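(* Consider the linear Gaussian model described in the context, with horizon $T\ge1$ and capacity $B\ge 0$, and the capacity-constrained continual learning problem $$\min_{(p_t),(q_t)}\ \sum_{t=1}^T\mathbb{E}\big[\|\theta_t-\hat\theta_t\|_2^2\big]$$ subject to: $S_0=0$; $S_{t+1}\sim p_t(\cdot\mid S_t,Y_{t+1})$ for $t=0,\dots,T-1$; $\hat\theta_t\sim q_t(\cdot\mid S_t)$ for $t=1,\dots,T$; and $\mathbb{I}(S_t;H_t)\le B$ for $t=1,\dots,T$. For each $t=1,\dots,T$, let $\bar\theta_t=\mathbb{E}[\theta_t\mid H_t]$, let $\lambda_{t1},\dots,\lambda_{td}$ be the eigenvalues of $\mathrm{Cov}[\bar\theta_t]$ with $U_t$ an orthogonal matrix of corresponding eigenvectors, let $\eta_t$ be the unique solution of $\sum_{i=1}^d[\log(2\lambda_{ti}/\eta)]^+=2B$, $B_{ti}=\frac12[\log(2\lambda_{ti}/\eta_t)]^+$, $D^F_t=\mathrm{diag}(1-e^{-2B_{t1}},\dots,1-e^{-2B_{td}})$, $D^\Psi_t=\mathrm{diag}\big((1-e^{-2B_{ti}})e^{-2B_{ti}}\lambda_{ti}\big)_{i=1}^d$, and define $$F_t=U_tD^F_tU_t^\top,\quad \Psi_t=U_tD^\Psi_tU_t^\top,\quad P_t=A\,\mathrm{Cov}[\theta_t\mid H_t]\,A^\top+\Sigma_\omega.$$ Suppose (1) $F_t$ is invertible for all $t=1,\dots,T$, and (2) for all $t=1,\dots,T-1$, in the positive semidefinite (Loewner) order, $$\big(I-P_tC^\top(CP_tC^\top+\Sigma_\nu)^{-1}C\big)AF_t^{-1}\Psi_tF_t^{-1}A^\top\big(I-C^\top(CP_tC^\top+\Sigma_\nu)^{-1}CP_t\big)\preceq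 F_{t+1}^{-1}\Psi_{t+1}F_{t+1}^{-1}.$$ Then an optimal solution to the capacity-constrained continual learning problem is a linear Gaussian agent, and its optimal total cost equals the optimal total cost of the relaxed capacity-constrained prediction problem $$\min_{(q_t)}\sum_{t=1}^T\mathbb{E}\big[\|\theta_t-\hat\theta_t\|_2^2\big]\ \text{ s.t. }\ \hat\theta_t\sim q_t(\cdot\mid H_t),\ \mathbb{I}(\hat\theta_t;H_t)\le B,\ t=1,\dots,T.$$
   Context: Model: $\theta_0\sim N(0,\Sigma_0)$ in $\mathbb{R}^d$; $\theta_{t+1}=A\theta_t+\omega_t$ with $\omega_t$ i.i.d. $N(0,\Sigma_\omega)$; $Y_t=C\theta_t+\nu_t\in\mathbb{R}^m$ with $\nu_t$ i.i.d. $N(0,\Sigma_\nu)$; $\theta_0,(\omega_t),(\nu_t)$ mutually independent; all model parameters known. $H_t=(Y_1,\dots,Y_t)$. $\mathrm{Cov}[\theta_t\mid H_t]$ is a deterministic matrix (Kalman filter posterior covariance). The notation $X\sim p(\cdot\mid Z)$ means $X$ is drawn from a conditional distribution given $Z$ alone (conditionally independent of everything else given $Z$). $S_t$ is the agent state. A linear Gaussian agent is one in which $S_{t+1}$ is a linear function of $(S_t,Y_{t+1})$ plus additive independent multivariate Gaussian noise, and $\hat\theta_t$ is a linear function of $S_t$ plus additive independent multivariate Gaussian noise. Logarithms are natural; $[x]^+=\max\{x,0\}$. *)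

(* Defs.v *)
From HB Require Import structures.
From mathcomp Require Import all_boot all_order all_algebra.
From mathcomp Require Import all_classical all_reals all_analysis.
Set Implicit Arguments. Unset Strict Implicit. Unset Printing Implicit Defensive.
Import Order.TTheory GRing.Theory Num.Theory.
Import numFieldNormedType.Exports.
Local Open Scope classical_set_scope.
Local Open Scope ring_scope.

(* R^n as a measurable space: column vectors 'cV[R]_n with the product       *)
(* (= Borel) sigma-algebra generated by the coordinate maps.                 *)
Section vec.
Variables (R : realType) (n : nat).
Definition vec := 'cV[R]_n.
HB.instance Definition _ := Choice.on vec.
HB.instance Definition _ := isPointed.Build vec 0.
Let coors : 'I_n -> vec -> R := fun i x => x i ord0.
Let v0 : g_sigma_preimage coors set0.
Proof. exact: sigma_algebra0. Qed.
Let vC A : g_sigma_preimage coors A -> g_sigma_preimage coors (~` A).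
Proof. exact: sigma_algebraC. Qed.
Let vU (F : _^nat) : (forall i, g_sigma_preimage coors (F i)) ->
  g_sigma_preimage coors (\bigcup_i (F i)).
Proof. exact: sigma_algebra_bigcup. Qed.
HB.instance Definition _ := @isMeasurable.Build default_measure_display
  vec (g_sigma_preimage coors) v0 vC vU.
End vec.

Section defs.
Variable R : realType.

Definition gauss1 (m v : R) : set R -> \bar R :=
  if v == 0 then (fun A => \d_m A) else normal_prob m (Num.sqrt v).

Definition is_gauss_measure n (nu : set (vec R n) -> \bar R)
    (mu : 'cV[R]_n) (S : 'M[R]_n) : Prop :=
  S^T = S /\ (forall a : 'cV[R]_n, 0 <= (a^T *m S *m a) ord0 ord0) /\
  forall (a : 'cV[R]_n) (A : set R), measurable A ->
    nu ((fun x : vec R n => (a^T *m x) ord0 ord0) @^-1` A) =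
    gauss1 ((a^T *m mu) ord0 ord0) ((a^T *m S *m a) ord0 ord0) A.

Definition psd n (S : 'M[R]_n) : Prop :=
  S^T = S /\ forall a : 'cV[R]_n, 0 <= (a^T *m S *m a) ord0 ord0.

Definition loewner_le n (M1 M2 : 'M[R]_n) : Prop :=
  forall x : 'cV[R]_n, (x^T *m M1 *m x) ord0 ord0 <= (x^T *m M2 *m x) ord0 ord0.

Section prob.
Context {dO : measure_display} {Om : measurableType dO} (P : probability Om R).

Definition Pr (E : set Om) : R := fine (P E).

Definition is_gauss_rv n (X : Om -> vec R n) (mu : 'cV[R]_n) (S : 'M[R]_n) :=
  is_gauss_measure (fun A => P (X @^-1` A)) mu S.

Definition ev {d'} {T : measurableType d'} (X : Om -> T) : set (set Om) :=
  [set E | exists2 A, measurable A & E = X @^-1` A].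

Definition mutually_independent n (F : 'I_n -> set (set Om)) : Prop :=
  forall E : 'I_n -> set Om, (forall i, F i (E i)) ->
    P (\bigcap_(i in [set: 'I_n]) E i) = (\prod_(i < n) Pr (E i))%:E.

(* "V ~ k( . | Z)", conditionally independent of everything in G given Z:   *)
(* the conditional law of V given sigma(G) (which contains sigma(Z)) is     *)
(* k(Z, .).                                                                 *)
Definition samples_from {dz dv} {Zt : measurableType dz} {Vt : measurableType dv}
    (Z : Om -> Zt) (k : R.-pker Zt ~> Vt) (V : Om -> Vt) (G : set (set Om)) :=
  forall A, measurable A -> forall E, <<s G >> E ->
    P (V @^-1` A `&` E) = (\int[P]_(w in E) k (Z w) A)%E.

(* mutual information, defined (Dobrushin / Pinsker) as the supremum over   *)
(* finite measurable partitions of the discrete mutual informations          *)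
Definition is_partition {d'} {T : measurableType d'} n (A : 'I_n -> set T) :=
  (forall i, measurable (A i)) /\ (forall i j, i != j -> A i `&` A j = set0) /\
  (forall x, exists i, A i x).

Definition xlog (p a b : R) : R := if p == 0 then 0 else p * ln (p / (a * b)).

Definition mutual_info {d1 d2} {T1 : measurableType d1} {T2 : measurableType d2}
    (U : Om -> T1) (V : Om -> T2) : \bar R :=
  ereal_sup [set z | exists n k (A : 'I_n -> set T1) (B : 'I_k -> set T2),
    [/\ is_partition A, is_partition B &
        z = (\sum_(i < n) \sum_(j < k)
               xlog (Pr (U @^-1` A i `&` V @^-1` B j)) (Pr (U @^-1` A i))
                    (Pr (V @^-1` B j)))%:E]].

(* conditional expectation E[X | H] = g(H) (Doob-Dynkin form) *)
Definition is_cond_exp n {dh} {Hs : measurableType dh}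
    (X : Om -> vec R n) (H : Om -> Hs) (g : Hs -> vec R n) : Prop :=
  measurable_fun setT g /\
  (forall i, P.-integrable setT (fun w => (g (H w) i ord0)%:E)) /\
  forall E, measurable E -> forall i,
    (\int[P]_(w in H @^-1` E) (X w i ord0)%:E =
     \int[P]_(w in H @^-1` E) (g (H w) i ord0)%:E)%E.

Definition is_cond_cov n {dh} {Hs : measurableType dh}
    (X : Om -> vec R n) (H : Om -> Hs) (K : 'M[R]_n) : Prop :=
  exists g, is_cond_exp X H g /\
    forall E, measurable E -> forall i j,
      (\int[P]_(w in H @^-1` E)
          ((X w i ord0 - g (H w) i ord0) * (X w j ord0 - g (H w) j ord0))%:E
       = (K i j)%:E * P (H @^-1` E))%E.

Definition mean n (Z : Om -> vec R n) (i : 'I_n) : R :=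
  fine (\int[P]_w (Z w i ord0)%:E)%E.

Definition covmx n (Z : Om -> vec R n) : 'M[R]_n :=
  \matrix_(i, j) fine (\int[P]_w
     ((Z w i ord0 - mean Z i) * (Z w j ord0 - mean Z j))%:E)%E.

Variables (d m : nat).

Definition hist (Y : nat -> Om -> vec R m) (t : nat) : Om -> t.-tuple (vec R m) :=
  fun w => [tuple Y i.+1 w | i < t].

Definition env_real (T : nat) (A : 'M[R]_d) (C : 'M[R]_(m, d))
    (S0 Sw : 'M[R]_d) (Sv : 'M[R]_m)
    (th : nat -> Om -> vec R d) (Y : nat -> Om -> vec R m) : Prop :=
  let om t := fun w => (th t.+1 w - A *m th t w : vec R d) in
  let nu t := fun w => (Y t w - C *m th t w : vec R m) in
  [/\ (forall t, measurable_fun setT (th t) /\ measurable_fun setT (Y t)),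
      is_gauss_rv (th 0) 0 S0,
      (forall t, (t < T)%N -> is_gauss_rv (om t) 0 Sw),
      (forall t, (1 <= t <= T)%N -> is_gauss_rv (nu t) 0 Sv) &
      mutually_independent (fun i : 'I_(T + T).+1 =>
        if (i == 0 :> nat) then ev (th 0)
        else if (i <= T)%N then ev (om i.-1)
        else ev (nu (i - T)%N))].

Definition env_events T (th : nat -> Om -> vec R d) (Y : nat -> Om -> vec R m) :=
  (\bigcup_(s in [set s | (s <= T)%N]) ev (th s)) `|`
  (\bigcup_(s in [set s | (1 <= s <= T)%N]) ev (Y s)).

Definition sqerr (x y : vec R d) : R := \sum_(i < d) (x i ord0 - y i ord0) ^+ 2.

Definition total_cost T (th th_hat : nat -> Om -> vec R d) : \bar R :=
  (\sum_(1 <= t < T.+1) \int[P]_w (sqerr (th t w) (th_hat t w))%:E)%E.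

Definition agent_real T A C S0 Sw Sv {dx} {X : measurableType dx} (x0 : X)
    (p : nat -> R.-pker (X * vec R m)%type ~> X) (q : nat -> R.-pker X ~> vec R d)
    th Y (S : nat -> Om -> X) (th_hat : nat -> Om -> vec R d) : Prop :=
  [/\ env_real T A C S0 Sw Sv th Y,
      (forall t, measurable_fun setT (S t) /\ measurable_fun setT (th_hat t)),
      forall w, S 0%N w = x0,
      forall t, (t < T)%N ->
        samples_from (fun w => (S t w, Y t.+1 w)) (p t) (S t.+1)
          (env_events T th Y `|` (\bigcup_(s in [set s | (s <= t)%N]) ev (S s))
            `|` (\bigcup_(s in [set s | (1 <= s <= t)%N]) ev (th_hat s))) &
      forall t, (1 <= t <= T)%N ->
        samples_from (S t) (q t) (th_hat t)
          (env_events T th Y `|` (\bigcup_(s in [set s | (s <= t)%N]) ev (S s))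
            `|` (\bigcup_(s in [set s | (1 <= s < t)%N]) ev (th_hat s)))].
End prob.

Arguments agent_real {dO Om} P {d m} T A C S0 Sw Sv {dx X} x0 p q th Y S th_hat.

Definition agent_costs d m T (A : 'M[R]_d) (C : 'M[R]_(m, d)) S0 Sw Sv (B : R)
    {dx} {X : measurableType dx} (x0 : X)
    (p : nat -> R.-pker (X * vec R m)%type ~> X) (q : nat -> R.-pker X ~> vec R d)
    : set (\bar R) :=
  [set c | exists (dO : measure_display) (Om : measurableType dO)
     (P : probability Om R) th Y (S : nat -> Om -> X) th_hat,
     [/\ agent_real P T A C S0 Sw Sv x0 p q th Y S th_hat,
         forall t, (1 <= t <= T)%N -> (mutual_info P (S t) (hist Y t) <= B%:E)%E &
         c = total_cost P T th th_hat]].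

Definition CL_costs d m T (A : 'M[R]_d) (C : 'M[R]_(m, d)) S0 Sw Sv (B : R)
    : set (\bar R) :=
  [set c | exists (dx : measure_display) (X : measurableType dx) (x0 : X)
     (p : nat -> R.-pker (X * vec R m)%type ~> X) (q : nat -> R.-pker X ~> vec R d),
     agent_costs T A C S0 Sw Sv B x0 p q c].

Definition RX_costs d m T (A : 'M[R]_d) (C : 'M[R]_(m, d)) S0 Sw Sv (B : R)
    : set (\bar R) :=
  [set c | exists (q : forall t : nat, R.-pker (t.-tuple (vec R m)) ~> vec R d)
     (dO : measure_display) (Om : measurableType dO) (P : probability Om R)
     th Y (th_hat : nat -> Om -> vec R d),
     [/\ env_real P T A C S0 Sw Sv th Y,
         (forall t, measurable_fun setT (th_hat t)),
         forall t, (1 <= t <= T)%N ->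
           samples_from P (hist Y t) (q t) (th_hat t)
             (env_events T th Y `|`
                (\bigcup_(s in [set s | (1 <= s < t)%N]) ev (th_hat s))),
         forall t, (1 <= t <= T)%N ->
           (mutual_info P (th_hat t) (hist Y t) <= B%:E)%E &
         c = total_cost P T th th_hat]].

Definition lin_gauss_agent d m k
    (p : nat -> R.-pker (vec R k * vec R m)%type ~> vec R k)
    (q : nat -> R.-pker (vec R k) ~> vec R d) : Prop :=
  exists (M : nat -> 'M[R]_k) (N : nat -> 'M[R]_(k, m)) (Q : nat -> 'M[R]_k)
         (G : nat -> 'M[R]_(d, k)) (Rq : nat -> 'M[R]_d),
    (forall t (s : vec R k) (y : vec R m),
        is_gauss_measure (p t (s, y)) (M t *m s + N t *m y) (Q t)) /\
    (forall t (s : vec R k), is_gauss_measure (q t s) (G t *m s) (Rq t)).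

Definition pos_part (x : R) : R := Num.max x 0.

Definition Bti (lam eta : R) : R := 2^-1 * pos_part (ln (2 * lam / eta)).

Definition DFmx d (lam : 'rV[R]_d) (eta : R) : 'M[R]_d :=
  diag_mx (\row_i (1 - expR (- (2 * Bti (lam ord0 i) eta)))).

Definition DPsimx d (lam : 'rV[R]_d) (eta : R) : 'M[R]_d :=
  diag_mx (\row_i ((1 - expR (- (2 * Bti (lam ord0 i) eta)))
                    * expR (- (2 * Bti (lam ord0 i) eta)) * lam ord0 i)).

End defs.

(* Main.v *)
Require Import Defs.
From HB Require Import structures.
From mathcomp Require Import all_boot all_order all_algebra.
From mathcomp Require Import all_classical all_reals all_analysis.
From mathcomp Require Import measurable_realfun ring lra zify.
Set Implicit Arguments. Unset Strict Implicit. Unset Printing Implicit Defensive.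
Import Order.TTheory GRing.Theory Num.Theory.
Import numFieldNormedType.Exports.
Local Open Scope classical_set_scope.
Local Open Scope ring_scope.

(* The common optimal cost is the sum over t of tr Cov[theta_t | H_t] + d D_t with D_t = eta_t / 2.

   Lower bound.  In any admissible experiment the filtering error theta_t - E[theta_t | H_t] is
   independent of H_t, hence of every estimate sampled from H_t or from an agent state, so the cost
   splits into the trace of the error covariance and E|thetabar_t - thetahat_t|^2.  By data
   processing I(thetahat_t; H_t) <= B, and the Donsker-Varadhan inequality with a Gaussian density
   ratio gives the reverse water-filling bound d D_t; invertibility of F_t means that every
   eigenvalue exceeds D_t.

   Attainment.  The agent S_t = thetabar_t + W_t with Cov W_t = F_t^-1 Psi_t F_t^-1 and estimate
   F_t S_t meets both constraints with equality.  It runs the Kalman recursion on its own noisy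
   state, which is possible because assumption (2) makes the increment
   Cov W_{t+1} - M_t Cov W_t M_t^T positive semidefinite, so that it can be supplied by fresh noise.

   All Gaussian vectors are represented by coefficient matrices over an orthonormal Gaussian frame:
   covariances become matrix products and orthogonality becomes independence. *)

(** * Integration *)

(** Three obstacles shape the development. Mutual information is a supremum over finite partitions,
    so a general experiment offers no density: lower bounds test finite quantisations with bounded
    functions and pass to the limit, whence the clamps and the errors exp(-N), while upper bounds
    integrate an explicit log-likelihood ratio over cells. Covariances may be singular: laws are
    identified through real characteristic functions E cos(a X + b), the phase b replacing the
    complex exponential, variance zero means a Dirac mass, and the Kalman gain uses a
    pseudo-inverse. Finally [Pc] and [Cb] are specified through all realisations of the environment,
    so one must be built before they can be computed.

    The level is D = eta / 2 because, once all components are active, the equation for eta reads: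
    the sum of ln (lam_i / D) is 2B. The noise variance D lam / (lam - D) is that of the additive
    channel whose best linear estimate has squared error exactly D, and 1 - D / lam is its
    regression coefficient. These are the eigenvalues of F^-1 Psi F^-1 and of F. *)

Section integration.
Import HBNNSimple.
Context d (T : measurableType d) (R : realType).
Implicit Types (mu : {measure set T -> \bar R}) (P : probability T R).

Lemma bounded_integrable P (f : T -> R) (M : R) : measurable_fun setT f ->
  (forall x, `|f x| <= M) -> P.-integrable setT (EFin \o f).
Proof.
move=> mf fM; apply: measurable_bounded_integrable => //.
  exact: (le_lt_trans (probability_le1 P measurableT) (ltry 1)).
by exists M; split; [exact: num_real|move=> x Mx t _; exact: le_trans (fM t) (ltW Mx)].
Qed.

Lemma measurable_fun_bigsum (I : Type) (r : seq I) (Q : pred I) (f : I -> T -> R) :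
  (forall i, measurable_fun setT (f i)) ->
  measurable_fun setT (fun x => \sum_(i <- r | Q i) f i x).
Proof.
move=> mf; elim: r => [|i r ih].
  by under eq_fun do rewrite big_nil; exact: measurable_cst.
under eq_fun do rewrite big_cons; case: (Q i) => //.
exact: measurable_funD.
Qed.

Lemma measurable_fun_bigprod (I : Type) (r : seq I) (Q : pred I) (f : I -> T -> R) :
  (forall i, measurable_fun setT (f i)) ->
  measurable_fun setT (fun x => \prod_(i <- r | Q i) f i x).
Proof.
move=> mf; elim: r => [|i r ih].
  by under eq_fun do rewrite big_nil; exact: measurable_cst.
under eq_fun do rewrite big_cons; case: (Q i) => //.
exact: measurable_funM.
Qed.

Lemma integrableRZ mu (k : R) (f : T -> R) : mu.-integrable setT (EFin \o f) ->
  mu.-integrable setT (EFin \o (fun x => k * f x)).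
Proof. by move=> fi; exact: (integrableZl measurableT k fi). Qed.

Lemma integrableRD mu (f g : T -> R) : mu.-integrable setT (EFin \o f) ->
  mu.-integrable setT (EFin \o g) ->
  mu.-integrable setT (EFin \o (fun x => f x + g x)).
Proof. by move=> fi gi; exact: (integrableD measurableT fi gi). Qed.

Lemma integrableRB mu (f g : T -> R) : mu.-integrable setT (EFin \o f) ->
  mu.-integrable setT (EFin \o g) ->
  mu.-integrable setT (EFin \o (fun x => f x - g x)).
Proof. by move=> fi gi; exact: (integrableB measurableT fi gi). Qed.

Lemma integrableR_sum mu (I : Type) (r : seq I) (Q : pred I) (f : I -> T -> R) :
  (forall i, mu.-integrable setT (EFin \o f i)) ->
  mu.-integrable setT (EFin \o (fun x => \sum_(i <- r | Q i) f i x)).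
Proof.
move=> fi; have -> : EFin \o (fun x => \sum_(i <- r | Q i) f i x) =
    (fun x => \sum_(i <- r | Q i) (f i x)%:E)%E.
  by apply/funext => x /=; rewrite sumEFin.
by apply: integrable_sum => // i _; exact: fi.
Qed.

Lemma Rintegral_sum mu (I : Type) (r : seq I) (Q : pred I) (f : I -> T -> R) :
  (forall i, mu.-integrable setT (EFin \o f i)) ->
  \int[mu]_x (\sum_(i <- r | Q i) f i x) = \sum_(i <- r | Q i) \int[mu]_x f i x.
Proof.
move=> fi; elim: r => [|i r ih].
  under eq_Rintegral do rewrite big_nil.
  by rewrite big_nil /Rintegral integral0.
under eq_Rintegral do rewrite big_cons.
rewrite big_cons; case: (Q i) => //.
by rewrite RintegralD ?ih//; exact: integrableR_sum.
Qed.

Lemma Rintegral_dominated_cvg mu (f_ : nat -> T -> R) (f g : T -> R) :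
  (forall n, measurable_fun setT (f_ n)) ->
  (forall x, f_ ^~ x @ \oo --> f x) ->
  mu.-integrable setT (EFin \o g) ->
  (forall n x, `|f_ n x| <= g x) ->
  mu.-integrable setT (EFin \o f) /\
  (\int[mu]_x f_ n x @[n --> \oo] --> \int[mu]_x f x).
Proof.
move=> mf_ cf ig fg.
have mf : measurable_fun setT f by apply: measurable_fun_cvg => // x _; exact: cf.
have cf' x : [set: T] x -> EFin \o f_ ^~ x @ \oo --> (EFin \o f) x.
  by move=> _; apply: cvg_EFin; [exact: nearW|exact: cf].
have [i _ c] := @dominated_convergence _ _ _ mu setT measurableT
  (fun n => EFin \o f_ n) (EFin \o f) (EFin \o g)
  (fun n => (measurable_EFinP _ _).2 (mf_ n)) ((measurable_EFinP _ _).2 mf)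
  (aeW mu cf') ig
  (aeW mu (fun x n _ => fg n x)).
split => //; rewrite /Rintegral; apply: fine_cvg; rewrite fineK//.
exact: integrable_fin_num.
Qed.

(** True for indicators by hypothesis and for simple functions by linearity; both sides pass to the
    monotone limit along [nnsfun_approx]. *)
Lemma ge0_density_integral mu (nu : {measure set T -> \bar R}) (p : T -> R) (f : T -> \bar R) :
  measurable_fun setT p -> (forall x, 0 <= p x) ->
  (forall A, measurable A -> nu A = \int[mu]_(x in A) (p x)%:E)%E ->
  measurable_fun setT f -> (forall x, 0 <= f x)%E ->
  (\int[nu]_x f x = \int[mu]_x (f x * (p x)%:E))%E.
Proof.
move=> mp p0 nuE mf f0.
have mp' : measurable_fun setT (EFin \o p) by exact/measurable_EFinP.
pose h := nnsfun_approx measurableT mf.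
have -> : (\int[nu]_x f x = limn (fun n => \int[nu]_x (h n x)%:E))%E.
  have fE x : f x = limn (fun n => (h n x)%:E).
    by apply/esym/cvg_lim => //; apply: cvg_nnsfun_approx.
  under eq_integral => x _ do rewrite fE.
  apply: monotone_convergence => //.
  - by move=> n; apply/measurable_EFinP.
  - by move=> n x _; rewrite lee_fin.
  - by move=> x _ a b ab; rewrite lee_fin; exact/lefP/nd_nnsfun_approx.
have -> : (\int[mu]_x (f x * (p x)%:E) =
           limn (fun n => \int[mu]_x ((h n x)%:E * (p x)%:E)))%E.
  have fE x : (f x * (p x)%:E = limn (fun n => (h n x)%:E * (p x)%:E))%E.
    by apply/esym/cvg_lim => //; apply: cvgeZr => //; apply: cvg_nnsfun_approx.
  under eq_integral => x _ do rewrite fE.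
  apply: monotone_convergence => //.
  - by move=> n; apply: emeasurable_funM => //; apply/measurable_EFinP.
  - by move=> n x _; rewrite mule_ge0 ?lee_fin.
  - move=> x _ a b ab; rewrite lee_wpmul2r ?lee_fin//.
    exact/lefP/nd_nnsfun_approx.
congr (limn _); apply/funext => n.
transitivity (\int[nu]_x
   (\sum_(y \in range (h n)) (y * \1_(h n @^-1` [set y]) x)%:E))%E.
  by apply: eq_integral => t _; rewrite /= fimfunE -fsumEFin.
have mi r : measurable_fun setT (fun x => (r * \1_(h n @^-1` [set r]) x)%:E).
  by apply/measurable_EFinP; exact: measurable_funM.
rewrite ge0_integral_fsum//; last by move=> y x _; exact: nnfun_muleindic_ge0.
transitivity (\int[mu]_x (\sum_(y \in range (h n))
    (y * \1_(h n @^-1` [set y]) x)%:E * (p x)%:E))%E; last first.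
  apply: eq_integral => x _.
  rewrite -ge0_mule_fsuml => [|y]; last exact: nnfun_muleindic_ge0.
  by rewrite fsumEFin // -(fimfunE _ x).
rewrite ge0_integral_fsum//; last 2 first.
  - by move=> y; apply: emeasurable_funM.
  - move=> y x _; apply: mule_ge0; last by rewrite lee_fin.
    exact: nnfun_muleindic_ge0.
apply: eq_fsbigr => r; rewrite inE => -[x _ hx].
have r0 : 0 <= r by rewrite -hx.
under eq_integral do rewrite EFinM.
rewrite ge0_integralZl//; last by apply/measurable_EFinP.
rewrite integral_indic// setIT.
under [RHS]eq_integral do rewrite EFinM -muleA.
rewrite ge0_integralZl//; last 2 first.
  - by apply: emeasurable_funM => //; apply/measurable_EFinP.
  - by move=> y _; rewrite mule_ge0 ?lee_fin.
congr (_ * _)%E; rewrite nuE// integral_mkcond; apply: eq_integral => y _.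
by rewrite patchE indicE; case: ifP => _; rewrite ?mul1e ?mul0e.
Qed.

(** No integrability is asked for: since [p] is nonnegative, multiplying by it commutes with taking
    positive and negative parts, and each part is covered by the nonnegative case. *)
Lemma density_Rintegral mu (nu : {measure set T -> \bar R}) (p : T -> R) (f : T -> R) :
  measurable_fun setT p -> (forall x, 0 <= p x) ->
  (forall A, measurable A -> nu A = \int[mu]_(x in A) (p x)%:E)%E ->
  measurable_fun setT f ->
  \int[nu]_x f x = \int[mu]_x (f x * p x).
Proof.
move=> mp p0 nuE mf; rewrite /Rintegral; congr fine.
have mf' : measurable_fun setT (EFin \o f) by exact/measurable_EFinP.
rewrite integralE [in RHS]integralE; congr (_ - _)%E.
  rewrite (ge0_density_integral mp p0 nuE)//; last exact: measurable_funepos.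
  apply: eq_integral => x _; rewrite !funeposE /maxe !lte_fin /=.
  have [fx|fx] := ltP (f x) 0.
    have fp : f x * p x <= 0 by rewrite mulr_le0_ge0// ltW.
    case: ltP => fp'; first by rewrite mul0e.
    by rewrite mul0e; congr EFin; apply/eqP; rewrite eq_le fp' fp.
  by rewrite ltNge mulr_ge0.
rewrite (ge0_density_integral mp p0 nuE)//; last exact: measurable_funeneg.
apply: eq_integral => x _; rewrite !funenegE /maxe !lte_fin /= !oppr_lt0.
have [fx|fx] := ltP 0 (f x).
  rewrite mul0e; case: ltP => // fp'; congr EFin; apply/eqP.
  by rewrite eq_sym oppr_eq0 eq_le fp' mulr_ge0// ltW.
by rewrite ltNge mulr_le0_ge0//= -EFinM mulNr.
Qed.

End integration.

(** * The normal distribution *)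

Section normal.
Context {R : realType}.
Local Notation mu := (@lebesgue_measure R).
Implicit Types (m s a x : R).

(** The fundamental theorem of calculus on growing intervals, with boundary terms killed by the
    decay [K] / |x - m|. Every Gaussian integration by parts below is an instance. *)
Lemma Rintegral_derivative_eq0 (H h : R -> R) m (K : R) :
  (forall x, is_derive x 1 H (h x)) -> continuous h ->
  mu.-integrable setT (EFin \o h) ->
  (forall x, `|x - m| * `|H x| <= K) ->
  \int[mu]_x h x = 0.
Proof.
move=> dH ch ih HK.
have HE n : \int[mu]_x (h x * \1_(`[- n.+1%:R, n.+1%:R]) x) = H n.+1%:R - H (- n.+1%:R).
  have n0 : - n.+1%:R < n.+1%:R :> R by rewrite gtrN.
  have dH' x : derivable H x 1 by case: (dH x).
  have cH : continuous H by move=> x; exact/differentiable_continuous/derivable1_diffP.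
  have := @continuous_FTC2 _ h H _ _ n0 _ _ _.
  rewrite /Rintegral => FTC; rewrite -[RHS]/(fine (_)%:E) EFinB -FTC//.
  - congr fine; rewrite [RHS]integral_mkcond; apply: eq_integral => x _.
    by rewrite patchE indicE; case: ifP => _; rewrite ?mulr1 ?mulr0.
  - exact: continuous_subspaceT.
  - split=> [x _//||]; first by apply: cvg_at_right_filter; exact: cH.
    by apply: cvg_at_left_filter; exact: cH.
  - by move=> x _; rewrite derive1E; case: (dH x).
have [||||_] := @Rintegral_dominated_cvg _ _ _ mu
  (fun n x => h x * \1_(`[- n.+1%:R, n.+1%:R]) x) h (fun x => `|h x|).
- move=> n; apply: measurable_funM; last exact: measurable_indic.
  exact: continuous_measurable_fun.
- move=> x; apply/cvgrPdist_lt => e e0; near=> n.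
  rewrite indicE mem_set ?mulr1 ?subrr ?normr0//=.
  rewrite in_itv/= -ler_norml; near: n.
  exists (Num.truncn `|x|) => //= n /= xn; apply: ltW.
  by apply: lt_le_trans (truncnS_gt _) _; rewrite ler_nat ltnS.
- exact: integrable_norm.
- move=> n x; rewrite normrM ler_piMr// indicE.
  by case: (_ \in _); rewrite ?normr1 ?normr0.
move=> /cvg_lim <- //; under eq_fun do rewrite HE.
apply/cvg_lim => //.
(* One statement for both endpoints: it only uses that [u n] moves away from [m] at least as fast as
   n - |m|. *)
suff c0 (u : nat -> R) : (forall n, n%:R - `|m| <= `|u n - m|) -> H (u n) @[n --> \oo] --> (0 : R).
  rewrite -[X in _ --> X]subr0; apply: cvgB.
    apply: (c0 (fun n => n.+1%:R)) => n.
    have : n%:R <= n.+1%:R :> R by rewrite ler_nat.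
    have := ler_norm m; have := ler_norm (n.+1%:R - m); lra.
  apply: (c0 (fun n => - n.+1%:R)) => n.
  have : n%:R <= n.+1%:R :> R by rewrite ler_nat.
  have := ler_norm (- m); have := ler_norm (- (- n.+1%:R - m)); rewrite !normrN; lra.
move=> un; apply/cvgrPdist_lt => e e0; near=> n.
rewrite sub0r normrN.
have K0 : 0 <= K by apply: le_trans (HK 0); rewrite mulr_ge0.
have n1 : (K + 1) / e + `|m| < n%:R.
  near: n; exists (Num.truncn ((K + 1) / e + `|m|)).+1 => //= n /= xn.
  by apply: lt_le_trans (truncnS_gt _) _; rewrite ler_nat.
have n2 : (K + 1) / e < `|u n - m| by have := un n; lra.
have n3 : K + 1 < `|u n - m| * e by rewrite -ltr_pdivrMr.
rewrite ltNge; apply/negP => eH.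
have : `|u n - m| * e <= `|u n - m| * `|H (u n)| by rewrite ler_wpM2l.
by have := HK (u n); lra.
Unshelve. all: end_near. Qed.

(** The exponential splits into two equal factors exp(-c y) with y = (x - m)^2. One absorbs 1 + y,
    because exp(c y) dominates 1 + c y; the other is, up to its peak, the density with doubled
    variance. This gives one integrable majorant for all moments up to order two. *)
Lemma normal_pdf_moment_bound m s : s != 0 -> exists K : R, 0 <= K /\
  forall x, (1 + (x - m) ^+ 2) * normal_pdf m s x
            <= K * normal_pdf m (Num.sqrt 2 * s) x.
Proof.
move=> s0; have s2 : Num.sqrt 2 * s != 0 by rewrite mulf_neq0// gt_eqF// sqrtr_gt0.
rewrite !normal_pdfE//.
set p := normal_peak s; set p' := normal_peak (_ * _).
have p0 : 0 <= p by exact: normal_peak_ge0.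
have p'0 : 0 < p' by exact: normal_peak_gt0.
pose c := (4 * s ^+ 2)^-1.
have c0 : 0 < c by rewrite invr_gt0 mulr_gt0// exprn_even_gt0.
exists (p * (1 + c^-1) / p'); split.
  apply: divr_ge0; last exact: ltW.
  by apply: mulr_ge0 => //; rewrite addr_ge0// invr_ge0 ltW.
move=> x; rewrite /normal_fun.
have -> : - (x - m) ^+ 2 / (s ^+ 2 *+ 2) = - (c * (x - m) ^+ 2) + - (c * (x - m) ^+ 2).
  by rewrite /c; field.
have -> : - (x - m) ^+ 2 / ((Num.sqrt 2 * s) ^+ 2 *+ 2) = - (c * (x - m) ^+ 2).
  by rewrite exprMn sqr_sqrtr// /c; field.
rewrite expRD; set y := (x - m) ^+ 2; have y0 : 0 <= y by exact: sqr_ge0.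
set E := expR _; have E0 : 0 < E by exact: expR_gt0.
have key : (1 + y) * E <= 1 + c^-1.
  rewrite /E expRN ler_pdivrMr ?expR_gt0//.
  apply: le_trans (_ : (1 + c^-1) * (1 + c * y) <= _).
    rewrite mulrDl mul1r mulrDr mulr1 mulKf ?gt_eqF//.
    have : 0 <= c^-1 by rewrite invr_ge0 ltW.
    have : 0 <= c * y by rewrite mulr_ge0// ltW.
    lra.
  by rewrite ler_wpM2l ?expR_ge1Dx// addr_ge0// invr_ge0 ltW.
have -> : p * (1 + c^-1) / p' * (p' * E) = (p * E) * (1 + c^-1).
  by field; rewrite (gt_eqF c0) (gt_eqF p'0).
have -> : (1 + y) * (p * (E * E)) = (p * E) * ((1 + y) * E) by ring.
by rewrite ler_wpM2l// mulr_ge0// ltW.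
Qed.

Lemma normal_pdf_moment_integrable m s (f : R -> R) : s != 0 ->
  measurable_fun setT f -> (forall x, `|f x| <= 1 + (x - m) ^+ 2) ->
  mu.-integrable setT (fun x => (f x * normal_pdf m s x)%:E).
Proof.
move=> s0 mf fb; have [K [K0 HK]] := normal_pdf_moment_bound m s0.
apply: (@le_integrable _ _ _ mu setT measurableT _
  (fun x => (K * normal_pdf m (Num.sqrt 2 * s) x)%:E)).
- apply/measurable_EFinP/measurable_funM => //; exact: measurable_normal_pdf.
- move=> x _; rewrite lee_fin normrM (ger0_norm (normal_pdf_ge0 _ _ _)).
  apply: le_trans (ler_norm _); apply: le_trans (HK x).
  by rewrite ler_wpM2r// normal_pdf_ge0.
- under eq_fun do rewrite EFinM.
  by apply: integrableZl => //; exact: integrable_normal_pdf.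
Qed.

Lemma normal_pdf_moment_le m s : s != 0 -> exists K : R,
  forall x, (1 + (x - m) ^+ 2) * normal_pdf m s x <= K.
Proof.
move=> s0; have [K [K0 HK]] := normal_pdf_moment_bound m s0.
exists (K * normal_peak (Num.sqrt 2 * s)) => x; apply: le_trans (HK x) _.
rewrite ler_wpM2l// normal_pdf_ub// mulf_neq0// gt_eqF// sqrtr_gt0//.
Qed.

Lemma is_derive_affine a b x : is_derive x 1 (fun x => a * x + b) a.
Proof.
have := is_deriveD (is_deriveZ a (is_derive_id x (1 : R))) (is_derive_cst b x 1).
by rewrite addr0 /GRing.scale/= mulr1.
Qed.

Lemma is_derive_normal_pdf m s x : s != 0 ->
  is_derive x 1 (normal_pdf m s) (- ((x - m) / s ^+ 2 * normal_pdf m s x)).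
Proof.
move=> s0; rewrite normal_pdfE//.
have d1 : is_derive x 1 (fun x => 1 * x + - m) (1 : R) by exact: is_derive_affine.
have d2 := @is_deriveX _ _ _ 2 _ _ _ d1.
have d3 := @is_deriveZ _ _ _ _ (- (s ^+ 2 *+ 2)^-1) _ _ _ d2.
have d4 := @is_derive1_comp _ expR _ _ _ _ (is_derive_expR _) d3.
have d5 := @is_deriveZ _ _ _ _ (normal_peak s) _ _ _ d4.
have e : (fun x => normal_peak s * normal_fun m s x) =
  (normal_peak s \*: (expR \o (- (s ^+ 2 *+ 2)^-1 \*: (fun x => 1 * x + - m) ^+ 2))).
  apply/funext => y; rewrite /normal_fun /= /GRing.scale /= !fctE /GRing.scale/=.
  by rewrite mul1r; congr (_ * expR _); rewrite !mulNr mulrC.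
rewrite -e in d5; apply: is_derive_eq d5 _.
rewrite /GRing.scale /= !fctE /= /GRing.scale /= /normal_fun !mul1r mulr1.
have -> : - (s ^+ 2 *+ 2)^-1 * (x - m) ^+ 2 = - (x - m) ^+ 2 / (s ^+ 2 *+ 2).
  by rewrite !mulNr mulrC.
by field.
Qed.

Lemma continuous_is_derive (f df : R -> R) : (forall x, is_derive x 1 f (df x)) ->
  continuous f.
Proof.
by move=> dfx x; apply/differentiable_continuous/derivable1_diffP; case: (dfx x).
Qed.

Lemma is_derive_sin_affine a b x :
  is_derive x 1 (fun x => sin (a * x + b)) (cos (a * x + b) * a).
Proof.
exact: (@is_derive1_comp _ _ _ _ _ _ (is_derive_sin _) (is_derive_affine a b x)).
Qed.

Lemma is_derive_cos_affine a b x :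
  is_derive x 1 (fun x => cos (a * x + b)) (- sin (a * x + b) * a).
Proof.
exact: (@is_derive1_comp _ _ _ _ _ _ (is_derive_cos _) (is_derive_affine a b x)).
Qed.

Lemma is_derive_mul (f g : R -> R) (df dg x : R) : is_derive x 1 f df ->
  is_derive x 1 g dg -> is_derive x 1 (fun x => f x * g x) (f x * dg + g x * df).
Proof. by move=> df' dg'; have := is_deriveM df' dg'. Qed.

Lemma norm_le_1sqr (y : R) : `|y| <= 1 + y ^+ 2.
Proof.
rewrite ler_norml; apply/andP; split.
  have := sqr_ge0 (y + 1); rewrite sqrrD mulr1 expr1n => H.
  by have := sqr_ge0 y; lra.
have := sqr_ge0 (y - 1); rewrite sqrrB mulr1 expr1n => H.
by have := sqr_ge0 y; lra.
Qed.

Lemma norm_cos_le1 (y : R) : `|cos y| <= 1.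
Proof. by rewrite ler_norml cos_geN1 cos_le1. Qed.

Lemma norm_sin_le1 (y : R) : `|sin y| <= 1.
Proof. by rewrite ler_norml sin_geN1 sin_le1. Qed.

Lemma measurable_cosT : measurable_fun [set: R] (@cos R).
Proof. by apply: continuous_measurable_fun; exact: continuous_cos. Qed.

Lemma measurable_sinT : measurable_fun [set: R] (@sin R).
Proof. by apply: continuous_measurable_fun; exact: continuous_sin. Qed.

Lemma measurable_affine a b : measurable_fun [set: R] (fun x : R => a * x + b).
Proof. by apply: measurable_funD => //; apply: measurable_funM. Qed.

(** Stein's identity for a sine: the derivative of sin (a x + b) times the density integrates to
    zero. It turns the derivative of the characteristic function into a multiple of the function
    itself. *)
Lemma normal_pdf_sin_stein m s a b : s != 0 ->
  \int[mu]_x ((x - m) * sin (a * x + b) * normal_pdf m s x) =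
  a * s ^+ 2 * \int[mu]_x (cos (a * x + b) * normal_pdf m s x).
Proof.
move=> s0; have [K HK] := normal_pdf_moment_le m s0.
have s20 : s ^+ 2 != 0 by rewrite expf_neq0.
have icos : mu.-integrable setT (fun x => (cos (a * x + b) * normal_pdf m s x)%:E).
  apply: normal_pdf_moment_integrable => //.
    by apply: measurableT_comp; [exact: measurable_cosT|exact: measurable_affine].
  by move=> x; rewrite (le_trans (norm_cos_le1 _))// lerDl sqr_ge0.
have isin : mu.-integrable setT (fun x => ((x - m) * sin (a * x + b) * normal_pdf m s x)%:E).
  apply: normal_pdf_moment_integrable => //.
    apply: measurable_funM; first exact: measurable_funB.
    by apply: measurableT_comp; [exact: measurable_sinT|exact: measurable_affine].
  move=> x; rewrite normrM; apply: le_trans (norm_le_1sqr _).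
  by rewrite ler_piMr// norm_sin_le1.
pose H x := sin (a * x + b) * normal_pdf m s x.
pose h x := a * (cos (a * x + b) * normal_pdf m s x) -
            (s ^+ 2)^-1 * ((x - m) * sin (a * x + b) * normal_pdf m s x).
have dH x : is_derive x 1 H (h x).
  apply: is_derive_eq (is_derive_mul (is_derive_sin_affine a b x) (is_derive_normal_pdf m x s0)) _.
  by rewrite /h; field.
have cpdf := @continuous_normal_pdf _ m s s0.
have csin := continuous_is_derive (is_derive_sin_affine a b).
have ccos := continuous_is_derive (is_derive_cos_affine a b).
have ih : mu.-integrable setT (EFin \o h).
  rewrite /comp; under eq_fun do rewrite EFinB !EFinM.
  by apply: integrableB => //; apply: integrableZl.
have := @Rintegral_derivative_eq0 H h m K dH _ ih _.
rewrite /h RintegralB//; last 2 first.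
- exact: integrableRZ.
- exact: integrableRZ.
rewrite !RintegralZl// => e.
suff : a * \int[mu]_x (cos (a * x + b) * normal_pdf m s x) -
   (s ^+ 2)^-1 * \int[mu]_x ((x - m) * sin (a * x + b) * normal_pdf m s x) = 0.
  move/eqP; rewrite subr_eq0 => /eqP e'.
  by rewrite -(mulrA a) (mulrC (s ^+ 2)) mulrA e' mulrAC mulVf// mul1r.
apply: e => [x|x].
  apply: cvgB; apply: cvgM; try exact: cvg_cst.
    by apply: cvgM; [exact: ccos|exact: cpdf].
  apply: cvgM; last exact: cpdf.
  apply: cvgM; last exact: csin.
  by apply: cvgB; [exact: cvg_id|exact: cvg_cst].
rewrite normrM (ger0_norm (normal_pdf_ge0 _ _ _)) mulrA.
apply: le_trans (HK x); rewrite ler_wpM2r ?normal_pdf_ge0//.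
apply: le_trans (norm_le_1sqr _); rewrite ler_piMr// norm_sin_le1//.
Qed.

(** As a function of the frequency, the integral [F] solves F' = - a s^2 F, so its product with exp
    (s^2 a^2 / 2) is constant and is evaluated at frequency 0. *)
Lemma normal_pdf_cos m s a b : s != 0 ->
  \int[mu]_x (cos (a * (x - m) + b) * normal_pdf m s x) =
  cos b * expR (- (a ^+ 2 * s ^+ 2 / 2)).
Proof.
move=> s0.
pose f (a x : R) := cos (a * (x - m) + b) * normal_pdf m s x.
pose F a := \int[mu]_(x in setT) f a x.
have df a' y : is_derive a' 1 (f ^~ y) (- ((y - m) * sin (a' * (y - m) + b) * normal_pdf m s y)).
  have -> : f ^~ y = (fun a => cos ((y - m) * a + b) * cst (normal_pdf m s y) a).
    by apply/funext => z; rewrite /f mulrC (mulrC z) mulrC.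
  apply: is_derive_eq (is_derive_mul (is_derive_cos_affine _ _ _) (is_derive_cst _ _ _)) _.
  by rewrite /cst mulr0 add0r (mulrC (y - m)); ring.
have int1 a' : mu.-integrable setT (EFin \o f a').
  apply: normal_pdf_moment_integrable => //.
    apply: (measurableT_comp measurable_cosT).
    apply: measurable_funD => //; apply: measurable_funM => //.
    exact: measurable_funB.
  by move=> x; rewrite (le_trans (norm_cos_le1 _))// lerDl sqr_ge0.
have dF a' : is_derive a' 1 F (- (a' * s ^+ 2) * F a').
  (* Differentiation under the integral sign needs an open window of frequencies with one common
     majorant; (1 + (y - m)^2) times the density serves for every window. *)
  have Ia : `]a' - 1, a' + 1[%classic a' by rewrite /= in_itv/=; apply/andP; split; lra.
  have G_ub x y : `]a' - 1, a' + 1[%classic x -> [set: R] y ->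
    `|partial1of2 f x y| <= (1 + (y - m) ^+ 2) * normal_pdf m s y.
    move=> _ _; rewrite /partial1of2 derive1E derive_val normrN normrM.
    rewrite (ger0_norm (normal_pdf_ge0 _ _ _)) ler_wpM2r ?normal_pdf_ge0//.
    rewrite normrM; apply: le_trans (norm_le_1sqr _).
    by rewrite ler_piMr// norm_sin_le1.
  have iG : mu.-integrable setT (EFin \o (fun y => (1 + (y - m) ^+ 2) * normal_pdf m s y)).
    apply: normal_pdf_moment_integrable => //.
      apply: measurable_funD => //; apply: measurable_funX; exact: measurable_funB.
    by move=> x; rewrite ger0_norm// addr_ge0// sqr_ge0.
  have G0 y : 0 <= (1 + (y - m) ^+ 2) * normal_pdf m s y.
    by rewrite mulr_ge0 ?normal_pdf_ge0// addr_ge0// sqr_ge0.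
  have der x y : `]a' - 1, a' + 1[%classic x -> [set: R] y -> derivable (f ^~ y) x 1.
    by move=> _ _; case: (df x y).
  have int2 x : `]a' - 1, a' + 1[%classic x -> mu.-integrable setT (EFin \o f x) by [].
  apply: DeriveDef; first exact: (derivable_under_integral measurableT Ia int2 der G0 iG G_ub).
  rewrite -derive1E (differentiation_under_integral measurableT Ia int2 der G0 iG G_ub).
  transitivity (- \int[mu]_y ((y - m) * sin (a' * y + (b - a' * m)) * normal_pdf m s y)).
    rewrite -mulN1r -RintegralZl//.
      apply: eq_Rintegral => y _; rewrite /partial1of2 derive1E derive_val mulN1r.
      by rewrite (_ : a' * (y - m) + b = a' * y + (b - a' * m))//; ring.
    apply: normal_pdf_moment_integrable => //.
      apply: measurable_funM; first exact: measurable_funB.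
      by apply: measurableT_comp; [exact: measurable_sinT|exact: measurable_affine].
    move=> x; rewrite normrM; apply: le_trans (norm_le_1sqr _).
    by rewrite ler_piMr// norm_sin_le1.
  rewrite normal_pdf_sin_stein// mulNr; congr (- (_ * _)).
  apply: eq_Rintegral => y _; rewrite /f.
  by rewrite (_ : a' * (y - m) + b = a' * y + (b - a' * m))//; ring.
(* The integrating factor of the differential equation for [F]. *)
pose E a' : R := expR (s ^+ 2 / 2 * a' ^+ 2).
have dE a' : is_derive a' 1 E (s ^+ 2 * a' * E a').
  have d2 := @is_deriveX _ _ _ 2 _ _ _ (is_derive_affine 1 0 a').
  have d3 := @is_deriveZ _ _ _ _ (s ^+ 2 / 2) _ _ _ d2.
  have d4 := @is_derive1_comp _ expR _ _ _ _ (is_derive_expR _) d3.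
  have e : E = expR \o (s ^+ 2 / 2 \*: (fun x => 1 * x + 0) ^+ 2).
    by apply/funext => y; rewrite /E /= /GRing.scale /= !fctE /GRing.scale/= mul1r addr0.
  rewrite -e in d4; apply: is_derive_eq d4 _.
  by rewrite /E /GRing.scale /= !fctE /= /GRing.scale /= !mul1r !addr0 mulr1; field.
have dFE a' : is_derive a' 1 (fun a => F a * E a) 0.
  by apply: is_derive_eq (is_derive_mul (dF a') (dE a')) _; ring.
have := is_derive_0_is_cst a 0 dFE.
rewrite /E expr0n/= mulr0 expR0 mulr1 => FE.
have F0 : F 0 = cos b.
  rewrite /F /f; under eq_Rintegral do rewrite mul0r add0r.
  rewrite RintegralZl//; last exact: integrable_normal_pdf.
  by rewrite /Rintegral integral_normal_pdf mulr1.
rewrite -[LHS]/(F a) -F0 -FE expRN (_ : a ^+ 2 * s ^+ 2 / 2 = s ^+ 2 / 2 * a ^+ 2); last by ring.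
by rewrite mulfK// gt_eqF// expR_gt0.
Qed.

(** Integrates the derivative of (x - m) times the density, which is the density minus (x - m)^2 /
    s^2 times the density. *)
Lemma normal_pdf_var m s : s != 0 ->
  \int[mu]_x ((x - m) ^+ 2 * normal_pdf m s x) = s ^+ 2.
Proof.
move=> s0; have [K HK] := normal_pdf_moment_le m s0.
have s20 : s ^+ 2 != 0 by rewrite expf_neq0.
have i2 : mu.-integrable setT (fun x => ((x - m) ^+ 2 * normal_pdf m s x)%:E).
  apply: normal_pdf_moment_integrable => //.
    by apply: measurable_funX; exact: measurable_funB.
  by move=> x; rewrite ger0_norm ?sqr_ge0// lerDr.
have i0 := integrable_normal_pdf m s.
pose H x := (1 * x + - m) * normal_pdf m s x.
pose h x := normal_pdf m s x - (s ^+ 2)^-1 * ((x - m) ^+ 2 * normal_pdf m s x).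
have dH x : is_derive x 1 H (h x).
  apply: is_derive_eq (is_derive_mul (is_derive_affine 1 (- m) x) (is_derive_normal_pdf m x s0)) _.
  by rewrite /h; field.
have cpdf := @continuous_normal_pdf _ m s s0.
have ih : mu.-integrable setT (EFin \o h).
  rewrite /comp; under eq_fun do rewrite EFinB EFinM.
  by apply: integrableB => //; apply: integrableZl.
have e : \int[mu]_x h x = 0.
  apply: (@Rintegral_derivative_eq0 H h m K dH _ ih _) => [x|x].
    apply: cvgB; first exact: cpdf.
    apply: cvgM; first exact: cvg_cst.
    apply: cvgM; last exact: cpdf.
    apply: (@cvg_comp _ _ _ (fun x => x - m) (fun x => x ^+ 2)); last exact: exprn_continuous.
    by apply: cvgB; [exact: cvg_id|exact: cvg_cst].
  rewrite /H mul1r normrM (ger0_norm (normal_pdf_ge0 _ _ _)) mulrA -normrM -expr2.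
  apply: le_trans (HK x); rewrite ler_wpM2r ?normal_pdf_ge0//.
  by rewrite ger0_norm ?sqr_ge0// lerDr.
move: e; rewrite /h RintegralB//; last exact: integrableRZ.
rewrite RintegralZl// {1}/Rintegral integral_normal_pdf /= => /eqP; rewrite subr_eq0 => /eqP e.
by rewrite -[RHS]mulr1 e mulVKf.
Qed.

Lemma normal_pdf_mean m s : s != 0 ->
  \int[mu]_x ((x - m) * normal_pdf m s x) = 0.
Proof.
move=> s0.
(* At frequency 0 and phase pi / 2 the sine is constantly 1, so Stein's identity is the mean. *)
have := normal_pdf_sin_stein m 0 (pi / 2) s0.
rewrite mul0r mul0r => e; rewrite -[RHS]e.
by apply: eq_Rintegral => x _; rewrite mul0r add0r sin_pihalf mulr1.
Qed.

Lemma normal_probE m s (A : set R) : measurable A ->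
  normal_prob m s A = (\int[mu]_(x in A) (normal_pdf m s x)%:E)%E.
Proof. by []. Qed.

Lemma normal_Rintegral m s (f : R -> R) : measurable_fun setT f ->
  \int[normal_prob m s]_x f x = \int[mu]_x (f x * normal_pdf m s x).
Proof.
move=> mf; apply: density_Rintegral => //; first exact: measurable_normal_pdf.
by move=> x; exact: normal_pdf_ge0.
Qed.

Lemma ge0_normal_integral m s (f : R -> \bar R) : measurable_fun setT f ->
  (forall x, 0 <= f x)%E ->
  (\int[normal_prob m s]_x f x = \int[mu]_x (f x * (normal_pdf m s x)%:E))%E.
Proof.
move=> mf f0; apply: ge0_density_integral => //; first exact: measurable_normal_pdf.
by move=> x; exact: normal_pdf_ge0.
Qed.

End normal.

(** * Fubini for real-valued integrals *)

Section rfubini.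
Context d1 d2 (T1 : measurableType d1) (T2 : measurableType d2) (R : realType).
Variables (m1 : {sigma_finite_measure set T1 -> \bar R})
          (m2 : {sigma_finite_measure set T2 -> \bar R}).

Lemma Rfubini (f : T1 -> T2 -> R) :
  (m1 \x m2)%E.-integrable setT (fun z => (f z.1 z.2)%:E) ->
  (forall x, m2.-integrable setT (EFin \o f x)) ->
  (forall y, m1.-integrable setT (EFin \o f ^~ y)) ->
  \int[m1]_x \int[m2]_y f x y = \int[m2]_y \int[m1]_x f x y.
Proof.
move=> fi i2 i1; rewrite {1 3}/Rintegral; congr fine.
transitivity (\int[m1]_x \int[m2]_y (f x y)%:E)%E.
  by apply: eq_integral => x _; rewrite /Rintegral fineK//; exact: integrable_fin_num (i2 x).
rewrite (Fubini fi); apply: eq_integral => y _.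
by rewrite /Rintegral fineK//; exact: integrable_fin_num (i1 y).
Qed.

End rfubini.

Section rfubini_bounded.
Context d1 d2 (T1 : measurableType d1) (T2 : measurableType d2) (R : realType).
Variables (P1 : probability T1 R) (P2 : probability T2 R).

Lemma Rfubini_bounded (f : T1 -> T2 -> R) (K : R) :
  measurable_fun setT (fun z : T1 * T2 => f z.1 z.2) ->
  (forall x y, `|f x y| <= K) ->
  \int[P1]_x \int[P2]_y f x y = \int[P2]_y \int[P1]_x f x y.
Proof.
move=> mf fK; have mf1 x : measurable_fun setT (f x).
  exact: (measurable_fun_pair2 x mf).
have mf2 y : measurable_fun setT (f ^~ y).
  exact: (measurable_fun_pair1 y mf).
apply: Rfubini => //.
- apply/integrable12ltyP; first exact/measurable_EFinP.
  apply: (@le_lt_trans _ _ (\int[P1]_x K%:E)%E); last first.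
    by rewrite integral_cst//= probability_setT mule1 ltry.
  have mF := @measurable_fun_fubini_tonelli_F _ _ _ _ _ P2
    (fun z : T1 * T2 => `|(f z.1 z.2)%:E|%E).
  apply: ge0_le_integral => //.
  + by move=> x _; exact: integral_ge0.
  + by apply: mF => //; apply: measurableT_comp => //; exact/measurable_EFinP.
  + move=> x _; apply: (@le_trans _ _ (\int[P2]_y K%:E)%E).
      apply: ge0_le_integral => //.
      * by apply: measurableT_comp => //; apply/measurable_EFinP; exact: mf1.
      * by move=> y _; rewrite lee_fin.
    by rewrite integral_cst//= probability_setT mule1.
- by move=> x; exact: (bounded_integrable P2 (mf1 x)).
- by move=> y; exact: (bounded_integrable P1 (mf2 y) (fun x => fK x y)).
Qed.

End rfubini_bounded.

(* Gaussian bumps are mixtures of cosines, and mixtures of bumps converge to indicators of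
   half-lines; this is how characteristic functions determine laws below. *)
Section smoothing.
Context d (T : measurableType d) (R : realType) (P : probability T R).
Local Notation mu := (@lebesgue_measure R).
Variables (X W G : T -> R) (K : R).
Hypotheses (mX : measurable_fun setT X) (mW : measurable_fun setT W)
  (mG : measurable_fun setT G) (GK : forall w, `|G w| <= K).

(** Averaging cos (a (X - c) + W) over a Gaussian frequency [a] produces the Gaussian factor by
    [normal_pdf_cos]; Fubini moves that average outside the expectation. *)
Lemma Rintegral_bump (c t : R) : t != 0 ->
  \int[P]_w (G w * (cos (W w) * expR (- ((X w - c) ^+ 2 * t ^+ 2 / 2)))) =
  \int[normal_prob 0 t]_a \int[P]_w (G w * cos (a * (X w - c) + W w)).
Proof.
move=> t0.
have mm : measurable_fun setT (fun z : T * R => G z.1 * cos (z.2 * (X z.1 - c) + W z.1)).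
  apply: measurable_funM; first exact: measurableT_comp.
  apply: (measurableT_comp measurable_cosT); apply: measurable_funD; last first.
    exact: measurableT_comp.
  apply: measurable_funM => //; apply: measurable_funB => //.
  exact: measurableT_comp.
rewrite -(@Rfubini_bounded _ _ _ _ _ P (normal_prob 0 t)
   (fun w a => G w * cos (a * (X w - c) + W w)) K mm); last first.
  move=> w a; rewrite normrM -[leRHS]mulr1 ler_pM//; exact: norm_cos_le1.
apply: eq_Rintegral => w _.
have mc : measurable_fun setT (fun a : R => cos (a * (X w - c) + W w)).
  by apply: (measurableT_comp measurable_cosT); apply: measurable_funD => //; apply: measurable_funM.
rewrite RintegralZl//; last first.
  exact: (bounded_integrable (normal_prob 0 t) mc (fun a => norm_cos_le1 _)).
congr (_ * _); rewrite normal_Rintegral//.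
rewrite -(@normal_pdf_cos _ 0 t (X w - c) (W w) t0).
by apply: eq_Rintegral => a _; rewrite subr0 (mulrC a).
Qed.

(** The tail probability of N(X, s^2) is an integral over centres y > c of bumps evaluated at X.
    Lebesgue measure in [y] is infinite, so Fubini rests on the density having mass 1 for each fixed
    X. *)
Lemma Rintegral_normal_tail (c s : R) : s != 0 ->
  \int[P]_w (G w * fine (normal_prob (X w) s `]c, +oo[)) =
  \int[mu]_y \int[P]_w (G w * (\1_`]c, +oo[ y * normal_pdf (X w) s y)).
Proof.
move=> s0.
have pdfE x y : normal_pdf x s y = normal_pdf 0 s (y - x).
  by rewrite !normal_pdfE//= /normal_fun subr0.
have mpdf : measurable_fun setT (fun z : T * R => normal_pdf (X z.1) s z.2).
  under eq_fun do rewrite pdfE.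
  apply: (measurableT_comp (measurable_normal_pdf 0 s)).
  by apply: measurable_funB => //; exact: measurableT_comp.
have mi : measurable_fun setT (\1_`]c, +oo[ : R -> R) by exact: measurable_indic.
have mm : measurable_fun setT (fun z : T * R => G z.1 * (\1_`]c, +oo[ z.2 * normal_pdf (X z.1) s z.2)).
  apply: measurable_funM; first exact: measurableT_comp.
  by apply: measurable_funM => //; exact: measurableT_comp.
have K0 : 0 <= K by apply: le_trans (GK point).
have fb w y : `|G w * (\1_`]c, +oo[ y * normal_pdf (X w) s y)| <= K * normal_pdf (X w) s y.
  rewrite normrM ler_pM// normrM (ger0_norm (normal_pdf_ge0 _ _ _)) ler_piMl ?normal_pdf_ge0//.
  by rewrite indicE; case: (_ \in _); rewrite ?normr1 ?normr0.
have mm1 w : measurable_fun setT (fun y : R => G w * (\1_`]c, +oo[ y * normal_pdf (X w) s y)).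
  by apply: measurable_funM => //; apply: measurable_funM => //; exact: measurable_normal_pdf.
have int1 w : mu.-integrable setT (EFin \o (fun y => G w * (\1_`]c, +oo[ y * normal_pdf (X w) s y))).
  apply: (@le_integrable _ _ _ mu setT measurableT _ (EFin \o fun y => K * normal_pdf (X w) s y)).
  - by apply/measurable_EFinP; exact: mm1.
  - by move=> y _; rewrite lee_fin; apply: le_trans (fb w y) (ler_norm _).
  - by apply: integrableRZ; exact: integrable_normal_pdf.
rewrite -(@Rfubini _ _ _ _ _ P mu (fun w y => G w * (\1_`]c, +oo[ y * normal_pdf (X w) s y))) //.
- apply: eq_Rintegral => w _; rewrite RintegralZl//; last first.
    apply: (@le_integrable _ _ _ mu setT measurableT _ (EFin \o fun y => normal_pdf (X w) s y)).
    + by apply/measurable_EFinP/measurable_funM => //; exact: measurable_normal_pdf.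
    + move=> y _; rewrite lee_fin normrM (ger0_norm (normal_pdf_ge0 _ _ _)) ler_piMl ?normal_pdf_ge0//.
      by rewrite indicE; case: (_ \in _); rewrite ?normr1 ?normr0.
    + exact: integrable_normal_pdf.
  congr (_ * _); rewrite /Rintegral; congr fine; rewrite normal_probE// [LHS]integral_mkcond.
  by apply: eq_integral => y _; rewrite patchE indicE; case: ifP => _; rewrite ?mul1r ?mul0r.
- apply/integrable12ltyP; first exact/measurable_EFinP.
  apply: (@le_lt_trans _ _ (\int[P]_x K%:E)%E); last first.
    by rewrite integral_cst//= probability_setT mule1 ltry.
  apply: ge0_le_integral => //.
  + by move=> x _; exact: integral_ge0.
  + apply: (@measurable_fun_fubini_tonelli_F _ _ _ _ _ mu
      (fun z : T * R => `|(G z.1 * (\1_`]c, +oo[ z.2 * normal_pdf (X z.1) s z.2))%:E|%E)) => //.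
    by apply: measurableT_comp => //; exact/measurable_EFinP.
  + move=> w _; apply: (@le_trans _ _ (\int[mu]_y (K%:E * (normal_pdf (X w) s y)%:E))%E).
      apply: ge0_le_integral => //.
      * by apply: measurableT_comp => //; apply/measurable_EFinP; exact: mm1.
      * by apply: measurable_funeM; apply/measurable_EFinP; exact: measurable_normal_pdf.
      * by move=> y _; rewrite -EFinM lee_fin; exact: fb.
    rewrite ge0_integralZl ?lee_fin//.
    * by rewrite integral_normal_pdf mule1.
    * by apply/measurable_EFinP; exact: measurable_normal_pdf.
    * by move=> y _; rewrite lee_fin normal_pdf_ge0.
- move=> y; apply: (@bounded_integrable _ _ _ P _ (K * normal_peak s)).
    exact: (measurable_fun_pair1 y mm).
  by move=> w; apply: le_trans (fb w y) _; rewrite ler_wpM2l// normal_pdf_ub.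
Qed.

End smoothing.

(** * Gaussian tails converging to indicators of half-lines *)

Section normal_tail.
Context {R : realType}.
Local Notation mu := (@lebesgue_measure R).

Lemma normal_integrable (m s : R) (f : R -> R) : s != 0 ->
  measurable_fun setT f -> (forall x, `|f x| <= 1 + (x - m) ^+ 2) ->
  (normal_prob m s).-integrable setT (EFin \o f).
Proof.
move=> s0 mf fb; have /integrableP[mi i] := normal_pdf_moment_integrable s0 mf fb.
apply/integrableP; split; first exact/measurable_EFinP.
rewrite ge0_normal_integral//; last first.
  by apply: measurableT_comp => //; exact/measurable_EFinP.
apply: le_lt_trans i; rewrite le_eqVlt; apply/orP; left; apply/eqP.
apply: eq_integral => x _.
rewrite EFinM abseM; congr (_ * _)%E.
by rewrite gee0_abs ?lee_fin ?normal_pdf_ge0.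
Qed.

Lemma normal_chebyshev (m s e : R) (A : set R) : s != 0 -> 0 < e -> measurable A ->
  (forall y, A y -> e <= `|y - m|) -> fine (normal_prob m s A) <= s ^+ 2 / e ^+ 2.
Proof.
move=> s0 e0 mA Ae.
have mi : measurable_fun setT (\1_A : R -> R) by exact: measurable_indic.
have m2 : measurable_fun setT (fun y : R => (y - m) ^+ 2).
  by apply: measurable_funX; exact: measurable_funB.
rewrite ler_pdivlMr ?exprn_gt0// mulrC.
have i1 : (normal_prob m s).-integrable setT (EFin \o \1_A).
  apply: (@bounded_integrable _ _ _ (normal_prob m s) _ 1) => // y.
  by rewrite indicE; case: (_ \in _); rewrite ?normr1 ?normr0.
have -> : fine (normal_prob m s A) = \int[normal_prob m s]_y \1_A y.
  by rewrite /Rintegral integral_indic// setIT.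
rewrite -RintegralZl// -[leRHS](@normal_pdf_var _ m s s0) -normal_Rintegral//.
apply: le_Rintegral => //.
- exact: integrableRZ.
- apply: normal_integrable => // x.
  by rewrite ger0_norm ?sqr_ge0// lerDr.
- move=> x _; rewrite indicE; case: (boolP (x \in A)) => [/set_mem /Ae xe|_].
    rewrite mulr1 -[leRHS]ger0_norm ?sqr_ge0// normrX.
    by rewrite lerXn2r// nnegrE// ltW.
  by rewrite mulr0 sqr_ge0.
Qed.

(** The threshold is shifted by 1/(n+1) while the standard deviation is (n+1)^-2. Even at x = c the
    point stays many deviations below the threshold, so Chebyshev gives (n+1)^-2 and the limit is
    the indicator of the open half-line everywhere, not just almost everywhere. *)
Lemma normal_tail_cvg (c x : R) :
  fine (normal_prob x (n.+1%:R ^- 2) `]c + n.+1%:R^-1, +oo[) @[n --> \oo] -->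
  (\1_`]c, +oo[ x : R).
Proof.
have n0 n : n.+1%:R != 0 :> R by rewrite pnatr_eq0.
have s0 n : n.+1%:R ^- 2 != 0 :> R by rewrite invr_eq0 expf_neq0.
have itvE (a y : R) : (y \in `]a, +oo[) = (a < y) by rewrite in_itv/= andbT.
have inv0 (n : nat) : 0 < n.+1%:R^-1 :> R by rewrite invr_gt0.
have cvg0 : (n.+1%:R^-1 : R) @[n --> \oo] --> 0 by exact: cvg_harmonic.
have m0 (u v : nat -> R) : u @ \oo --> (0 : R) -> v @ \oo --> (0 : R) ->
    (u n * v n) @[n --> \oo] --> (0 : R).
  by move=> u0 v0; rewrite -[X in _ --> X](mulr0 (0 : R)); exact: cvgM.
rewrite indicE; case: (ltP c x) => cx; last first.
  rewrite memNset /=; last by rewrite itvE ltNge cx.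
  apply: (@squeeze_cvgr _ _ _ _ (cst 0) (fun n => n.+1%:R^-1 * n.+1%:R^-1)).
  - apply: nearW => n; rewrite fine_ge0//=.
    apply: le_trans (@normal_chebyshev x _ n.+1%:R^-1 _ (s0 n) (inv0 n) _ _) _ => //.
      move=> y; rewrite /= itvE; set z := n.+1%:R^-1 => cy.
      by apply: le_trans (ler_norm _); lra.
    by rewrite -exprVn -exprM (_ : 2 * 2 = 2 + 2)%N// exprD mulfK ?expf_neq0 ?invr_eq0.
  - exact: cvg_cst.
  - by rewrite -[X in _ --> X](mulr0 (0 : R)); apply: cvgM.
rewrite mem_set /=; last by rewrite itvE.
(* Once 1/(n+1) is below half the gap between c and x, the shifted threshold is still at distance e
   from x. *)
pose e := (x - c) / 2; have e0 : 0 < e by rewrite divr_gt0// subr_gt0.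
apply: (@squeeze_cvgr _ _ _ _ (fun n => 1 - n.+1%:R ^- 2 ^+ 2 / e ^+ 2) (cst 1)).
- near=> n.
  have nx : n.+1%:R^-1 < e by near: n; apply: cvgr_lt cvg0 _ _.
  have PC := @probability_setC _ _ _ (normal_prob x (n.+1%:R ^- 2))
    `]c + n.+1%:R^-1, +oo[ (measurable_itv _).
  have fin A : measurable A -> normal_prob x (n.+1%:R ^- 2) A \is a fin_num.
    by move=> mA; exact: fin_num_measure.
  apply/andP; split; last by rewrite -[leRHS]/(fine 1%:E) fine_le ?fin//= probability_le1.
  have : fine (normal_prob x (n.+1%:R ^- 2) (~` `]c + n.+1%:R^-1, +oo[)) <=
         n.+1%:R ^- 2 ^+ 2 / e ^+ 2.
    apply: normal_chebyshev => //; first exact: measurableC.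
    move=> y /= /negP; rewrite itvE -leNgt => yc.
    rewrite distrC; apply: le_trans (ler_norm _); move: nx yc; rewrite /e.
    by set z := n.+1%:R^-1; lra.
  rewrite PC fineB ?fin//=; set q := _ / e ^+ 2; set p := fine _; lra.
- rewrite -[X in _ --> X]subr0; apply: cvgB; first exact: cvg_cst.
  rewrite -[X in _ --> X](mul0r (e ^+ 2)^-1); apply: cvgM; last exact: cvg_cst.
  have c2 : (n.+1%:R ^- 2 : R) @[n --> \oo] --> 0.
    rewrite (_ : (fun n => _) = (fun n => n.+1%:R^-1 * n.+1%:R^-1)); first exact: m0.
    by apply/funext => n; rewrite -exprVn expr2.
  rewrite (_ : (fun n => _) = (fun n => n.+1%:R ^- 2 * n.+1%:R ^- 2)); first exact: m0.
  by apply/funext => n; rewrite expr2.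
- exact: cvg_cst.
Unshelve. all: end_near. Qed.

End normal_tail.

(** * Trading one frequency for an indicator *)

Section uniqueness1.
Context d1 d2 (T1 : measurableType d1) (T2 : measurableType d2) (R : realType).
Variables (P1 : probability T1 R) (P2 : probability T2 R).
Variables (X1 W1 G1 : T1 -> R) (X2 W2 G2 : T2 -> R) (K : R).
Hypotheses (mX1 : measurable_fun setT X1) (mW1 : measurable_fun setT W1)
  (mG1 : measurable_fun setT G1) (GK1 : forall w, `|G1 w| <= K).
Hypotheses (mX2 : measurable_fun setT X2) (mW2 : measurable_fun setT W2)
  (mG2 : measurable_fun setT G2) (GK2 : forall w, `|G2 w| <= K).
Hypothesis char_eq : forall a b,
  \int[P1]_w (G1 w * cos (a * X1 w + W1 w + b)) =
  \int[P2]_w (G2 w * cos (a * X2 w + W2 w + b)).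

Let bump_eq c t b : t != 0 ->
  \int[P1]_w (G1 w * (cos (W1 w + b) * expR (- ((X1 w - c) ^+ 2 * t ^+ 2 / 2)))) =
  \int[P2]_w (G2 w * (cos (W2 w + b) * expR (- ((X2 w - c) ^+ 2 * t ^+ 2 / 2)))).
Proof.
move=> t0; rewrite (@Rintegral_bump _ _ _ P1 X1 (fun w => W1 w + b) G1 K)//; last exact: measurable_funD.
rewrite (@Rintegral_bump _ _ _ P2 X2 (fun w => W2 w + b) G2 K)//; last exact: measurable_funD.
apply: eq_Rintegral => a _.
(* Recentring at [c] is only a change of phase, which is why the hypothesis is stated for all phases
   [b]. *)
have := char_eq a (b - a * c).
rewrite [X in X = _ -> _](_ : _ = \int[P1]_w (G1 w * cos (a * (X1 w - c) + (W1 w + b)))); last first.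
  by apply: eq_Rintegral => w _; congr (_ * cos _); ring.
by move=> ->; apply: eq_Rintegral => w _; congr (_ * cos _); ring.
Qed.

Let tail_eq c s b : s != 0 ->
  \int[P1]_w (G1 w * cos (W1 w + b) * fine (normal_prob (X1 w) s `]c, +oo[)) =
  \int[P2]_w (G2 w * cos (W2 w + b) * fine (normal_prob (X2 w) s `]c, +oo[)).
Proof.
move=> s0.
have mGc d (T : measurableType d) (W G : T -> R) : measurable_fun setT W ->
    measurable_fun setT G -> measurable_fun setT (fun w => G w * cos (W w + b)).
  move=> mW mG; apply: measurable_funM => //.
  by apply: (measurableT_comp measurable_cosT); exact: measurable_funD.
have Gcb (g w : R) : `|g| <= K -> `|g * cos (w + b)| <= K.
  by move=> gK; rewrite normrM -[leRHS]mulr1 ler_pM//; exact: norm_cos_le1.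
rewrite (@Rintegral_normal_tail _ _ _ P1 X1 (fun w => G1 w * cos (W1 w + b)) K)//; last 2 first.
- exact: mGc.
- by move=> w; exact: Gcb.
rewrite (@Rintegral_normal_tail _ _ _ P2 X2 (fun w => G2 w * cos (W2 w + b)) K)//; last 2 first.
- exact: mGc.
- by move=> w; exact: Gcb.
apply: eq_Rintegral => y _.
(* The density at y of N(X, s^2) is its peak times the bump centred at y of frequency scale 1/s; [k]
   collects the factors that do not depend on the sample point. *)
pose k := \1_`]c, +oo[ y * normal_peak s : R.
have E d (T : measurableType d) (P : probability T R) (X W G : T -> R) :
    measurable_fun setT X -> measurable_fun setT W -> measurable_fun setT G ->
    (forall w, `|G w| <= K) ->
    \int[P]_w (G w * cos (W w + b) * (\1_`]c, +oo[ y * normal_pdf (X w) s y)) =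
    k * \int[P]_w (G w * (cos (W w + b) * expR (- ((X w - y) ^+ 2 * s^-1 ^+ 2 / 2)))).
  move=> mX mW mG GK; rewrite -RintegralZl//; last first.
    apply: (@bounded_integrable _ _ _ P _ K).
      apply: measurable_funM => //; apply: measurable_funM.
        by apply: (measurableT_comp measurable_cosT); exact: measurable_funD.
      apply: measurableT_comp => //; apply: measurableT_comp => //.
      apply: measurable_funM => //; apply: measurable_funM => //.
      by apply: measurable_funX; exact: measurable_funB.
    move=> w; rewrite mulrA normrM -[leRHS]mulr1 ler_pM//; first exact: Gcb.
    rewrite ger0_norm ?expR_ge0// -[leRHS]expR0 ler_expR oppr_le0.
    by rewrite divr_ge0// mulr_ge0 ?sqr_ge0.
  apply: eq_Rintegral => w _; rewrite /k normal_pdfE//= /normal_fun.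
  rewrite (_ : - (y - X w) ^+ 2 / (s ^+ 2 *+ 2) = - ((X w - y) ^+ 2 * s^-1 ^+ 2 / 2)).
    by ring.
  by field.
by rewrite !E// bump_eq// invr_eq0.
Qed.

Let itv_eq c b :
  \int[P1]_w (G1 w * cos (W1 w + b) * \1_`]c, +oo[ (X1 w)) =
  \int[P2]_w (G2 w * cos (W2 w + b) * \1_`]c, +oo[ (X2 w)).
Proof.
pose h n x : R := fine (normal_prob x (n.+1%:R ^- 2) `]c + n.+1%:R^-1, +oo[).
have s0 n : n.+1%:R ^- 2 != 0 :> R by rewrite invr_eq0 expf_neq0// pnatr_eq0.
have h01 n x : `|h n x| <= 1.
  rewrite ger0_norm ?fine_ge0//= -[leRHS]/(fine 1%:E) fine_le ?fin_num_measure//=.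
  by rewrite probability_le1.
have mh n : measurable_fun setT (h n).
  rewrite /h.
  have -> : (fun x : R => fine (normal_prob x (n.+1%:R ^- 2) `]c + n.+1%:R^-1, +oo[)) =
    (fun x => fine (\int[@lebesgue_measure R]_y
        ((\1_`]c + n.+1%:R^-1, +oo[ y * normal_pdf 0 (n.+1%:R ^- 2) (y - x))%:E)%E)).
    apply/funext => x; congr fine; rewrite normal_probE// integral_mkcond.
    apply: eq_integral => y _; rewrite patchE indicE.
    have -> : normal_pdf x (n.+1%:R ^- 2) y = normal_pdf 0 (n.+1%:R ^- 2) (y - x).
      by rewrite !normal_pdfE//= /normal_fun subr0.
    by case: ifP => _; rewrite ?mul1r ?mul0r.
  apply: measurableT_comp => //.
  apply: (@measurable_fun_fubini_tonelli_F _ _ _ _ _ (@lebesgue_measure R)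
      (fun z : R * R => (\1_`]c + n.+1%:R^-1, +oo[ z.2 * normal_pdf 0 (n.+1%:R ^- 2) (z.2 - z.1))%:E)).
    apply/measurable_EFinP; apply: measurable_funM.
      apply: measurableT_comp => //; exact: measurable_indic.
    apply: (measurableT_comp (measurable_normal_pdf _ _)).
    exact: measurable_funB.
  by move=> z; rewrite lee_fin mulr_ge0 ?normal_pdf_ge0.
have C d (T : measurableType d) (P : probability T R) (X W G : T -> R) :
    measurable_fun setT X -> measurable_fun setT W -> measurable_fun setT G ->
    (forall w, `|G w| <= K) ->
    \int[P]_w (G w * cos (W w + b) * h n (X w)) @[n --> \oo] -->
    \int[P]_w (G w * cos (W w + b) * \1_`]c, +oo[ (X w)).
  move=> mX mW mG GK.
  have mc : measurable_fun setT (fun w => G w * cos (W w + b)).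
    apply: measurable_funM => //.
    by apply: (measurableT_comp measurable_cosT); exact: measurable_funD.
  have [||||//] := @Rintegral_dominated_cvg _ _ _ P
    (fun n w => G w * cos (W w + b) * h n (X w))
    (fun w => G w * cos (W w + b) * \1_`]c, +oo[ (X w)) (cst K).
  - by move=> n; apply: measurable_funM => //; exact: measurableT_comp.
  - by move=> w; apply: cvgM; [exact: cvg_cst|exact: normal_tail_cvg].
  - exact: finite_measure_integrable_cst.
  - move=> n w; rewrite normrM -[leRHS]mulr1 ler_pM//.
    by rewrite normrM -[leRHS]mulr1 ler_pM//; exact: norm_cos_le1.
have := C _ _ P1 _ _ _ mX1 mW1 mG1 GK1.
under eq_fun do rewrite tail_eq//.
move=> C1; have C2 := C _ _ P2 _ _ _ mX2 mW2 mG2 GK2.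
exact: (cvg_unique _ C1 C2).
Qed.

(** Dynkin's lemma on open half-lines, which generate the Borel sets and are closed under
    intersection. Keeping the weight [G] and the residual phase [W] lets the lemma be iterated over
    coordinates. *)
Lemma char_eq_indic B b : measurable B ->
  \int[P1]_w (G1 w * cos (W1 w + b) * \1_B (X1 w)) =
  \int[P2]_w (G2 w * cos (W2 w + b) * \1_B (X2 w)).
Proof.
move=> mB.
have mGc d (T : measurableType d) (X W G : T -> R) A : measurable A ->
    measurable_fun setT X -> measurable_fun setT W ->
    measurable_fun setT G -> measurable_fun setT (fun w => G w * cos (W w + b) * \1_A (X w)).
  move=> mA mX mW mG; apply: measurable_funM; last first.
    apply: measurableT_comp => //; exact: measurable_indic.
  apply: measurable_funM => //.
  by apply: (measurableT_comp measurable_cosT); exact: measurable_funD.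
have Gcb (g w x : R) A : `|g| <= K -> `|g * cos (w + b) * \1_A x| <= K.
  move=> gK; rewrite normrM -[leRHS]mulr1 ler_pM//; last first.
    by rewrite indicE; case: (_ \in _); rewrite ?normr1 ?normr0.
  by rewrite normrM -[leRHS]mulr1 ler_pM//; exact: norm_cos_le1.
have I d (T : measurableType d) (P : probability T R) (X W G : T -> R) A : measurable A ->
    measurable_fun setT X -> measurable_fun setT W -> measurable_fun setT G ->
    (forall w, `|G w| <= K) ->
    P.-integrable setT (EFin \o (fun w => G w * cos (W w + b) * \1_A (X w))).
  move=> mA mX mW mG GK; apply: (@bounded_integrable _ _ _ P _ K); first exact: mGc.
  by move=> w; exact: Gcb.
(* Frequency 0 compares the total masses, which stability under complements requires. *)
have PT : \int[P1]_w (G1 w * cos (W1 w + b) * \1_setT (X1 w)) =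
          \int[P2]_w (G2 w * cos (W2 w + b) * \1_setT (X2 w)).
  rewrite indicT; have := char_eq 0 b.
  under eq_Rintegral do rewrite mul0r add0r.
  under [in X in _ = X -> _]eq_Rintegral do rewrite mul0r add0r.
  by move=> e; under eq_Rintegral do rewrite mulr1; rewrite e; under [RHS]eq_Rintegral do rewrite mulr1.
have mE : @measurable _ R = <<s RGenOInfty.G (R := R) >> by exact: RGenOInfty.measurableE.
pose Q := [set B : set R | \int[P1]_w (G1 w * cos (W1 w + b) * \1_B (X1 w)) =
            \int[P2]_w (G2 w * cos (W2 w + b) * \1_B (X2 w))].
suff : Q B by [].
move: mB; rewrite mE; move: B; apply: (dynkin_induction (P := Q) mE) => //.
- move=> _ _ [x ->] [y ->]; exists (Num.max x y); apply/seteqP; split => z /=.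
    by rewrite !in_itv/= !andbT gt_max => -[-> ->].
  by rewrite !in_itv/= !andbT gt_max => /andP[].
- by move=> _ [x ->]; exact: itv_eq.
- move=> A mA e.
  have CE d (T : measurableType d) (P : probability T R) (X W G : T -> R) :
    measurable_fun setT X -> measurable_fun setT W -> measurable_fun setT G ->
    (forall w, `|G w| <= K) ->
    \int[P]_w (G w * cos (W w + b) * \1_(~` A) (X w)) =
    \int[P]_w (G w * cos (W w + b) * \1_setT (X w)) - \int[P]_w (G w * cos (W w + b) * \1_A (X w)).
    move=> mX mW mG GK; rewrite -RintegralB//; [|exact: I|exact: I].
    apply: eq_Rintegral => w _; rewrite -mulrBr; congr (_ * _).
    by rewrite !indicE in_setC in_setT; case: (_ \in _); rewrite /= ?subrr ?subr0.
  by rewrite /Q/= !CE// PT e.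
- move=> F mF tF eF.
  pose U n := \big[setU/set0]_(k < n) F k.
  have mU n : measurable (U n) by apply: bigsetU_measurable.
  have eU n : \int[P1]_w (G1 w * cos (W1 w + b) * \1_(U n) (X1 w)) =
              \int[P2]_w (G2 w * cos (W2 w + b) * \1_(U n) (X2 w)).
    elim: n => [|n ih].
      rewrite /U big_ord0 indic0.
      by under eq_Rintegral do rewrite mulr0; under [RHS]eq_Rintegral do rewrite mulr0;
        rewrite /Rintegral !integral0.
    have UE d (T : measurableType d) (P : probability T R) (X W G : T -> R) :
      measurable_fun setT X -> measurable_fun setT W -> measurable_fun setT G ->
      (forall w, `|G w| <= K) ->
      \int[P]_w (G w * cos (W w + b) * \1_(U n.+1) (X w)) =
      \int[P]_w (G w * cos (W w + b) * \1_(U n) (X w)) + \int[P]_w (G w * cos (W w + b) * \1_(F n) (X w)).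
      move=> mX mW mG GK; rewrite -RintegralD//; [|exact: I|exact: I].
      apply: eq_Rintegral => w _; rewrite -mulrDr; congr (_ * _).
      have UF : U n `&` F n = set0.
        apply/seteqP; split => // x []; rewrite /U -bigcup_mkord => -[k /= kn Fk] Fn.
        by have kE : k = n; [apply: tF => //; exists x|move: kn; rewrite kE ltnn].
      rewrite /U big_ord_recr/= -/(U n) !indicE in_setU.
      case: (boolP (X w \in U n)) => [/set_mem Xu|]; case: (boolP (X w \in F n)) => [/set_mem Xf|] //=; rewrite ?addr0 ?add0r//.
      by have : (U n `&` F n) (X w) by []; rewrite UF.
    by rewrite !UE// ih eF.
  have C d (T : measurableType d) (P : probability T R) (X W G : T -> R) :
    measurable_fun setT X -> measurable_fun setT W -> measurable_fun setT G ->
    (forall w, `|G w| <= K) ->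
    \int[P]_w (G w * cos (W w + b) * \1_(U n) (X w)) @[n --> \oo] -->
    \int[P]_w (G w * cos (W w + b) * \1_(\bigcup_k F k) (X w)).
    move=> mX mW mG GK.
    have [||||//] := @Rintegral_dominated_cvg _ _ _ P
      (fun n w => G w * cos (W w + b) * \1_(U n) (X w))
      (fun w => G w * cos (W w + b) * \1_(\bigcup_k F k) (X w)) (cst K).
    - by move=> n; exact: mGc.
    - move=> w; apply: cvgM; first exact: cvg_cst.
      rewrite indicE; case: (boolP (_ \in _)) => [/set_mem[k _ Fk]|Xn].
        apply/cvgrPdist_lt => e e0; near=> n.
        rewrite indicE mem_set ?subrr ?normr0//.
        have kn : (k < n)%N by near: n; exact: nbhs_infty_gt.
        by rewrite /U -bigcup_mkord; exists k.
      rewrite (_ : (fun n => _) = cst 0); first exact: cvg_cst.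
      apply/funext => n; rewrite indicE memNset// /U -bigcup_mkord => -[k _ Fk].
      by move/negP: Xn; apply; apply/mem_set; exists k.
    - exact: finite_measure_integrable_cst.
    - by move=> n w; exact: Gcb.
  have := C _ _ P1 _ _ _ mX1 mW1 mG1 GK1.
  under eq_fun do rewrite eU.
  move=> C1; have C2 := C _ _ P2 _ _ _ mX2 mW2 mG2 GK2.
  exact: (cvg_unique _ C1 C2).
Unshelve. all: end_near. Qed.

End uniqueness1.

(** * Laws of random vectors *)

Section vec_measurability.
Context (R : realType) (n : nat).

Lemma measurable_coord (i : 'I_n) : measurable_fun setT (fun x : vec R n => x i ord0).
Proof.
move=> _ Y mY; rewrite setTI; apply: sub_sigma_algebra => /=.
rewrite -bigcup_seq/=; exists i => /=; first by rewrite mem_index_enum.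
by exists Y => //; rewrite setTI.
Qed.

Lemma measurable_fun_vec d (T : measurableType d) (f : T -> vec R n) :
  (forall i, measurable_fun setT (fun w => f w i ord0)) -> measurable_fun setT f.
Proof.
move=> mf _ Y; rewrite setTI => mY.
have : <<s \big[setU/set0]_(i < n)
    preimage_set_system [set: T] (fun w => f w i ord0) measurable >> (f @^-1` Y).
  have := g_sigma_preimage_comp (fun i (x : vec R n) => x i ord0) f.
  move=> /(congr1 (fun G : set (set T) => G (f @^-1` Y))) E.
  rewrite /g_sigma_preimage in E; rewrite E; exists Y => //.
  by rewrite setTI.
apply: smallest_sub; first exact: sigma_algebra_measurable.
rewrite -bigcup_seq; apply: bigcup_sub => i _ A [B mB <-]; exact: mf.
Qed.

Lemma measurable_col d (T : measurableType d) (f : 'I_n -> T -> R) :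
  (forall i, measurable_fun setT (f i)) ->
  measurable_fun setT (fun w => (\col_i f i w) : vec R n).
Proof.
move=> mf; apply: measurable_fun_vec => i.
by rewrite (_ : (fun w => _) = f i)//; apply/funext => w; rewrite mxE.
Qed.

Definition rect (B : 'I_n -> set R) : set (vec R n) := [set x | forall i, B i (x i ord0)].

Lemma measurable_rect B : (forall i, measurable (B i)) -> measurable (rect B).
Proof.
move=> mB; have -> : rect B = \big[setI/setT]_(i < n) ((fun x : vec R n => x i ord0) @^-1` B i).
  rewrite -bigcap_seq; apply/seteqP; split => [x Bx i _|x Bx i]; first exact: Bx.
  by apply: Bx; rewrite /= mem_index_enum.
apply: bigsetI_measurable => i _.
by rewrite -[X in measurable X]setTI; exact: measurable_coord.
Qed.

(** Rectangles form a generating family closed under intersection, so finite measures on vectors are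
    determined by them; [vec_measure_unique] uses exactly this. *)
Lemma measurable_vecE : @measurable _ (vec R n) =
  <<s [set E | exists B, (forall i, measurable (B i)) /\ E = rect B] >>.
Proof.
apply/seteqP; split.
  apply: smallest_sub; first exact: smallest_sigma_algebra.
  rewrite -bigcup_seq; apply: bigcup_sub => i _ A [B mB <-].
  apply: sub_sigma_algebra; exists (fun j => if j == i then B else setT); split.
    by move=> j; case: ifP.
  rewrite setTI; apply/seteqP; split => [x Bx j|x /(_ i)]; last by rewrite eqxx.
  by case: eqP => [->|].
apply: smallest_sub; first exact: sigma_algebra_measurable.
by move=> E [B [mB ->]]; exact: measurable_rect.
Qed.

Lemma vec_measure_unique (m1 m2 : {measure set (vec R n) -> \bar R}) :
  (forall B, (forall i, measurable (B i)) -> m1 (rect B) = m2 (rect B)) ->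
  (m1 setT < +oo)%E -> forall E, measurable E -> m1 E = m2 E.
Proof.
move=> e fin; apply: (measure_unique _ (fun=> setT) measurable_vecE) => //.
- move=> _ _ [B [mB ->]] [C [mC ->]]; exists (fun i => B i `&` C i); split.
    by move=> i; exact: measurableI.
  by apply/seteqP; split => [x [Bx Cx] i|x BC]; split => // i; have [] := BC i.
- by move=> _; exists (fun=> setT); split => //; apply/seteqP; split.
- by rewrite bigcup_const//; exists 0%N.
- by move=> _ [B [mB ->]]; exact: e.
Qed.

End vec_measurability.

Section law.
Context d d' (T : measurableType d) (T' : measurableType d') (R : realType).
Variables (P : probability T R) (X : T -> T') (mX : measurable_fun setT X).
Let X_mixin := isMeasurableFun.Build _ _ _ _ _ mX.
Let X_pack : {mfun _ >-> _} := HB.pack X X_mixin.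

Definition law : probability T' R := distribution P X_pack.

Lemma lawE A : law A = P (X @^-1` A).
Proof. by []. Qed.

Lemma ge0_integral_law (f : T' -> \bar R) : measurable_fun setT f ->
  (forall y, 0 <= f y)%E -> (\int[law]_y f y = \int[P]_x f (X x))%E.
Proof. by move=> mf f0; exact: (@ge0_integral_distribution _ _ _ _ _ P X_pack f mf f0). Qed.

Lemma Rintegral_law (f : T' -> R) : measurable_fun setT f ->
  \int[law]_y f y = \int[P]_x f (X x).
Proof.
move=> mf; rewrite /Rintegral integralE [in RHS]integralE; congr (fine (_ - _)).
  transitivity (\int[P]_x ((fun y => (f y)%:E)^\+ (X x)))%E.
    apply: ge0_integral_law => //.
    by apply: measurable_funepos; exact/measurable_EFinP.
  by apply: eq_integral => x _; rewrite !funeposE.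
transitivity (\int[P]_x ((fun y => (f y)%:E)^\- (X x)))%E.
  apply: ge0_integral_law => //.
  by apply: measurable_funeneg; exact/measurable_EFinP.
by apply: eq_integral => x _; rewrite !funenegE.
Qed.

End law.

Lemma eq_law_integral d1 d2 d' (T1 : measurableType d1) (T2 : measurableType d2)
    (T' : measurableType d') (R : realType) (P1 : probability T1 R) (P2 : probability T2 R)
    (X1 : T1 -> T') (X2 : T2 -> T') (f : T' -> \bar R) :
  measurable_fun setT X1 -> measurable_fun setT X2 ->
  (forall A, measurable A -> P1 (X1 @^-1` A) = P2 (X2 @^-1` A)) ->
  measurable_fun setT f -> (forall y, 0 <= f y)%E ->
  (\int[P1]_x f (X1 x) = \int[P2]_x f (X2 x))%E.
Proof.
move=> mX1 mX2 e mf f0; rewrite -(ge0_integral_law P1 mX1)// -(ge0_integral_law P2 mX2)//.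
by apply: eq_measure_integral => A mA _; exact: e.
Qed.

Lemma eq_law_Rintegral d1 d2 d' (T1 : measurableType d1) (T2 : measurableType d2)
    (T' : measurableType d') (R : realType) (P1 : probability T1 R) (P2 : probability T2 R)
    (X1 : T1 -> T') (X2 : T2 -> T') (f : T' -> R) :
  measurable_fun setT X1 -> measurable_fun setT X2 ->
  (forall A, measurable A -> P1 (X1 @^-1` A) = P2 (X2 @^-1` A)) ->
  measurable_fun setT f -> \int[P1]_x f (X1 x) = \int[P2]_x f (X2 x).
Proof.
move=> mX1 mX2 e mf; rewrite -(Rintegral_law P1 mX1)// -(Rintegral_law P2 mX2)//.
by rewrite /Rintegral; congr fine; apply: eq_measure_integral => A mA _; exact: e.
Qed.

(** * The product of two probabilities, as a probability *)

Section product_probability.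
Context d1 d2 (T1 : measurableType d1) (T2 : measurableType d2) (R : realType).
Variables (P1 : probability T1 R) (P2 : probability T2 R).

Let prodm : set (T1 * T2) -> \bar R := (P1 \x P2)%E.
HB.instance Definition _ := Measure.on prodm.
Let prodm_setT : prodm setT = 1%E.
Proof.
rewrite -setXTT [LHS]product_measure1E//.
by transitivity (1 * 1 : \bar R)%E; [congr (_ * _)%E; exact: probability_setT|rewrite mule1].
Qed.
HB.instance Definition _ := Measure_isProbability.Build _ _ _ prodm prodm_setT.
Definition product_probability : probability (T1 * T2)%type R := prodm.

Lemma product_probabilityE A B : measurable A -> measurable B ->
  product_probability (A `*` B) = (P1 A * P2 B)%E.
Proof. by move=> mA mB; exact: product_measure1E. Qed.

Lemma ge0_integral_product (f : T1 * T2 -> \bar R) : measurable_fun setT f ->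
  (forall z, 0 <= f z)%E ->
  (\int[product_probability]_z f z = \int[P1]_x \int[P2]_y f (x, y))%E.
Proof. by move=> mf f0; exact: fubini_tonelli1. Qed.

Lemma Rintegral_product (f : T1 -> T2 -> R) (K : R) :
  measurable_fun setT (fun z : T1 * T2 => f z.1 z.2) ->
  (forall x y, `|f x y| <= K) ->
  \int[product_probability]_z f z.1 z.2 = \int[P1]_x \int[P2]_y f x y.
Proof.
move=> mf fK.
have fi : (P1 \x P2)%E.-integrable setT (fun z => (f z.1 z.2)%:E).
  exact: (@bounded_integrable _ _ _ product_probability _ K mf).
rewrite {1 2}/Rintegral; congr fine.
have -> : (\int[product_probability]_x (f x.1 x.2)%:E = \int[P1 \x P2]_z (f z.1 z.2)%:E)%E by [].
rewrite -(integral12_prod_meas1 fi); apply: eq_integral => x _.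
rewrite /Rintegral fineK//; apply: integrable_fin_num => //.
apply: (@bounded_integrable _ _ _ P2 _ K) => // .
exact: (measurable_fun_pair2 x mf).
Qed.

End product_probability.

(** * Characteristic functions determine joint laws *)

Section char_function.
Context d1 d2 (T1 : measurableType d1) (T2 : measurableType d2) (R : realType).
Variables (P1 : probability T1 R) (P2 : probability T2 R) (n : nat).
Variables (X1 : 'I_n -> T1 -> R) (X2 : 'I_n -> T2 -> R).
Hypotheses (mX1 : forall i, measurable_fun setT (X1 i))
           (mX2 : forall i, measurable_fun setT (X2 i)).
Hypothesis char_eq : forall (a : 'I_n -> R) b,
  \int[P1]_w cos (\sum_(i < n) a i * X1 i w + b) =
  \int[P2]_w cos (\sum_(i < n) a i * X2 i w + b).

Let prod_indic (T : Type) (X : 'I_n -> T -> R) (B : 'I_n -> set R) k w : R :=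
  \prod_(i < n | (i < k)%N) \1_(B i) (X i w).
Let tail_sum (T : Type) (X : 'I_n -> T -> R) (a : 'I_n -> R) k w : R :=
  \sum_(i < n | (k <= i)%N) a i * X i w.

Let measurable_prod_indic d (T : measurableType d) (X : 'I_n -> T -> R) B k :
  (forall i, measurable_fun setT (X i)) -> (forall i, measurable (B i)) ->
  measurable_fun setT (prod_indic X B k).
Proof.
move=> mX mB; rewrite /prod_indic; apply: measurable_fun_bigprod => i.
by apply: measurableT_comp => //; exact: measurable_indic.
Qed.

Let prod_indic_le1 (T : Type) (X : 'I_n -> T -> R) B k w :
  `|prod_indic X B k w| <= 1.
Proof.
rewrite /prod_indic; elim/big_ind : _ => //; first by rewrite normr1.
  by move=> x y x1 y1; rewrite normrM mulr_ile1.
by move=> i _; rewrite indicE; case: (_ \in _); rewrite ?normr1 ?normr0.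
Qed.

Let measurable_tail_sum d (T : measurableType d) (X : 'I_n -> T -> R) a k :
  (forall i, measurable_fun setT (X i)) -> measurable_fun setT (tail_sum X a k).
Proof.
by move=> mX; rewrite /tail_sum; apply: measurable_fun_bigsum => i; exact: measurable_funM.
Qed.

(** Induction on the number [k] of coordinates already converted into indicators; the remaining ones
    still carry frequencies. At stage [k] the indicators form the weight of [char_eq_indic] and the
    later coordinates its residual phase. *)
Let partial B k a b : (forall i, measurable (B i)) -> (k <= n)%N ->
  \int[P1]_w (prod_indic X1 B k w * cos (tail_sum X1 a k w + b)) =
  \int[P2]_w (prod_indic X2 B k w * cos (tail_sum X2 a k w + b)).
Proof.
move=> mB; elim: k a b => [|k ih] a b kn.
  have E d (T : measurableType d) (P : probability T R) (X : 'I_n -> T -> R) :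
    \int[P]_w (prod_indic X B 0 w * cos (tail_sum X a 0 w + b)) =
    \int[P]_w cos (\sum_(i < n) a i * X i w + b).
    by apply: eq_Rintegral => w _; rewrite /prod_indic big_pred0// mul1r.
  by rewrite !E.
pose i0 := Ordinal kn.
have pE (T : Type) (X : 'I_n -> T -> R) w :
    prod_indic X B k.+1 w = prod_indic X B k w * \1_(B i0) (X i0 w).
  rewrite /prod_indic (bigD1 i0)/=; last by rewrite ltnS.
  rewrite mulrC; congr (_ * _); apply: eq_bigl => i.
  by rewrite ltnS ltn_neqAle -(inj_eq val_inj)/= andbC.
have tE (T : Type) (X : 'I_n -> T -> R) a' w :
    tail_sum X (fun i => if i == i0 then a' else a i) k w = a' * X i0 w + tail_sum X a k.+1 w.
  rewrite /tail_sum (bigD1 i0)//= eqxx; congr (_ + _).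
  rewrite (eq_bigl (fun i : 'I_n => (k.+1 <= i)%N)).
    apply: eq_bigr => i ki; case: eqP => // ii.
    by move: ki; rewrite ii /= ltnn.
  by move=> i; rewrite -(inj_eq val_inj)/= ltn_neqAle eq_sym andbC.
under eq_Rintegral do rewrite pE mulrAC.
under [RHS]eq_Rintegral do rewrite pE mulrAC.
apply: (@char_eq_indic _ _ _ _ _ P1 P2 (X1 i0) (tail_sum X1 a k.+1) (prod_indic X1 B k)
  (X2 i0) (tail_sum X2 a k.+1) (prod_indic X2 B k) 1) => //; try exact: measurable_tail_sum;
  try exact: measurable_prod_indic.
move=> a' b'.
(* The induction hypothesis holds for all frequency vectors, so the frequency of the coordinate
   being converted can be set freely. *)
have := ih (fun i => if i == i0 then a' else a i) b' (ltnW kn).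
under eq_Rintegral do rewrite tE.
by under [in X in _ = X -> _]eq_Rintegral do rewrite tE.
Qed.

Lemma char_eq_rect B : (forall i, measurable (B i)) ->
  P1 [set w | forall i, B i (X1 i w)] = P2 [set w | forall i, B i (X2 i w)].
Proof.
move=> mB.
have E d (T : measurableType d) (P : probability T R) (X : 'I_n -> T -> R) :
    (forall i, measurable_fun setT (X i)) ->
    P [set w | forall i, B i (X i w)] =
    (\int[P]_w (prod_indic X B n w * cos (tail_sum X (fun=> 0) n w + 0)))%:E.
  move=> mX.
  have mE : measurable [set w | forall i, B i (X i w)].
    have -> : [set w | forall i, B i (X i w)] = \big[setI/setT]_(i < n) (X i @^-1` B i).
      rewrite -bigcap_seq; apply/seteqP; split => [x Bx i _|x Bx i]; first exact: Bx.
      by apply: Bx; rewrite /= mem_index_enum.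
    by apply: bigsetI_measurable => i _; rewrite -[X in measurable X]setTI; exact: mX.
  rewrite /Rintegral.
  rewrite (_ : (fun x => _) = (fun x => (\1_[set w | forall i, B i (X i w)] x)%:E)).
    by rewrite integral_indic// setIT fineK// fin_num_measure.
  apply/funext => w; congr EFin; rewrite /tail_sum big1 ?addr0; last by move=> i _; rewrite mul0r.
  rewrite cos0 mulr1 /prod_indic [RHS]indicE; case: (boolP (w \in _)) => [/set_mem Bw|Bw].
    by rewrite big1// => i _; rewrite indicE mem_set//; exact: Bw.
  have [i Bi] : exists i, ~ B i (X i w).
    by apply/existsNP => H; move/negP: Bw; apply; exact/mem_set.
  by apply/eqP/prodf_eq0; exists i => //; rewrite indicE memNset.
by rewrite !E// partial.
Qed.

End char_function.

Lemma char_eq_law d1 d2 (T1 : measurableType d1) (T2 : measurableType d2) (R : realType)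
    (P1 : probability T1 R) (P2 : probability T2 R) n (X1 : T1 -> vec R n) (X2 : T2 -> vec R n) :
  measurable_fun setT X1 -> measurable_fun setT X2 ->
  (forall (a : 'I_n -> R) b,
    \int[P1]_w cos (\sum_(i < n) a i * X1 w i ord0 + b) =
    \int[P2]_w cos (\sum_(i < n) a i * X2 w i ord0 + b)) ->
  forall E, measurable E -> P1 (X1 @^-1` E) = P2 (X2 @^-1` E).
Proof.
move=> mX1 mX2 e E mE; rewrite -(lawE P1 mX1) -(lawE P2 mX2).
apply: vec_measure_unique => //; last first.
  exact: (le_lt_trans (probability_le1 (law P1 mX1) measurableT) (ltry 1)).
move=> B mB; change (P1 [set w | forall i, B i (X1 w i ord0)] =
  P2 [set w | forall i, B i (X2 w i ord0)]).
apply: (@char_eq_rect _ _ _ _ _ P1 P2 n (fun i w => X1 w i ord0) (fun i w => X2 w i ord0)) => //.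
  by move=> i; apply: (measurableT_comp (measurable_coord i)).
by move=> i; apply: (measurableT_comp (measurable_coord i)).
Qed.

(** * Gaussian random variables *)

Section gauss1.
Context (R : realType).

Lemma normal_cos (m s a b : R) : s != 0 ->
  \int[normal_prob m s]_x cos (a * x + b) = cos (a * m + b) * expR (- (a ^+ 2 * s ^+ 2 / 2)).
Proof.
move=> s0; rewrite normal_Rintegral; last first.
  by apply: (measurableT_comp measurable_cosT); exact: measurable_affine.
rewrite -(normal_pdf_cos m a (a * m + b) s0); apply: eq_Rintegral => x _.
by congr (cos _ * _); ring.
Qed.

Lemma measurable_cos_affine d (T : measurableType d) (X : T -> R) a b :
  measurable_fun setT X -> measurable_fun setT (fun w => cos (a * X w + b)).
Proof.
move=> mX; apply: (measurableT_comp measurable_cosT).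
by apply: measurable_funD => //; apply: measurable_funM.
Qed.

Section rv.
Context d (T : measurableType d) (P : probability T R) (X : T -> R).
Hypothesis mX : measurable_fun setT X.

Definition has_gauss1 (m v : R) :=
  forall A, measurable A -> P (X @^-1` A) = gauss1 m v A.

Lemma gauss1_char m v a b : 0 <= v -> has_gauss1 m v ->
  \int[P]_w cos (a * X w + b) = cos (a * m + b) * expR (- (a ^+ 2 * v / 2)).
Proof.
move=> v0; rewrite /has_gauss1 /gauss1; case: eqP => [-> | /eqP v0'] XG.
  rewrite (@eq_law_Rintegral _ _ _ _ _ _ _ P (\d_m) X id (fun x => cos (a * x + b)))//; last first.
    exact: measurable_cos_affine.
  rewrite /Rintegral integral_dirac//=; last first.
    by apply/measurable_EFinP; exact: measurable_cos_affine.
  by rewrite indicT mul1r mulr0 mul0r oppr0 expR0 mulr1.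
have s0 : Num.sqrt v != 0 by rewrite gt_eqF// sqrtr_gt0 lt_def v0' v0.
rewrite (@eq_law_Rintegral _ _ _ _ _ _ _ P (normal_prob m (Num.sqrt v)) X id
  (fun x => cos (a * x + b)))//; last exact: measurable_cos_affine.
by rewrite normal_cos// sqr_sqrtr.
Qed.

Lemma char_gauss1 m v : 0 <= v ->
  (forall a b, \int[P]_w cos (a * X w + b) = cos (a * m + b) * expR (- (a ^+ 2 * v / 2))) ->
  has_gauss1 m v.
Proof.
move=> v0 e A mA.
(* It suffices to compare with any model having the same characteristic function: a Dirac mass when
   v = 0, the normal law otherwise. *)
suff H d2 (T2 : measurableType d2) (P2 : probability T2 R) (X2 : T2 -> R) :
    measurable_fun setT X2 ->
    (forall a b, \int[P2]_w cos (a * X2 w + b) = cos (a * m + b) * expR (- (a ^+ 2 * v / 2))) ->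
    P (X @^-1` A) = P2 (X2 @^-1` A).
  rewrite /gauss1; case: eqP => [vE | /eqP v0'].
    rewrite (H _ _ (\d_m) id) => // a b.
    rewrite /Rintegral integral_dirac//=; last first.
      by apply/measurable_EFinP; exact: measurable_cos_affine.
    by rewrite indicT mul1r vE mulr0 mul0r oppr0 expR0 mulr1.
  have s0 : Num.sqrt v != 0 by rewrite gt_eqF// sqrtr_gt0 lt_def v0' v0.
  rewrite (H _ _ (normal_prob m (Num.sqrt v)) id) => // a b.
  by rewrite normal_cos// sqr_sqrtr.
move=> mX2 e2.
have := @char_eq_rect _ _ _ _ _ P P2 1 (fun=> X) (fun=> X2) (fun=> mX) (fun=> mX2) _ (fun=> A) (fun=> mA).
have -> : [set w | 'I_1 -> A (X w)] = X @^-1` A.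
  by apply/seteqP; split => [w /(_ ord0)|w ? _].
have -> : [set w | 'I_1 -> A (X2 w)] = X2 @^-1` A.
  by apply/seteqP; split => [w /(_ ord0)|w ? _].
apply => a b; under eq_Rintegral do rewrite big_ord1.
by under [RHS]eq_Rintegral do rewrite big_ord1; rewrite e e2.
Qed.

Lemma gauss1_moments v : 0 <= v -> has_gauss1 0 v ->
  [/\ P.-integrable setT (EFin \o X), \int[P]_w X w = 0,
      P.-integrable setT (EFin \o (fun w => X w ^+ 2)) & \int[P]_w (X w ^+ 2) = v].
Proof.
move=> v0; rewrite /has_gauss1 /gauss1; case: eqP => [-> | /eqP v0'] XG.
  (* With variance zero the variable vanishes almost surely, and so do both moments. *)
  have X0 : {ae P, forall w, X w = 0}.
    exists (X @^-1` (~` [set 0])); split.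
    - by rewrite -[Y in measurable Y]setTI; apply: mX => //; apply: measurableC; exact: measurable_set1.
    - rewrite XG; last by apply: measurableC; exact: measurable_set1.
      by rewrite diracE memNset//=; apply.
    - by move=> w.
  have i0 (f : R -> R) : f 0 = 0 -> measurable_fun setT f ->
      P.-integrable setT (EFin \o (fun w => f (X w))) /\ \int[P]_w f (X w) = 0.
    move=> f0 mf.
    have ae0 : ae_eq P setT (EFin \o (fun w => f (X w))) (cst 0%E).
      by apply: filterS X0 => w Xw _ /=; rewrite Xw f0.
    have mfX : measurable_fun setT (EFin \o (fun w => f (X w))).
      by apply/measurable_EFinP; exact: measurableT_comp.
    split; last by rewrite /Rintegral (ae_eq_integral (cst 0%E))// integral0.
    apply/integrableP; split => //.
    rewrite (ae_eq_integral (cst 0%E))//; [by rewrite integral0|exact: measurableT_comp|].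
    by apply: filterS X0 => w Xw _ /=; rewrite Xw f0 normr0.
  have [? ?] := i0 id erefl (@measurable_id _ _ _).
  have [? ?] := i0 (fun x => x ^+ 2) (expr0n _ _) (measurable_funX 2 (@measurable_id _ _ _)).
  by split.
have s0 : Num.sqrt v != 0 by rewrite gt_eqF// sqrtr_gt0 lt_def v0' v0.
set s := Num.sqrt v in s0 XG.
have I (f : R -> R) : measurable_fun setT f -> (forall x, `|f x| <= 1 + (x - 0) ^+ 2) ->
    P.-integrable setT (EFin \o (fun w => f (X w))).
  move=> mf fb; apply/integrableP; split.
    by apply/measurable_EFinP; exact: measurableT_comp.
  have /integrableP[_] := normal_integrable s0 mf fb.
  rewrite (@eq_law_integral _ _ _ _ _ _ _ P (normal_prob 0 s) X id (fun x => `|(f x)%:E|%E))//.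
  by apply: measurableT_comp => //; exact/measurable_EFinP.
have m2 : measurable_fun setT (fun x : R => x ^+ 2) by exact: measurable_funX.
split.
- by apply: (I id) => // x; rewrite subr0; exact: norm_le_1sqr.
- rewrite (@eq_law_Rintegral _ _ _ _ _ _ _ P (normal_prob 0 s) X id id)// normal_Rintegral//.
  by rewrite -[RHS](normal_pdf_mean 0 s0); apply: eq_Rintegral => x _; rewrite subr0.
- by apply: (I (fun x => x ^+ 2)) => // x; rewrite subr0 ger0_norm ?sqr_ge0// lerDr.
- rewrite (@eq_law_Rintegral _ _ _ _ _ _ _ P (normal_prob 0 s) X id (fun x => x ^+ 2))//.
  rewrite normal_Rintegral// -[RHS]sqr_sqrtr// -[RHS](normal_pdf_var 0 s0).
  by apply: eq_Rintegral => x _; rewrite subr0.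
Qed.

End rv.

Definition vcons n (r : R) (v : vec R n) : vec R n.+1 :=
  \col_i (if unlift ord0 i is Some j then v j ord0 else r).

Lemma vcons0 n r (v : vec R n) : vcons r v ord0 ord0 = r.
Proof. by rewrite mxE unlift_none. Qed.

Lemma vconsS n r (v : vec R n) i : vcons r v (lift ord0 i) ord0 = v i ord0.
Proof. by rewrite mxE liftK. Qed.

Lemma measurable_vcons d (T : measurableType d) n (f : T -> R) (g : T -> vec R n) :
  measurable_fun setT f -> measurable_fun setT g ->
  measurable_fun setT (fun w => vcons (f w) (g w)).
Proof.
move=> mf mg; apply: measurable_fun_vec => i.
case: (unliftP ord0 i) => [j ->|->].
  under eq_fun do rewrite vconsS.
  exact: (measurableT_comp (measurable_coord j)).
by under eq_fun do rewrite vcons0.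
Qed.

Lemma rect_vcons n (B : 'I_n.+1 -> set R) (r : R) (v : vec R n) :
  rect B (vcons r v) <-> B ord0 r /\ rect (fun i => B (lift ord0 i)) v.
Proof.
split=> [H|[B0 BS] i].
  split; first by have := H ord0; rewrite vcons0.
  by move=> i; have := H (lift ord0 i); rewrite vconsS.
case: (unliftP ord0 i) => [j ->|->]; first by rewrite vconsS; exact: BS.
by rewrite vcons0.
Qed.

(** Induction on the dimension: the product of N(0,1) with the measure already built is pushed
    forward by [vcons]. The rectangle formula and the characteristic function are carried along
    together. *)
Lemma std_gauss_exists n : exists mu : probability (vec R n) R,
  (forall B, (forall i, measurable (B i)) ->
     mu (rect B) = (\prod_(i < n) fine (normal_prob 0 1 (B i)))%:E) /\
  (forall (a : 'I_n -> R) b, \int[mu]_x cos (\sum_(i < n) a i * x i ord0 + b) =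
     cos b * expR (- ((\sum_(i < n) a i ^+ 2) / 2))).
Proof.
elim: n => [|n [mu [murect muchar]]].
  exists (\d_(0 : vec R 0)); split.
    move=> B mB; rewrite big_ord0.
    change ((\1_(rect B) (0 : vec R 0) : R)%:E = 1%:E).
    by rewrite indicE mem_set// => -[].
  move=> a b; rewrite big_ord0 mul0r oppr0 expR0 mulr1.
  under eq_Rintegral do rewrite big_ord0 add0r.
  by rewrite Rintegral_cst//= indicT mulr1.
pose PP := product_probability (normal_prob (0 : R) 1) mu.
have mv : measurable_fun setT (fun z : R * vec R n => vcons z.1 z.2).
  exact: measurable_vcons.
exists (law PP mv); split.
  move=> B mB; rewrite big_ord_recl EFinM -murect//.
  have mB' : measurable (rect (fun i => B (lift ord0 i))) by exact: measurable_rect.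
  rewrite fineK ?fin_num_measure//; last exact: mB.
  have <- := @product_probabilityE _ _ _ _ _ (normal_prob 0 1) mu _ _ (mB ord0) mB'.
  rewrite lawE; congr (_ _); apply/seteqP; split => -[r v].
    by move/rect_vcons.
  by move=> [/= ? ?]; apply/rect_vcons.
move=> a b; rewrite Rintegral_law; last first.
  apply: (measurableT_comp measurable_cosT); apply: measurable_funD => //.
  by apply: measurable_fun_bigsum => i; apply: measurable_funM => //; exact: measurable_coord.
have E (z : R * vec R n) : cos (\sum_(i < n.+1) a i * vcons z.1 z.2 i ord0 + b) =
    cos (\sum_(i < n) a (lift ord0 i) * z.2 i ord0 + (a ord0 * z.1 + b)).
  congr cos; rewrite big_ord_recl vcons0 -addrA addrCA; congr (_ + _).
  by apply: eq_bigr => i _; rewrite vconsS.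
under eq_Rintegral do rewrite E.
rewrite (@Rintegral_product _ _ _ _ _ (normal_prob (0 : R) 1) mu
  (fun r (v : vec R n) => cos (\sum_(i < n) a (lift ord0 i) * v i ord0 + (a ord0 * r + b))) 1); last 2 first.
- apply: (measurableT_comp measurable_cosT); apply: measurable_funD.
    apply: measurable_fun_bigsum => i; apply: measurable_funM => //.
    exact: (measurableT_comp (measurable_coord i)).
  by apply: measurable_funD => //; apply: measurable_funM.
- by move=> r v; exact: norm_cos_le1.
under eq_Rintegral do rewrite muchar.
rewrite RintegralZr//; last first.
  apply: (@bounded_integrable _ _ _ (normal_prob 0 1) _ 1).
    exact: measurable_cos_affine.
  by move=> r; exact: norm_cos_le1.
rewrite normal_cos ?oner_neq0// mulr0 add0r -(mulrA (cos b)) -expRD; congr (_ * expR _).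
by rewrite big_ord_recl; field.
Qed.

Lemma std_gauss_sig n : {mu : probability (vec R n) R |
  (forall B, (forall i, measurable (B i)) ->
     mu (rect B) = (\prod_(i < n) fine (normal_prob 0 1 (B i)))%:E) /\
  (forall (a : 'I_n -> R) b, \int[mu]_x cos (\sum_(i < n) a i * x i ord0 + b) =
     cos b * expR (- ((\sum_(i < n) a i ^+ 2) / 2)))}.
Proof. exact: cid (std_gauss_exists n). Qed.

Definition std_gauss n : probability (vec R n) R := sval (std_gauss_sig n).

Lemma std_gauss_rect n B : (forall i, measurable (B i)) ->
  std_gauss n (rect B) = (\prod_(i < n) fine (normal_prob 0 1 (B i)))%:E.
Proof. by rewrite /std_gauss; case: std_gauss_sig => mu [] /= H _; exact: H. Qed.

Lemma std_gauss_char n (a : 'I_n -> R) b :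
  \int[std_gauss n]_x cos (\sum_(i < n) a i * x i ord0 + b) =
  cos b * expR (- ((\sum_(i < n) a i ^+ 2) / 2)).
Proof. by rewrite /std_gauss; case: std_gauss_sig => mu [] /= _ H; exact: H. Qed.

Section mutual_independence.
Context d (T : measurableType d) (P : probability T R).

(** Subfamilies are covered by taking some of the [B i] to be the whole line. *)
Definition mindep n (X : 'I_n -> T -> R) := forall B, (forall i, measurable (B i)) ->
  P [set w | forall i, B i (X i w)] = (\prod_(i < n) fine (P (X i @^-1` B i)))%:E.

Variables (n : nat) (X : 'I_n -> T -> R) (v : 'I_n -> R).
Hypotheses (mX : forall i, measurable_fun setT (X i)) (v0 : forall i, 0 <= v i).

(** The reference model for independent centred Gaussians: standard coordinates multiplied by
    standard deviations, zero allowed. Both implications below compare with it. *)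
Let scaled (i : 'I_n) (z : vec R n) : R := Num.sqrt (v i) * z i ord0.

Let mscaled i : measurable_fun setT (scaled i).
Proof. by apply: measurable_funM => //; exact: measurable_coord. Qed.

Let scaled_law i A : has_gauss1 P (X i) 0 (v i) -> measurable A ->
  normal_prob 0 1 ((fun z => Num.sqrt (v i) * z) @^-1` A) = P (X i @^-1` A).
Proof.
move=> XG mA; rewrite XG//.
apply: (@char_gauss1 _ _ (normal_prob 0 1) (fun z => Num.sqrt (v i) * z)) => //.
  exact: measurable_funM.
move=> a b; under eq_Rintegral do rewrite mulrA.
by rewrite normal_cos ?oner_neq0// exprMn sqr_sqrtr// mulr0 mulr0 expr1n mulr1.
Qed.

Let scaled_char (a : 'I_n -> R) b :
  \int[std_gauss n]_z cos (\sum_(i < n) a i * scaled i z + b) =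
  cos b * expR (- ((\sum_(i < n) a i ^+ 2 * v i) / 2)).
Proof.
transitivity (\int[std_gauss n]_z cos (\sum_(i < n) (a i * Num.sqrt (v i)) * z i ord0 + b)).
  apply: eq_Rintegral => z _; congr (cos (_ + _)); apply: eq_bigr => i _.
  by rewrite mulrA.
rewrite (std_gauss_char (fun i => a i * Num.sqrt (v i))).
rewrite (eq_bigr (fun i => a i ^+ 2 * v i))// => i _.
by rewrite exprMn sqr_sqrtr.
Qed.

Let scaled_rect B : (forall i, has_gauss1 P (X i) 0 (v i)) -> (forall i, measurable (B i)) ->
  std_gauss n [set z | forall i, B i (scaled i z)] =
  (\prod_(i < n) fine (P (X i @^-1` B i)))%:E.
Proof.
move=> XG mB.
have := @std_gauss_rect n (fun i => (fun z => Num.sqrt (v i) * z) @^-1` B i).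
rewrite -[rect _]/([set z | forall i, B i (scaled i z)]) => ->; last first.
  by move=> i; rewrite -[Y in measurable Y]setTI; apply: measurable_funM.
by congr EFin; apply: eq_bigr => i _; rewrite scaled_law.
Qed.

(** Independence fixes the joint law on rectangles, so it is that of the scaled standard vector,
    where the characteristic function is known. *)
Lemma mindep_char b : (forall i, has_gauss1 P (X i) 0 (v i)) -> mindep X ->
  \int[P]_w cos (\sum_(i < n) X i w + b) = cos b * expR (- ((\sum_(i < n) v i) / 2)).
Proof.
move=> XG iX.
pose Xv w : vec R n := \col_i X i w; pose Zv z : vec R n := \col_i scaled i z.
have mXv : measurable_fun setT Xv.
  exact: measurable_col.
have mZv : measurable_fun setT Zv.
  exact: measurable_col.
have E A : measurable A -> P (Xv @^-1` A) = std_gauss n (Zv @^-1` A).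
  move=> mA; rewrite -(lawE P mXv) -(lawE (std_gauss n) mZv).
  apply: vec_measure_unique => //; last first.
    exact: (le_lt_trans (probability_le1 (law P mXv) measurableT) (ltry 1)).
  move=> B mB; transitivity (P [set w | forall i, B i (X i w)]).
    rewrite [LHS]/(P (Xv @^-1` rect B)); congr (_ _).
    by apply/seteqP; split => w H i; have := H i; rewrite mxE.
  rewrite iX// -scaled_rect//; apply/esym.
  rewrite [LHS]/(std_gauss n (Zv @^-1` rect B)); congr (_ _).
  by apply/seteqP; split => w H i; have := H i; rewrite mxE.
have := @eq_law_Rintegral _ _ _ _ _ _ _ P (std_gauss n) Xv Zv
  (fun x : vec R n => cos (\sum_(i < n) x i ord0 + b)) mXv mZv E.
have -> : \int[P]_x cos (\sum_(i < n) Xv x i ord0 + b) = \int[P]_w cos (\sum_(i < n) X i w + b).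
  by apply: eq_Rintegral => w _; congr (cos (_ + _)); apply: eq_bigr => i _; rewrite mxE.
move=> ->; last first.
  apply: (measurableT_comp measurable_cosT); apply: measurable_funD => //.
  by apply: measurable_fun_bigsum => i; exact: measurable_coord.
have := scaled_char (fun=> 1) b.
under [in X in _ = X -> _]eq_bigr do rewrite expr1n mul1r.
move=> <-; apply: eq_Rintegral => z _; congr (cos (_ + _)).
by apply: eq_bigr => i _; rewrite mxE mul1r.
Qed.

Lemma char_mindep :
  (forall a b, \int[P]_w cos (\sum_(i < n) a i * X i w + b) =
     cos b * expR (- ((\sum_(i < n) a i ^+ 2 * v i) / 2))) ->
  mindep X /\ forall i, has_gauss1 P (X i) 0 (v i).
Proof.
move=> e.
have XG i : has_gauss1 P (X i) 0 (v i).
  apply: char_gauss1 => // a b.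
  (* Marginal laws come from switching off all other frequencies. *)
  have := e (fun j => if j == i then a else 0) b.
  rewrite [in X in _ = X -> _](bigD1 i)//= [in X in _ = X -> _]eqxx big1 ?addr0; last first.
    by move=> j /negbTE ->; rewrite expr0n/= mul0r.
  rewrite mulr0 add0r => <-; apply: eq_Rintegral => w _; congr (cos (_ + _)).
  rewrite (bigD1 i)//= eqxx big1 ?addr0// => j /negbTE ->; by rewrite mul0r.
split => // B mB; rewrite -scaled_rect//.
apply: char_eq_rect => // a b; by rewrite e scaled_char.
Qed.

End mutual_independence.

(** Induction on [n]: on a product space the first coordinate is replaced by an independent copy
    without changing the joint law, and Tonelli splits off its factor. *)
Lemma mindep_ge0_prod d (T : measurableType d) (P : probability T R) n
    (X : 'I_n -> T -> R) (f : 'I_n -> R -> R) (c : 'I_n -> R) :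
  (forall i, measurable_fun setT (X i)) -> mindep P X ->
  (forall i, measurable_fun setT (f i)) -> (forall i x, 0 <= f i x) ->
  (forall i, (\int[P]_w (f i (X i w))%:E = (c i)%:E)%E) ->
  (\int[P]_w (\prod_(i < n) f i (X i w))%:E = (\prod_(i < n) c i)%:E)%E.
Proof.
elim: n X f c => [|n ih] X f c mX iX mf f0 fc.
  under eq_integral do rewrite big_ord0.
  by rewrite big_ord0 integral_cst//= mul1e probability_setT.
pose X' i := X (lift ord0 i).
have iX' : mindep P X'.
  move=> B mB; have := iX (fun i => if unlift ord0 i is Some j then B j else setT).
  rewrite big_ord_recl unlift_none preimage_setT (_ : P setT = 1%E)?probability_setT//= mul1r.
  under eq_bigr do rewrite liftK; move=> <-; last by move=> i; case: unliftP.
  congr (_ _); apply/seteqP; split => w H i.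
    by case: unliftP => // j ->; exact: H.
  by have := H (lift ord0 i); rewrite liftK.
pose Xv w : vec R n.+1 := \col_i X i w.
pose X'v w : vec R n := \col_i X' i w.
have mXv : measurable_fun setT Xv.
  exact: measurable_col.
have mX'v : measurable_fun setT X'v.
  by apply: measurable_col => i; exact: mX.
pose PP := product_probability P P.
pose Zv (z : T * T) := vcons (X ord0 z.1) (X'v z.2).
have mZv : measurable_fun setT Zv.
  by apply: measurable_vcons; exact: measurableT_comp.
have E A : measurable A -> P (Xv @^-1` A) = PP (Zv @^-1` A).
  move=> mA; rewrite -(lawE P mXv) -(lawE PP mZv).
  apply: vec_measure_unique => //; last first.
    exact: (le_lt_trans (probability_le1 (law P mXv) measurableT) (ltry 1)).
  move=> B mB; transitivity (P [set w | forall i, B i (X i w)]).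
    rewrite [LHS]/(P (Xv @^-1` rect B)); congr (_ _).
    by apply/seteqP; split => w H i; have := H i; rewrite mxE.
  rewrite iX// big_ord_recl EFinM -iX'//.
  have m0 : measurable (X ord0 @^-1` B ord0).
    by rewrite -[Y in measurable Y]setTI; exact: mX.
  have m1 : measurable [set w | forall i, B (lift ord0 i) (X' i w)].
    have := mX'v measurableT _ (@measurable_rect R n (fun i => B (lift ord0 i)) (fun i => mB _)).
    rewrite setTI (_ : X'v @^-1` _ = [set w | forall i, B (lift ord0 i) (X' i w)])//.
    by apply/seteqP; split => w H i; have := H i; rewrite mxE.
  rewrite fineK ?fin_num_measure//.
  have <- := @product_probabilityE _ _ _ _ _ P P _ _ m0 m1.
  rewrite [RHS]/(PP (Zv @^-1` rect B)); congr (_ _); apply/seteqP; split => -[w1 w2].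
    by move=> [/= H0 H1]; apply/rect_vcons; split => // i; rewrite mxE; exact: H1.
  by move=> /rect_vcons[H0 H1]; split => //= i; have := H1 i; rewrite mxE.
have mF : measurable_fun setT (fun x : vec R n.+1 => (\prod_(i < n.+1) f i (x i ord0))%:E).
  apply/measurable_EFinP; apply: measurable_fun_bigprod => i.
  exact: (measurableT_comp (mf i) (measurable_coord i)).
have F0 (x : vec R n.+1) : (0 <= (\prod_(i < n.+1) f i (x i ord0))%:E)%E.
  by rewrite lee_fin; apply: prodr_ge0 => i _.
have := @eq_law_integral _ _ _ _ _ _ _ P PP Xv Zv _ mXv mZv E mF F0.
rewrite [X in X = _ -> _](_ : _ = \int[P]_w (\prod_(i < n.+1) f i (X i w))%:E)%E; last first.
  by apply: eq_integral => w _; congr EFin; apply: eq_bigr => i _; rewrite mxE.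
move=> ->.
transitivity (\int[PP]_z ((f ord0 (X ord0 z.1))%:E * (\prod_(i < n) f (lift ord0 i) (X' i z.2))%:E))%E.
  apply: eq_integral => z _; rewrite big_ord_recl vcons0 EFinM; congr (_ * _%:E)%E.
  by apply: eq_bigr => i _; rewrite vconsS mxE.
have mf0 : measurable_fun setT (fun w => f ord0 (X ord0 w)) by exact: measurableT_comp.
have mf1 : measurable_fun setT (fun w => \prod_(i < n) f (lift ord0 i) (X' i w)).
  by apply: measurable_fun_bigprod => i; exact: (measurableT_comp (mf _) (mX _)).
have f10 w : 0 <= \prod_(i < n) f (lift ord0 i) (X' i w) by apply: prodr_ge0 => i _.
rewrite ge0_integral_product; last 2 first.
- apply: emeasurable_funM; apply/measurable_EFinP.
    exact: (measurableT_comp mf0 measurable_fst).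
  exact: (measurableT_comp mf1 measurable_snd).
- by move=> z; rewrite mule_ge0 ?lee_fin.
transitivity (\int[P]_x ((f ord0 (X ord0 x))%:E * (\prod_(i < n) c (lift ord0 i))%:E))%E.
  apply: eq_integral => x _ /=; rewrite ge0_integralZl ?lee_fin//; last 2 first.
  - exact/measurable_EFinP.
  - by move=> w _; rewrite lee_fin.
  congr (_ * _)%E.
  apply: (ih X' (fun i => f (lift ord0 i)) (fun i => c (lift ord0 i))) => //.
  by move=> i; exact: mX.
have c0 i : 0 <= c i.
  by rewrite -lee_fin -fc; apply: integral_ge0 => w _; rewrite lee_fin.
rewrite ge0_integralZr//; last 3 first.
- exact/measurable_EFinP.
- by move=> w _; rewrite lee_fin.
- by rewrite lee_fin; apply: prodr_ge0.
by rewrite fc big_ord_recl EFinM.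
Qed.

End gauss1.

(** * Independence of two random elements *)

Section independence.
Context (R : realType) d (T : measurableType d) (P : probability T R).

Definition indep2 d1 d2 (T1 : measurableType d1) (T2 : measurableType d2)
    (X : T -> T1) (Y : T -> T2) := forall A B, measurable A -> measurable B ->
  P (X @^-1` A `&` Y @^-1` B) = (P (X @^-1` A) * P (Y @^-1` B))%E.

Lemma indep2_integral d1 d2 (T1 : measurableType d1) (T2 : measurableType d2)
    (X : T -> T1) (Y : T -> T2) (h : T1 * T2 -> \bar R) :
  measurable_fun setT X -> measurable_fun setT Y -> indep2 X Y ->
  measurable_fun setT h -> (forall z, 0 <= h z)%E ->
  (\int[P]_w h (X w, Y w) = \int[P]_w1 \int[P]_w2 h (X w1, Y w2))%E.
Proof.
move=> mX mY iXY mh h0.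
have mXY : measurable_fun setT (fun w => (X w, Y w)) by exact: measurable_fun_pair.
have mP : measurable_fun setT (fun z : T * T => (X z.1, Y z.2)).
  by apply: measurable_fun_pair; exact: measurableT_comp.
rewrite -(ge0_integral_law P mXY)//.
have mhP : measurable_fun setT (fun z : T * T => h (X z.1, Y z.2)).
  exact: (measurableT_comp mh mP).
have -> : (\int[P]_w1 \int[P]_w2 h (X w1, Y w2) =
   \int[product_probability P P]_z h (X z.1, Y z.2))%E.
  by rewrite ge0_integral_product.
transitivity (\int[product_probability (law P mX) (law P mY)]_z h z)%E.
  apply: eq_measure_integral => A mA _; apply/esym.
  apply: (@product_measure_unique _ _ _ _ _ (law P mX) (law P mY) (law P mXY)) => //.
rewrite ge0_integral_product//.
rewrite (ge0_integral_law P mX); last 2 first.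
- exact: (@measurable_fun_fubini_tonelli_F _ _ _ _ _ (law P mY) h).
- by move=> x; exact: integral_ge0.
rewrite ge0_integral_product//; apply: eq_integral => w _ /=.
by rewrite (ge0_integral_law P mY)//; exact: measurable_fun_pair2.
Qed.

(** The stacked vector (X, Y) is compared with the vector built from X on one copy of the space and
    Y on another; the hypothesis says that their characteristic functions agree. *)
Lemma char_indep2 n k (X : T -> vec R n) (Y : T -> vec R k) :
  measurable_fun setT X -> measurable_fun setT Y ->
  (forall (a : 'I_n -> R) (b : 'I_k -> R) c,
    \int[P]_w cos (\sum_(i < n) a i * X w i ord0 + \sum_(j < k) b j * Y w j ord0 + c) =
    \int[P]_w1 \int[P]_w2
      cos (\sum_(i < n) a i * X w1 i ord0 + \sum_(j < k) b j * Y w2 j ord0 + c)) ->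
  indep2 X Y.
Proof.
move=> mX mY e A B mA mB.
pose PP := product_probability P P.
pose Z1 w : vec R (n + k) := col_mx (X w) (Y w).
pose Z2 (z : T * T) : vec R (n + k) := col_mx (X z.1) (Y z.2).
have mZ d' (T' : measurableType d') (f : T' -> vec R n) (g : T' -> vec R k) :
    measurable_fun setT f -> measurable_fun setT g ->
    measurable_fun setT (fun w => col_mx (f w) (g w) : vec R (n + k)).
  move=> mf mg; apply: measurable_fun_vec => i; rewrite -(splitK i).
  case: (fintype.split i) => j /=.
    under eq_fun do rewrite col_mxEu.
    exact: (measurableT_comp (measurable_coord j)).
  under eq_fun do rewrite col_mxEd.
  exact: (measurableT_comp (measurable_coord j)).
have mZ1 : measurable_fun setT Z1 by exact: mZ.
have mZ2 : measurable_fun setT Z2 by apply: mZ; exact: measurableT_comp.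
pose E : set (vec R (n + k)) := (fun z => usubmx z : vec R n) @^-1` A `&`
  (fun z => dsubmx z : vec R k) @^-1` B.
have mE : measurable E.
  apply: measurableI; rewrite -[Y in measurable Y]setTI.
    suff : measurable_fun setT (fun z : vec R (n + k) => usubmx z : vec R n) by exact.
    apply: measurable_fun_vec => i; rewrite (_ : (fun w => _) = fun w : vec R (n + k) => w (lshift k i) ord0).
      exact: measurable_coord.
    by apply/funext => w; rewrite mxE.
  suff : measurable_fun setT (fun z : vec R (n + k) => dsubmx z : vec R k) by exact.
  apply: measurable_fun_vec => i; rewrite (_ : (fun w => _) = fun w : vec R (n + k) => w (rshift n i) ord0).
    exact: measurable_coord.
  by apply/funext => w; rewrite mxE.
have H := @char_eq_law _ _ _ _ _ P PP _ Z1 Z2 mZ1 mZ2 _ E mE.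
have E1 : Z1 @^-1` E = X @^-1` A `&` Y @^-1` B.
  by apply/seteqP; split => w; rewrite /E /Z1 /= col_mxKu col_mxKd.
have E2 : Z2 @^-1` E = (X @^-1` A) `*` (Y @^-1` B).
  by apply/seteqP; split => w; rewrite /E /Z2 /= col_mxKu col_mxKd.
rewrite -E1 H ?E2.
  apply: product_probabilityE; rewrite -[Y in measurable Y]setTI.
    exact: mX.
  exact: mY.
move=> a b.
have S (x : vec R n) (y : vec R k) : \sum_(i < n + k) a i * (col_mx x y : vec R (n + k)) i ord0 =
  \sum_(i < n) a (lshift k i) * x i ord0 + \sum_(j < k) a (rshift n j) * y j ord0.
  rewrite big_split_ord/=; congr (_ + _); apply: eq_bigr => i _.
    by rewrite col_mxEu.
  by rewrite col_mxEd.
under eq_Rintegral do rewrite S.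
rewrite e; under [RHS]eq_Rintegral do rewrite S.
rewrite (@Rintegral_product _ _ _ _ _ P P (fun w1 w2 => cos (\sum_(i < n) a (lshift k i) * X w1 i ord0 + \sum_(j < k) a (rshift n j) * Y w2 j ord0 + b)) 1)//.
  apply: (measurableT_comp measurable_cosT); apply: measurable_funD => //.
  apply: measurable_funD; apply: measurable_fun_bigsum => i; apply: measurable_funM => //.
    exact: (measurableT_comp (measurable_coord i)) (measurableT_comp mX _).
  exact: (measurableT_comp (measurable_coord i)) (measurableT_comp mY _).
by move=> x y; exact: norm_cos_le1.
Qed.

End independence.

(** * Mutual information *)

Section finite_valued.
Context (R : realType) d (T : measurableType d).

(** Finite targets are plain [finType]s without a sigma-algebra; for them, measurability of every
    fibre is all that is needed. *)
Definition measurable_fibers (K : eqType) (g : T -> K) :=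
  forall k, measurable (g @^-1` [set k]).

Lemma measurable_fibers_pair (K1 K2 : eqType) (f : T -> K1) (g : T -> K2) :
  measurable_fibers f -> measurable_fibers g -> measurable_fibers (fun x => (f x, g x)).
Proof.
move=> mf mg [k l]; rewrite (_ : _ @^-1` _ = f @^-1` [set k] `&` g @^-1` [set l]).
  exact: measurableI.
by apply/seteqP; split => x /= [] // -> ->.
Qed.

Lemma measurable_fibers_ffun (I : finType) (K : finType) (f : I -> T -> K) :
  (forall i, measurable_fibers (f i)) -> measurable_fibers (fun x => [ffun i => f i x]).
Proof.
move=> mf k; rewrite (_ : _ @^-1` _ = \big[setI/setT]_(i : I) (f i @^-1` [set k i])).
  by apply: bigsetI_measurable => i _; exact: mf.
rewrite -bigcap_seq; apply/seteqP; split => x.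
  by move=> /= <- i _; rewrite ffunE.
by move=> H; apply/ffunP => i; rewrite ffunE; apply: (H i); rewrite /= mem_index_enum.
Qed.

Lemma measurable_fibers_comp d' (T' : measurableType d') (K : eqType) (g : T -> K) (U : T' -> T) :
  measurable_fun setT U -> measurable_fibers g ->
  forall k, measurable ((g \o U) @^-1` [set k]).
Proof. by move=> mU mg k; rewrite comp_preimage -[Y in measurable Y]setTI; exact: mU. Qed.

Lemma finite_sumE (K : finType) (g : T -> K) (h : K -> R) w :
  h (g w) = \sum_k h k * \1_(g @^-1` [set k]) w.
Proof.
rewrite (bigD1 (g w))//= indicE mem_set// mulr1 big1 ?addr0// => k kg.
by rewrite indicE memNset ?mulr0// => /= gk; rewrite gk eqxx in kg.
Qed.

Lemma measurable_finite (K : finType) (g : T -> K) (h : K -> R) :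
  measurable_fibers g -> measurable_fun setT (fun w => h (g w)).
Proof.
move=> mg; under eq_fun do rewrite finite_sumE.
by apply: measurable_fun_bigsum => k; apply: measurable_funM => //; exact: measurable_indic.
Qed.

Lemma Rintegral_finite (P : probability T R) (K : finType) (g : T -> K) (h : K -> R) :
  measurable_fibers g ->
  \int[P]_w h (g w) = \sum_k h k * Pr P (g @^-1` [set k]).
Proof.
move=> mg; transitivity (\int[P]_w \sum_k h k * \1_(g @^-1` [set k]) w).
  by apply: eq_Rintegral => w _; rewrite -finite_sumE.
have i1 k : P.-integrable setT (EFin \o (\1_(g @^-1` [set k]) : T -> R)).
  apply: (@bounded_integrable _ _ _ P _ 1); first exact: measurable_indic.
  by move=> w; rewrite indicE; case: (_ \in _); rewrite ?normr1 ?normr0.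
rewrite Rintegral_sum; last by move=> k; exact: integrableRZ.
apply: eq_bigr => k _; rewrite RintegralZl//; congr (_ * _).
by rewrite /Rintegral integral_indic// setIT.
Qed.

End finite_valued.

Section quantizer.
Context (R : realType).

(** Cells of width 1/N on [-N, N]. Points below the range truncate to cell 0, and [inord] also sends
    indices beyond the range to 0; this is harmless because each fixed point is eventually in
    range. *)
Definition qidx (N : nat) (x : R) : 'I_(2 * N * N).+1 :=
  inord (Num.truncn ((x + N%:R) * N%:R)).
Definition qval (N k : nat) : R := k%:R / N%:R - N%:R.

Lemma qval_cvg x : qval n.+1 (qidx n.+1 x) @[n --> \oo] --> x.
Proof.
apply/cvgrPdist_le => e e0; near=> n.
have xn : `|x| < n.+1%:R.
  near: n; exists (Num.truncn `|x|) => //= n /= xn.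
  by apply: lt_le_trans (truncnS_gt _) _; rewrite ler_nat ltnS.
have ne : n.+1%:R^-1 <= e.
  near: n; have := @cvg_harmonic R => /cvgr_le; apply => //.
have N0 : 0 < n.+1%:R :> R by rewrite ltr0n.
have [x1 x2] : - n.+1%:R < x /\ x < n.+1%:R by apply/andP; rewrite -ltr_norml.
set t := (x + n.+1%:R) * n.+1%:R.
have t0 : 0 <= t by rewrite mulr_ge0 ?ler0n//; lra.
have /andP[t1 t2] := truncn_itv t0.
have tb : (Num.truncn t < (2 * n.+1 * n.+1).+1)%N.
  rewrite ltnS -(ler_nat R) (le_trans t1)// /t !natrM ler_pM2r//.
  by rewrite mulr_natl mulr2n; lra.
rewrite /qval /qidx -/t inordK//.
have -> : x - ((Num.truncn t)%:R / n.+1%:R - n.+1%:R) = (t - (Num.truncn t)%:R) / n.+1%:R.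
  by rewrite /t; field; rewrite gt_eqF.
rewrite ger0_norm ?divr_ge0 ?subr_ge0 ?ler0n//.
apply: le_trans ne; rewrite ler_pdivrMr// mulVf ?gt_eqF//.
by rewrite -natr1 in t2; lra.
Unshelve. all: end_near. Qed.

Lemma measurable_qidx d (T : measurableType d) (f : T -> R) N :
  measurable_fun setT f -> measurable_fibers (fun x => qidx N (f x)).
Proof.
move=> mf k.
pose t x := (f x + N%:R) * N%:R.
have mt : measurable_fun setT t.
  by apply: measurable_funM => //; exact: measurable_funD.
have ml c : measurable [set x | (Num.truncn (t x) <= c)%N].
  rewrite (_ : [set x | _] = t @^-1` `]-oo, c.+1%:R[).
    by rewrite -[Y in measurable Y]setTI; exact: mt.
  by apply/seteqP; split => x /=; rewrite in_itv/= truncn_le_nat.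
have mc c : measurable [set x | Num.truncn (t x) = c].
  case: c => [|c].
    rewrite (_ : [set x | _] = [set x | (Num.truncn (t x) <= 0)%N])//.
    by apply/seteqP; split => x /=; rewrite leqn0 => /eqP.
  rewrite (_ : [set x | _] = [set x | (Num.truncn (t x) <= c.+1)%N] `\`
    [set x | (Num.truncn (t x) <= c)%N]); first exact: measurableD.
  apply/seteqP; split => x /=; first by move=> ->; rewrite leqnn ltnn.
  by move=> [h1 /negP]; rewrite -ltnNge => h2; apply/eqP; rewrite eqn_leq h1.
(* Several integers may share a cell because [inord] has a default, hence a countable union. *)
rewrite (_ : _ @^-1` _ = \bigcup_(c in [set c | inord c = k]) [set x | Num.truncn (t x) = c]).
  exact: bigcup_measurable.
apply/seteqP; split => x /=; first by move=> <-; exists (Num.truncn (t x)).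
by move=> [c /= <- <-].
Qed.

End quantizer.

Section clamp.
Context (R : realType).

Lemma cvg_bigsum (I : Type) (r : seq I) (f : nat -> I -> R) (l : I -> R) :
  (forall i, f ^~ i @ \oo --> l i) ->
  \sum_(i <- r) f k i @[k --> \oo] --> \sum_(i <- r) l i.
Proof.
move=> fl; elim: r => [|i r ih].
  by under eq_fun do rewrite big_nil; rewrite big_nil; exact: cvg_cst.
under eq_fun do rewrite big_cons; rewrite big_cons.
by apply: cvgD => //; exact: fl.
Qed.

Definition clamp (M z : R) := Num.min (Num.max z (- M)) M.

Lemma clamp_norm_le M z : 0 <= M -> `|clamp M z| <= M.
Proof.
move=> M0; rewrite /clamp ler_norml le_min ge_min lexx orbT andbT.
by rewrite le_max lexx orbT /=; lra.
Qed.

Lemma clamp_id M z : `|z| <= M -> clamp M z = z.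
Proof. by rewrite ler_norml /clamp => /andP[z1 z2]; rewrite max_l// min_l. Qed.

Lemma cvg_clamp M (f : nat -> R) l : f @ \oo --> l -> clamp M (f k) @[k --> \oo] --> clamp M l.
Proof.
move=> fl.
(* Written with absolute values, the clamp inherits continuity from the norm. *)
have cE z : clamp M z = ((z - M + `|z + M|) / 2 + M - `|(z - M + `|z + M|) / 2 - M|) / 2.
  by rewrite /clamp minr_absE maxr_absE opprK.
under eq_fun do rewrite cE; rewrite cE.
have c1 : (f k - M + `|f k + M|) / 2 @[k --> \oo] --> (l - M + `|l + M|) / 2.
  apply: cvgM; last exact: cvg_cst.
  apply: cvgD; first by apply: cvgB => //; exact: cvg_cst.
  by apply: cvg_norm; apply: cvgD => //; exact: cvg_cst.
apply: cvgM; last exact: cvg_cst.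
apply: cvgB; first by apply: cvgD => //; exact: cvg_cst.
by apply: cvg_norm; apply: cvgB => //; exact: cvg_cst.
Qed.

End clamp.

Section mutual_information.
Context (R : realType) d (T : measurableType d) (P : probability T R).
Context d1 d2 (T1 : measurableType d1) (T2 : measurableType d2).
Variables (U : T -> T1) (V : T -> T2).
Hypotheses (mU : measurable_fun setT U) (mV : measurable_fun setT V).

Lemma PrE (A : set T) : measurable A -> (Pr P A)%:E = P A.
Proof. by move=> mA; rewrite /Pr fineK// fin_num_measure. Qed.

Lemma Pr_ge0 (A : set T) : 0 <= Pr P A.
Proof. by rewrite /Pr fine_ge0. Qed.

Lemma le_Pr (A B : set T) : measurable A -> measurable B -> A `<=` B -> Pr P A <= Pr P B.
Proof. by move=> mA mB AB; rewrite -lee_fin !PrE// le_measure ?inE. Qed.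

(** The duality behind Donsker-Varadhan, one cell at a time: exp u >= 1 + u at u = F - ln (p / (a
    b)), multiplied by p. *)
Lemma xlog_gibbs (p a b F : R) : 0 <= p -> 0 <= a -> 0 <= b -> (0 < p -> 0 < a /\ 0 < b) ->
  p * F + p <= xlog p a b + a * b * expR F.
Proof.
move=> p0 a0 b0 pab; rewrite /xlog; case: eqP => [->|/eqP pn0].
  by rewrite mul0r !add0r !mulr_ge0// expR_ge0.
have {}p0 : 0 < p by rewrite lt_def pn0.
have [{}a0 {}b0] := pab p0; have ab0 : 0 < a * b by exact: mulr_gt0.
have := expR_ge1Dx (F - ln (p / (a * b))).
rewrite expRD expRN lnK ?posrE ?divr_gt0// invf_div => H.
have : p * (1 + (F - ln (p / (a * b)))) <= p * (expR F * ((a * b) / p)) by rewrite ler_pM2l.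
have -> : p * (expR F * ((a * b) / p)) = a * b * expR F by field.
rewrite mulrDr mulr1 mulrBr; lra.
Qed.

Lemma mutual_info_finite (K1 K2 : finType) (f : T1 -> K1) (g : T2 -> K2) (B : R) :
  measurable_fibers f -> measurable_fibers g -> (mutual_info P U V <= B%:E)%E ->
  \sum_k \sum_l xlog (Pr P (U @^-1` (f @^-1` [set k]) `&` V @^-1` (g @^-1` [set l])))
    (Pr P (U @^-1` (f @^-1` [set k]))) (Pr P (V @^-1` (g @^-1` [set l]))) <= B.
Proof.
move=> mf mg MI; rewrite -lee_fin; apply: le_trans MI; apply: ereal_sup_ubound => /=.
exists #|K1|, #|K2|, (fun i => f @^-1` [set enum_val i]), (fun j => g @^-1` [set enum_val j]).
have part dd (TT : measurableType dd) (K : finType) (h : TT -> K) : measurable_fibers h ->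
    is_partition (fun i : 'I_#|K| => h @^-1` [set enum_val i]).
  move=> mh; split; first by move=> i; exact: mh.
  split => [i j ij|x]; last by exists (enum_rank (h x)); rewrite /= enum_rankK.
  apply/seteqP; split => // x [/= hi hj]; move/eqP: ij; apply.
  by apply: enum_val_inj; rewrite -hi -hj.
split; [exact: part|exact: part|].
congr EFin; rewrite (reindex (@enum_val K1 predT))/=; last first.
  by apply: onW_bij; exact: enum_val_bij.
apply: eq_bigr => i _; rewrite (reindex (@enum_val K2 predT))//=.
by apply: onW_bij; exact: enum_val_bij.
Qed.

(** Sums [xlog_gibbs] over the cells cut out by [f] and [g]; the 1 on the left is the total mass of
    the joint law. *)
Lemma donsker_varadhan_finite (K1 K2 : finType) (f : T1 -> K1) (g : T2 -> K2)
    (F : K1 -> K2 -> R) (B : R) :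
  measurable_fibers f -> measurable_fibers g -> (mutual_info P U V <= B%:E)%E ->
  \int[P]_w F (f (U w)) (g (V w)) + 1 <=
  B + \int[P]_w1 \int[P]_w2 expR (F (f (U w1)) (g (V w2))).
Proof.
move=> mf mg MI.
have mfU := measurable_fibers_comp mU mf; have mgV := measurable_fibers_comp mV mg.
pose p k l := Pr P (U @^-1` (f @^-1` [set k]) `&` V @^-1` (g @^-1` [set l])).
pose a k := Pr P (U @^-1` (f @^-1` [set k])).
pose b l := Pr P (V @^-1` (g @^-1` [set l])).
have mI k l : measurable (U @^-1` (f @^-1` [set k]) `&` V @^-1` (g @^-1` [set l])).
  by apply: measurableI; [exact: mfU|exact: mgV].
have E1 (h : K1 -> K2 -> R) : \int[P]_w h (f (U w)) (g (V w)) = \sum_k \sum_l h k l * p k l.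
  have := @Rintegral_finite R _ _ P _ (fun w => (f (U w), g (V w)))
    (fun z => h z.1 z.2) (measurable_fibers_pair mfU mgV).
  move=> ->; rewrite pair_big/=; apply: eq_bigr => -[k l] _ /=; congr (_ * Pr P _).
  by apply/seteqP; split => w /= [] // -> ->.
have E2 : \int[P]_w1 \int[P]_w2 expR (F (f (U w1)) (g (V w2))) =
    \sum_k \sum_l a k * b l * expR (F k l).
  transitivity (\int[P]_w1 \sum_l expR (F (f (U w1)) l) * b l).
    by apply: eq_Rintegral => w _; rewrite (Rintegral_finite P (fun l => expR (F (f (U w)) l)) mgV).
  rewrite (Rintegral_finite P (fun k => \sum_l expR (F k l) * b l) mfU).
  apply: eq_bigr => k _; rewrite mulr_suml; apply: eq_bigr => l _.
  by rewrite -/(a k); ring.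
have p1 : \sum_k \sum_l p k l = 1.
  have E : 1 = \sum_k \sum_l 1 * p k l.
    by rewrite -(E1 (fun _ _ => 1)) Rintegral_cst//= probability_setT mul1r.
  by rewrite [RHS]E; apply: eq_bigr => k _; apply: eq_bigr => l _; rewrite mul1r.
rewrite (E1 F) E2 -[in leLHS]p1.
apply: le_trans (_ : \sum_k \sum_l (xlog (p k l) (a k) (b l) + a k * b l * expR (F k l)) <= _).
  rewrite -big_split/=; apply: ler_sum => k _; rewrite -big_split/=; apply: ler_sum => l _.
  rewrite mulrC; apply: xlog_gibbs; rewrite ?Pr_ge0// => p0.
  split; apply: (lt_le_trans p0); apply: le_Pr => //.
  - exact: mfU.
  - exact: mgV.
under eq_bigr do rewrite big_split/=.
rewrite big_split/= lerD2r; exact: mutual_info_finite.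
Qed.

(* Donsker-Varadhan, with [ln x <= x - 1] already used on the exponential moment. *)
Lemma donsker_varadhan n m (a : 'I_n -> T1 -> R) (b : 'I_m -> T2 -> R)
    (F : ('I_n -> R) -> ('I_m -> R) -> R) (M B : R) :
  (forall i, measurable_fun setT (a i)) -> (forall i, measurable_fun setT (b i)) ->
  (forall x y, `|F x y| <= M) ->
  (forall (x_ : nat -> 'I_n -> R) (y_ : nat -> 'I_m -> R) x y,
    (forall i, x_ ^~ i @ \oo --> x i) -> (forall j, y_ ^~ j @ \oo --> y j) ->
    F (x_ k) (y_ k) @[k --> \oo] --> F x y) ->
  (mutual_info P U V <= B%:E)%E ->
  \int[P]_w F (a ^~ (U w)) (b ^~ (V w)) + 1 <=
  B + \int[product_probability P P]_z expR (F (a ^~ (U z.1)) (b ^~ (V z.2))).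
Proof.
move=> ma mb FM Fc MI.
(* Each coordinate is quantised; continuity of [F] gives pointwise convergence and its bound [M]
   gives domination, under the joint law and under the product law alike. *)
pose f k x := [ffun i => qidx k.+1 (a i x)]; pose g k y := [ffun j => qidx k.+1 (b j y)].
pose G k (p : {ffun 'I_n -> 'I_(2 * k.+1 * k.+1).+1}) (q : {ffun 'I_m -> 'I_(2 * k.+1 * k.+1).+1}) :=
  F (fun i => qval R k.+1 (p i)) (fun j => qval R k.+1 (q j)).
have mf k : measurable_fibers (f k).
  by apply: measurable_fibers_ffun => i; exact: measurable_qidx.
have mg k : measurable_fibers (g k).
  by apply: measurable_fibers_ffun => i; exact: measurable_qidx.
have Gcvg s t : G k (f k s) (g k t) @[k --> \oo] --> F (a ^~ s) (b ^~ t).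
  apply: Fc => i.
    rewrite (_ : (fun k => _) = fun k => qval R k.+1 (qidx k.+1 (a i s))); first exact: qval_cvg.
    by apply/funext => k; rewrite /f ffunE.
  rewrite (_ : (fun k => _) = fun k => qval R k.+1 (qidx k.+1 (b i t))); first exact: qval_cvg.
  by apply/funext => k; rewrite /g ffunE.
have M0 : 0 <= M by apply: le_trans (FM (fun=> 0) (fun=> 0)).
have mG k : measurable_fun setT (fun z : T * T => G k (f k (U z.1)) (g k (V z.2))).
  apply: (measurable_finite (g := fun z : T * T => (f k (U z.1), g k (V z.2)))
    (fun z => G k z.1 z.2)).
  apply: measurable_fibers_pair.
    exact: (measurable_fibers_comp (measurableT_comp mU measurable_fst) (mf k)).
  exact: (measurable_fibers_comp (measurableT_comp mV measurable_snd) (mg k)).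
have C1 : \int[P]_w G k (f k (U w)) (g k (V w)) @[k --> \oo] -->
    \int[P]_w F (a ^~ (U w)) (b ^~ (V w)).
  have [||||//] := @Rintegral_dominated_cvg _ _ _ P
    (fun k w => G k (f k (U w)) (g k (V w))) (fun w => F (a ^~ (U w)) (b ^~ (V w))) (cst M).
  - move=> k; apply: (measurable_finite (g := fun w => (f k (U w), g k (V w)))
      (fun z => G k z.1 z.2)).
    apply: measurable_fibers_pair.
      exact: (measurable_fibers_comp mU (mf k)).
    exact: (measurable_fibers_comp mV (mg k)).
  - by move=> w; exact: Gcvg.
  - exact: finite_measure_integrable_cst.
  - by move=> k w; exact: FM.
have C2 : \int[product_probability P P]_z expR (G k (f k (U z.1)) (g k (V z.2))) @[k --> \oo] -->
    \int[product_probability P P]_z expR (F (a ^~ (U z.1)) (b ^~ (V z.2))).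
  have [||||//] := @Rintegral_dominated_cvg _ _ _ (product_probability P P)
    (fun k z => expR (G k (f k (U z.1)) (g k (V z.2))))
    (fun z => expR (F (a ^~ (U z.1)) (b ^~ (V z.2)))) (cst (expR M)).
  - by move=> k; apply: measurableT_comp => //; exact: mG.
  - move=> z; apply: (cvg_comp (fun k => G k (f k (U z.1)) (g k (V z.2))) expR).
      exact: Gcvg.
    exact: continuous_expR.
  - exact: finite_measure_integrable_cst.
  - move=> k z; rewrite ger0_norm ?expR_ge0// ler_expR.
    by apply: le_trans (ler_norm _) _; exact: FM.
have C1' : \int[P]_w G k (f k (U w)) (g k (V w)) + 1 @[k --> \oo] -->
    \int[P]_w F (a ^~ (U w)) (b ^~ (V w)) + 1.
  by apply: cvgD; [exact: C1|exact: cvg_cst].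
have C2' : B + \int[product_probability P P]_z expR (G k (f k (U z.1)) (g k (V z.2))) @[k --> \oo] -->
    B + \int[product_probability P P]_z expR (F (a ^~ (U z.1)) (b ^~ (V z.2))).
  by apply: cvgD; [exact: cvg_cst|exact: C2].
apply: (ler_cvg_to C1' C2'); apply: nearW => k.
rewrite /= (@Rintegral_product _ _ _ _ _ P P
  (fun w1 w2 => expR (G k (f k (U w1)) (g k (V w2)))) (expR M)); last 2 first.
- by apply: measurableT_comp => //; exact: mG.
- move=> x y; rewrite ger0_norm ?expR_ge0// ler_expR.
  by apply: le_trans (ler_norm _) _; exact: FM.
exact: (donsker_varadhan_finite (G k) (mf k) (mg k) MI).
Qed.

(** [L] plays the logarithm of the density of the joint law with respect to the product of the
    marginals. On a cell with ratio c = p / (a b), integrating 1 + ln c <= c exp(-L) + L gives p + p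
    ln c <= p + the integral of L, that is, the contribution of that cell. *)
Lemma mutual_info_le_log (L : T -> R) : measurable_fun setT L ->
  P.-integrable setT (EFin \o L) ->
  (forall A B, measurable A -> measurable B ->
    \int[P]_(w in U @^-1` A `&` V @^-1` B) (expR (- L w))%:E
      <= P (U @^-1` A) * P (V @^-1` B))%E ->
  (mutual_info P U V <= (\int[P]_w L w)%:E)%E.
Proof.
move=> mL iL H; apply: ub_ereal_sup => _ [n [m [A [B [[mA [dA cA]] [mB [dB cB]] ->]]]]].
rewrite lee_fin.
pose C i j := U @^-1` A i `&` V @^-1` B j.
have mUA i : measurable (U @^-1` A i) by rewrite -[Y in measurable Y]setTI; exact: mU.
have mVB i : measurable (V @^-1` B i) by rewrite -[Y in measurable Y]setTI; exact: mV.
have mC i j : measurable (C i j) by exact: measurableI.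
have LE w : L w = \sum_(i < n) \sum_(j < m) L w * \1_(C i j) w.
  have [i0 Ai0] := cA (U w); have [j0 Bj0] := cB (V w).
  rewrite (bigD1 i0)//= (bigD1 j0)//= indicE mem_set ?mulr1//.
  rewrite big1 ?addr0; last first.
    move=> j jj0; rewrite indicE memNset ?mulr0// => -[_ /= Bj].
    by have : (B j `&` B j0) (V w) by []; rewrite dB.
  rewrite big1 ?addr0// => i ii0; rewrite big1// => j _.
  rewrite indicE memNset ?mulr0// => -[/= Ai _].
  by have : (A i `&` A i0) (U w) by []; rewrite dA.
have iLC i j : P.-integrable setT (EFin \o (fun w => L w * \1_(C i j) w)).
  apply: (@le_integrable _ _ _ P setT measurableT _ (EFin \o L)) => //.
    by apply/measurable_EFinP; apply: measurable_funM => //; exact: measurable_indic.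
  move=> w _; rewrite lee_fin normrM ler_piMr// indicE.
  by case: (_ \in _); rewrite ?normr1 ?normr0.
have -> : \int[P]_w L w = \sum_(i < n) \sum_(j < m) \int[P]_w (L w * \1_(C i j) w).
  transitivity (\int[P]_w (\sum_(i < n) \sum_(j < m) L w * \1_(C i j) w)).
    by apply: eq_Rintegral => w _; rewrite -LE.
  rewrite Rintegral_sum; last by move=> i; exact: integrableR_sum.
  by apply: eq_bigr => i _; rewrite Rintegral_sum.
apply: ler_sum => i _; apply: ler_sum => j _.
rewrite -/(C i j); set p := Pr P (C i j); set a := Pr P (U @^-1` _); set b := Pr P (V @^-1` _).
have pa : p <= a by apply: le_Pr => // w [].
have pb : p <= b by apply: le_Pr => // w [].
rewrite /xlog; case: eqP => [p0|/eqP pn0].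
  (* On a null cell both sides are zero, by the convention in [xlog] and because the integral runs
     over a null set. *)
  have PC0 : P (C i j) = 0%E by rewrite -PrE// -/p p0.
  rewrite /Rintegral le_eqVlt; apply/orP; left; apply/eqP/esym.
  rewrite (_ : (fun w => _) = (EFin \o L) \_ (C i j)).
    rewrite -integral_mkcond null_set_integral//.
    by apply: measurable_funTS; exact/measurable_EFinP.
  by apply/funext => w; rewrite patchE indicE /=; case: ifP => _; rewrite ?mulr1 ?mulr0.
have p0 : 0 < p by rewrite lt_def pn0 Pr_ge0.
have a0 : 0 < a by exact: lt_le_trans pa.
have b0 : 0 < b by exact: lt_le_trans pb.
set c := p / (a * b); have c0 : 0 < c by rewrite divr_gt0// mulr_gt0.
have mE : measurable_fun setT (fun w => expR (- L w) * \1_(C i j) w).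
  apply: measurable_funM; last exact: measurable_indic.
  by apply: measurableT_comp => //; exact: measurableT_comp.
have HE : (\int[P]_w (expR (- L w) * \1_(C i j) w)%:E <= (a * b)%:E)%E.
  rewrite EFinM !PrE//; apply: le_trans (H _ _ (mA i) (mB j)).
  rewrite [leRHS]integral_mkcond le_eqVlt; apply/orP; left; apply/eqP.
  apply: eq_integral => w _; rewrite patchE indicE.
  by case: ifP => _; rewrite ?mulr1 ?mulr0.
have iE : P.-integrable setT (EFin \o (fun w => expR (- L w) * \1_(C i j) w)).
  apply/integrableP; split; first exact/measurable_EFinP.
  apply: le_lt_trans (ltry (a * b)); apply: le_trans HE.
  rewrite le_eqVlt; apply/orP; left; apply/eqP; apply: eq_integral => w _.
  by rewrite gee0_abs// lee_fin mulr_ge0 ?expR_ge0.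
have i1 : P.-integrable setT (EFin \o (\1_(C i j) : T -> R)).
  apply: (@bounded_integrable _ _ _ P _ 1); first exact: measurable_indic.
  by move=> w; rewrite indicE; case: (_ \in _); rewrite ?normr1 ?normr0.
have I1 : \int[P]_w \1_(C i j) w = p by rewrite /Rintegral integral_indic// setIT.
have IE : \int[P]_w (expR (- L w) * \1_(C i j) w) <= a * b.
  by rewrite -lee_fin /Rintegral fineK//; exact: integrable_fin_num.
have : \int[P]_w ((1 + ln c) * \1_(C i j) w) <=
       \int[P]_w (c * (expR (- L w) * \1_(C i j) w) + L w * \1_(C i j) w).
  apply: le_Rintegral => //.
  - exact: integrableRZ.
  - by apply: integrableRD => //; exact: integrableRZ.
  - move=> w _; rewrite indicE; case: (_ \in _); rewrite ?mulr1 ?mulr0 ?addr0//.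
    have := expR_ge1Dx (ln c - L w); rewrite expRD lnK//; lra.
rewrite RintegralZl// RintegralD//; last exact: integrableRZ.
rewrite RintegralZl// I1.
have : c * \int[P]_w (expR (- L w) * \1_(C i j) w) <= c * (a * b) by rewrite ler_pM2l.
have -> : c * (a * b) = p by rewrite /c divfK// gt_eqF// mulr_gt0.
rewrite mulrDl mul1r (mulrC (ln c)); lra.
Qed.

End mutual_information.

(** * Data processing through a kernel *)

Section data_processing.
Context (R : realType) d (T : measurableType d) (P : probability T R).
Context ds dv dh (Ts : measurableType ds) (Tv : measurableType dv) (Th : measurableType dh).
Variables (S : T -> Ts) (V : T -> Tv) (H : T -> Th).
Hypotheses (mS : measurable_fun setT S) (mV : measurable_fun setT V) (mH : measurable_fun setT H).
Variables (k : R.-pker Ts ~> Tv) (G : set (set T)).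

Lemma expR_jensen n (x F : 'I_n -> R) : (forall i, 0 <= x i) -> \sum_(i < n) x i = 1 ->
  expR (\sum_(i < n) x i * F i) <= \sum_(i < n) x i * expR (F i).
Proof.
move=> x0 x1; set s := \sum_(i < n) x i * F i.
apply: le_trans (_ : \sum_(i < n) x i * (expR s * (1 + (F i - s))) <= _).
  have -> : \sum_(i < n) x i * (expR s * (1 + (F i - s))) =
      expR s * ((1 - s) * \sum_(i < n) x i + \sum_(i < n) x i * F i).
    rewrite mulr_sumr -big_split mulr_sumr/=; apply: eq_bigr => i _; ring.
  by rewrite x1 -/s mulr1 subrK mulr1.
apply: ler_sum => i _; rewrite ler_wpM2l//.
rewrite -[in leRHS](subrK s (F i)) expRD mulrC ler_wpM2r ?expR_ge0//.
exact: expR_ge1Dx.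
Qed.

(** Since [V] is drawn from a kernel, a partition for [V] is no partition for [S]: it becomes the
    probability weights x_i(S) = k(S, A_i). The variational inequality accepts such soft weights as
    test data, so it replaces a cell-by-cell comparison. *)
Lemma data_processing (B : R) : samples_from P S k V G -> ev H `<=` <<s G >> ->
  (mutual_info P S H <= B%:E)%E -> (mutual_info P V H <= B%:E)%E.
Proof.
move=> smp HG MI; apply: ub_ereal_sup => _ [n [m [A [C [[mA [dA cA]] [mC [dC cC]] ->]]]]].
rewrite lee_fin.
have mVA i : measurable (V @^-1` A i) by rewrite -[Y in measurable Y]setTI; exact: mV.
have mHC i : measurable (H @^-1` C i) by rewrite -[Y in measurable Y]setTI; exact: mH.
pose x i s : R := fine (k s (A i)).
pose y j h : R := \1_(C j) h.
have kf s X : measurable X -> k s X \is a fin_num 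
  by move=> mX; rewrite ge0_fin_numE//; apply: le_lt_trans (ltry 1);
     rewrite -(@prob_kernel _ _ _ _ _ k s) le_measure ?inE.
have x0 i s : 0 <= x i s by rewrite /x fine_ge0.
have x1 s : \sum_(i < n) x i s = 1.
  apply: EFin_inj; rewrite -sumEFin.
  rewrite (eq_bigr (fun i => k s (A i))); last by move=> i _; rewrite /x fineK// kf.
  rewrite -(@measure_bigsetU_ord _ _ _ (k s) n predT A)//; last first.
    by apply/trivIsetP => i j _ _ ij; exact: dA.
  rewrite (_ : \big[setU/set0]_(i < n) A i = setT); first exact: prob_kernel.
  apply/seteqP; split => // v _; have [i Ai] := cA v.
  by rewrite -bigcup_seq; exists i => //=; rewrite mem_index_enum.
have y0 j h : 0 <= y j h by rewrite /y.
have y1 h : \sum_(j < m) y j h = 1.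
  have [j0 Cj0] := cC h; rewrite (bigD1 j0)//= /y indicE mem_set// big1 ?addr0// => j jj0.
  rewrite indicE memNset// => Cj.
  by have : (C j `&` C j0) h by []; rewrite dC.
have mx i : measurable_fun setT (x i).
  by apply: measurableT_comp => //; exact: measurable_kernel.
have my j : measurable_fun setT (y j) by exact: measurable_indic.
have x_le1 i s : x i s <= 1.
  by rewrite -(x1 s) (bigD1 i)//= lerDl sumr_ge0.
pose p i j := Pr P (V @^-1` A i `&` H @^-1` C j).
pose a i := Pr P (V @^-1` A i); pose b j := Pr P (H @^-1` C j).
have ixy i j : P.-integrable setT (EFin \o (fun w => x i (S w) * y j (H w))).
  apply: (@bounded_integrable _ _ _ P _ 1).
    by apply: measurable_funM; exact: measurableT_comp.
  move=> w; rewrite ger0_norm ?mulr_ge0// mulr_ile1//.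
  by rewrite /y indicE; case: (_ \in _).
have pE i j : p i j = \int[P]_w (x i (S w) * y j (H w)).
  rewrite /p /Pr smp//; last by apply: HG; exists (C j).
  rewrite /Rintegral [in LHS]integral_mkcond; congr fine; apply: eq_integral => w _.
  rewrite patchE /y indicE.
  case: ifPn => [/set_mem /= h|/negP h].
    by rewrite mem_set// mulr1 /x fineK// kf.
  by rewrite memNset ?mulr0// => h'; apply: h; exact/mem_set.
have ix i : P.-integrable setT (EFin \o (fun w => x i (S w))).
  apply: (@bounded_integrable _ _ _ P _ 1); first exact: measurableT_comp.
  by move=> w; rewrite ger0_norm.
have iy j : P.-integrable setT (EFin \o (fun w => y j (H w))).
  apply: (@bounded_integrable _ _ _ P _ 1); first exact: measurableT_comp.
  by move=> w; rewrite ger0_norm// /y indicE; case: (_ \in _).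
have aE i : a i = \int[P]_w x i (S w).
  rewrite /a /Pr -[V @^-1` A i]setIT smp//; last by apply: HG; exists setT.
  by rewrite /Rintegral; congr fine; apply: eq_integral => w _; rewrite /x fineK// kf.
have bE j : b j = \int[P]_w y j (H w).
  rewrite /b /Pr /Rintegral; congr fine; rewrite -[LHS]/(P (H @^-1` C j)).
  rewrite (_ : (fun w => (y j (H w))%:E) = (fun w => (\1_(H @^-1` C j) w)%:E)); last by [].
  by rewrite integral_indic// setIT.
have p1 : \sum_(i < n) \sum_(j < m) p i j = 1.
  transitivity (\int[P]_w \sum_(i < n) \sum_(j < m) x i (S w) * y j (H w)).
    rewrite Rintegral_sum; last by move=> i; exact: integrableR_sum.
    apply: eq_bigr => i _; rewrite Rintegral_sum//; apply: eq_bigr => j _; exact: pE.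
  transitivity (\int[P]_w (1 : R)).
    apply: eq_Rintegral => w _.
    rewrite (eq_bigr (fun i => x i (S w))) ?x1// => i _.
    by rewrite -mulr_sumr y1 mulr1.
  by rewrite Rintegral_cst//= probability_setT mul1r.
(* Donsker-Varadhan for [S], tested on the kernel average of the optimal test function for [V];
   Jensen's inequality controls the exponential moment. *)
suff key (N : nat) : \sum_(i < n) \sum_(j < m) xlog (p i j) (a i) (b j) <=
    B + (n * m)%:R * expR (- N%:R).
  have C0 : B + (n * m)%:R * expR (- N%:R) @[N --> \oo] --> B.
    rewrite -[X in _ --> X]addr0; apply: cvgD; first exact: cvg_cst.
    rewrite -[X in _ --> X](mulr0 (n * m)%:R); apply: cvgM; first exact: cvg_cst.
    exact: cvgn_expR.
  by apply: (ler_cvg_to (@cvg_cst _ _ _ \oo _) C0); exact: nearW.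
(* The optimal test value is minus infinity on null cells; -N stands in for it and costs at most
   exp(-N) per cell. *)
pose F i j : R := if p i j == 0 then - N%:R else ln (p i j / (a i * b j)).
pose Phi (X : 'I_n -> R) (Y : 'I_m -> R) := \sum_(i < n) \sum_(j < m) X i * Y j * F i j.
(* [donsker_varadhan] wants a bound for arbitrary arguments; on actual weights in [0,1] the function
   stays below [M], so the clamp is invisible. *)
pose M := \sum_(i < n) \sum_(j < m) `|F i j|.
pose cl (z : R) := clamp M z.
have M0 : 0 <= M by apply: sumr_ge0 => i _; apply: sumr_ge0.
have clE z : `|z| <= M -> cl z = z by exact: clamp_id.
have PhiM s h : `|Phi (x ^~ s) (y ^~ h)| <= M.
  rewrite /Phi; apply: le_trans (ler_norm_sum _ _ _) _; apply: ler_sum => i _.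
  apply: le_trans (ler_norm_sum _ _ _) _; apply: ler_sum => j _.
  rewrite normrM ler_piMl// ger0_norm ?mulr_ge0// mulr_ile1//.
  by rewrite /y indicE; case: (_ \in _).
have := @donsker_varadhan R _ _ P _ _ _ _ S H mS mH n m x y (fun X Y => cl (Phi X Y)) M B mx my.
have -> : \int[P]_w cl (Phi (x ^~ (S w)) (y ^~ (H w))) =
    \sum_(i < n) \sum_(j < m) xlog (p i j) (a i) (b j).
  transitivity (\int[P]_w \sum_(i < n) \sum_(j < m) F i j * (x i (S w) * y j (H w))).
    apply: eq_Rintegral => w _; rewrite clE//.
    by apply: eq_bigr => i _; apply: eq_bigr => j _; rewrite mulrC.
  rewrite Rintegral_sum; last by move=> i; apply: integrableR_sum => j; exact: integrableRZ.
  apply: eq_bigr => i _; rewrite Rintegral_sum; last by move=> j; exact: integrableRZ.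
  apply: eq_bigr => j _; rewrite RintegralZl// -pE /F /xlog.
  by case: eqP => [->|_]; rewrite ?mulr0// mulrC.
move=> DV; rewrite -(lerD2r 1).
apply: le_trans (DV _ _ MI) _.
- by move=> X Y; exact: clamp_norm_le.
- move=> x_ y_ X Y cx cy; apply: cvg_clamp.
  rewrite /Phi; apply: cvg_bigsum => i; apply: cvg_bigsum => j.
  by apply: cvgM; [apply: cvgM; [exact: cx|exact: cy]|exact: cvg_cst].
rewrite -addrA lerD2l.
pose PP := product_probability P P.
have mPhi : measurable_fun setT (fun z : T * T => Phi (x ^~ (S z.1)) (y ^~ (H z.2))).
  apply: measurable_fun_bigsum => i; apply: measurable_fun_bigsum => j.
  apply: measurable_funM => //; apply: measurable_funM.
    exact: (measurableT_comp (measurableT_comp (mx i) mS) measurable_fst).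
  exact: (measurableT_comp (measurableT_comp (my j) mH) measurable_snd).
have mxy i j : measurable_fun setT (fun z : T * T => x i (S z.1) * y j (H z.2)).
  apply: measurable_funM.
    exact: (measurableT_comp (measurableT_comp (mx i) mS) measurable_fst).
  exact: (measurableT_comp (measurableT_comp (my j) mH) measurable_snd).
have xyb i j (w1 w2 : T) : `|x i (S w1) * y j (H w2)| <= 1.
  rewrite ger0_norm ?mulr_ge0// mulr_ile1//.
  by rewrite /y indicE; case: (_ \in _).
have iPxy i j : PP.-integrable setT (EFin \o (fun z : T * T => x i (S z.1) * y j (H z.2))).
  by apply: (@bounded_integrable _ _ _ PP _ 1) => // -[w1 w2]; exact: xyb.
apply: le_trans (_ : \int[PP]_z \sum_(i < n) \sum_(j < m) expR (F i j) * (x i (S z.1) * y j (H z.2)) <= _).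
  apply: le_Rintegral => //.
  - apply: (@bounded_integrable _ _ _ PP _ (expR M)).
      rewrite (_ : (fun z => _) = fun z : T * T => expR (Phi (x ^~ (S z.1)) (y ^~ (H z.2)))).
        by apply: measurableT_comp.
      by apply/funext => z; rewrite clE.
    move=> z; rewrite clE// ger0_norm ?expR_ge0// ler_expR.
    exact: le_trans (ler_norm _) (PhiM _ _).
  - apply: integrableR_sum => i; apply: integrableR_sum => j; exact: integrableRZ.
  - move=> z _; rewrite clE// exchange_big/=.
    have [j0 Cj0] := cC (H z.2).
    (* The weights of [H] are those of a single cell, so Jensen is needed only for the convex
       combination over i. *)
    have yE j : y j (H z.2) = (j == j0)%:R.
      rewrite /y indicE; case: eqP => [->|/eqP jj0]; first by rewrite mem_set.
      rewrite memNset// => Cj.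
      by have : (C j `&` C j0) (H z.2) by []; rewrite dC.
    have -> : Phi (x ^~ (S z.1)) (y ^~ (H z.2)) = \sum_(i < n) x i (S z.1) * F i j0.
      apply: eq_bigr => i _; rewrite (bigD1 j0)//= yE eqxx mulr1 big1 ?addr0// => j /negbTE jj0.
      by rewrite yE jj0 mulr0 mul0r.
    rewrite (bigD1 j0)//= [X in _ + X]big1 ?addr0; last first.
      by move=> j /negbTE jj0; rewrite big1// => i _; rewrite yE jj0 !mulr0.
    apply: le_trans (expR_jensen _ _ _) _ => //.
    rewrite le_eqVlt; apply/orP; left; apply/eqP; apply: eq_bigr => i _.
    by rewrite yE eqxx mulr1 mulrC.
rewrite Rintegral_sum; last by move=> i; apply: integrableR_sum => j; exact: integrableRZ.
rewrite natrM addrC -{1}p1.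
have -> : n%:R * m%:R * expR (- N%:R) = \sum_(i < n) \sum_(j < m) expR (- N%:R) :> R.
  by rewrite !sumr_const !card_ord -mulrnA -[RHS]mulr_natl mulnC natrM.
rewrite -big_split/=; apply: ler_sum => i _; rewrite -big_split/=.
rewrite Rintegral_sum; last by move=> j; exact: integrableRZ.
apply: ler_sum => j _; rewrite RintegralZl//.
rewrite (@Rintegral_product _ _ _ _ _ P P (fun w1 w2 => x i (S w1) * y j (H w2)) 1)//.
have -> : \int[P]_w1 \int[P]_w2 (x i (S w1) * y j (H w2)) = a i * b j.
  rewrite aE bE -RintegralZr//; apply: eq_Rintegral => w1 _.
  by rewrite RintegralZl.
have pa : p i j <= a i by apply: le_Pr => //; exact: measurableI.
have pb : p i j <= b j by apply: le_Pr => //; exact: measurableI.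
have a1 : a i <= 1 by rewrite -lee_fin PrE// probability_le1.
have b1 : b j <= 1 by rewrite -lee_fin PrE// probability_le1.
rewrite /F; case: eqP => [->|/eqP pn0].
  rewrite add0r ler_piMr ?expR_ge0//.
  by rewrite mulr_ile1// Pr_ge0.
have p0 : 0 < p i j by rewrite lt_def pn0 Pr_ge0.
have a0 : 0 < a i by exact: lt_le_trans pa.
have b0 : 0 < b j by exact: lt_le_trans pb.
rewrite lnK ?posrE ?divr_gt0 ?mulr_gt0// divfK ?gt_eqF ?mulr_gt0//.
by rewrite lerDl expR_ge0.
Qed.

End data_processing.

(** * Gaussian systems *)

Section dotp.
Context (R : realType) (N : nat).
Implicit Types u v : 'rV[R]_N.

Definition dotp u v : R := (u *m v^T) ord0 ord0.

Lemma dotpE u v : dotp u v = \sum_i u ord0 i * v ord0 i.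
Proof. by rewrite /dotp mxE; apply: eq_bigr => i _; rewrite mxE. Qed.

Lemma dotpC u v : dotp u v = dotp v u.
Proof. by rewrite !dotpE; apply: eq_bigr => i _; rewrite mulrC. Qed.

Lemma dotpDl u v w : dotp (u + v) w = dotp u w + dotp v w.
Proof. by rewrite /dotp mulmxDl mxE. Qed.

Lemma dotpDr u v w : dotp w (u + v) = dotp w u + dotp w v.
Proof. by rewrite dotpC dotpDl !(dotpC w). Qed.

Lemma dotpZl a u v : dotp (a *: u) v = a * dotp u v.
Proof. by rewrite /dotp -scalemxAl mxE. Qed.

Lemma dotpZr a u v : dotp u (a *: v) = a * dotp u v.
Proof. by rewrite dotpC dotpZl dotpC. Qed.

Lemma dotp_suml (I : Type) (r : seq I) (f : I -> 'rV[R]_N) v :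
  dotp (\sum_(i <- r) f i) v = \sum_(i <- r) dotp (f i) v.
Proof.
elim: r => [|i r ih]; first by rewrite !big_nil /dotp mul0mx mxE.
by rewrite !big_cons dotpDl ih.
Qed.

Lemma dotp_sumr (I : Type) (r : seq I) (f : I -> 'rV[R]_N) v :
  dotp v (\sum_(i <- r) f i) = \sum_(i <- r) dotp v (f i).
Proof. by rewrite dotpC dotp_suml; apply: eq_bigr => i _; rewrite dotpC. Qed.

Lemma dotp_ge0 u : 0 <= dotp u u.
Proof. by rewrite dotpE; apply: sumr_ge0 => i _; rewrite -expr2 sqr_ge0. Qed.

Lemma dotp_row n k (M : 'M[R]_(n, N)) (K : 'M[R]_(k, N)) i j :
  dotp (row i M) (row j K) = (M *m K^T) i j.
Proof. by rewrite dotpE mxE; apply: eq_bigr => l _; rewrite !mxE. Qed.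

End dotp.

Section gaussian_system.
Context (R : realType) d (T : measurableType d) (P : probability T R) (N : nat).

(* [GR X u]: the random variable [X] is centred Gaussian with coefficient vector [u]
   in some orthonormal Gaussian frame, so that covariances are dot products. *)
Record gaussian_system (GR : (T -> R) -> 'rV[R]_N -> Prop) : Prop := GaussianSystem {
  gs0 : GR (fun=> 0) 0;
  gs_lin : forall a X u b Y v, GR X u -> GR Y v ->
    GR (fun w => a * X w + b * Y w) (a *: u + b *: v);
  gs_measurable : forall X u, GR X u -> measurable_fun setT X;
  gs_gauss : forall X u, GR X u -> has_gauss1 P X 0 (dotp u u) }.

Variable GR : (T -> R) -> 'rV[R]_N -> Prop.
Hypothesis gs : gaussian_system GR.

Definition gvec n (X : T -> vec R n) (M : 'M[R]_(n, N)) :=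
  forall i, GR (fun w => X w i ord0) (row i M).

Lemma gs_sum (I : Type) (r : seq I) (a : I -> R) (X : I -> T -> R) (u : I -> 'rV[R]_N) :
  (forall i, GR (X i) (u i)) ->
  GR (fun w => \sum_(i <- r) a i * X i w) (\sum_(i <- r) a i *: u i).
Proof.
move=> GX; elim: r => [|i r ih].
  rewrite big_nil (_ : (fun w => _) = fun=> 0); first exact: gs0 gs.
  by apply/funext => w; rewrite big_nil.
rewrite big_cons (_ : (fun w => _) = fun w => a i * X i w + 1 * (\sum_(i <- r) a i * X i w)).
  by rewrite -[X in _ + X]scale1r; exact: gs_lin.
by apply/funext => w; rewrite big_cons mul1r.
Qed.

Lemma gvec_lin n (X : T -> vec R n) M (a : 'I_n -> R) : gvec X M ->
  GR (fun w => \sum_(i < n) a i * X w i ord0) (\row_i a i *m M).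
Proof.
move=> XM; have := gs_sum (index_enum _) a XM.
rewrite (_ : \sum_(i < n) a i *: row i M = \row_i a i *m M)//.
by rewrite [RHS]mulmx_sum_row; apply: eq_bigr => i _; rewrite mxE.
Qed.

Lemma gvec_mul n k (X : T -> vec R n) M (A : 'M[R]_(k, n)) : gvec X M ->
  gvec (fun w => A *m X w) (A *m M).
Proof.
move=> XM i; have := gvec_lin (fun j => A i j) XM.
rewrite (_ : \row_j A i j = row i A); last by apply/rowP => j; rewrite !mxE.
rewrite row_mul; congr GR.
by apply/funext => w; rewrite mxE.
Qed.

Lemma gvec_add n (X Y : T -> vec R n) M K : gvec X M -> gvec Y K ->
  gvec (fun w => X w + Y w) (M + K).
Proof.
move=> XM YK i; have := gs_lin gs 1 1 (XM i) (YK i).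
rewrite !scale1r -raddfD; congr GR.
by apply/funext => w; rewrite !mul1r mxE.
Qed.

Lemma gvec_sub n (X Y : T -> vec R n) M K : gvec X M -> gvec Y K ->
  gvec (fun w => X w - Y w) (M - K).
Proof.
move=> XM YK i; have := gs_lin gs 1 (-1) (XM i) (YK i).
rewrite scale1r scaleN1r -raddfB; congr GR.
by apply/funext => w; rewrite mul1r mulN1r !mxE.
Qed.

Lemma gvec_measurable n (X : T -> vec R n) M : gvec X M -> measurable_fun setT X.
Proof. by move=> XM; apply: measurable_fun_vec => i; exact: gs_measurable (XM i). Qed.

Lemma gs_char X u b : GR X u -> \int[P]_w cos (X w + b) = cos b * expR (- (dotp u u / 2)).
Proof.
move=> GX; have := gauss1_char (gs_measurable gs GX) 1 b (dotp_ge0 u) (gs_gauss gs GX).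
rewrite mulr0 add0r expr1n mul1r => <-.
by apply: eq_Rintegral => w _; rewrite mul1r.
Qed.

Lemma gs_mean X u : GR X u -> P.-integrable setT (EFin \o X) /\ \int[P]_w X w = 0.
Proof.
move=> GX.
by have [] := gauss1_moments (gs_measurable gs GX) (dotp_ge0 u) (gs_gauss gs GX).
Qed.

(** Polarisation: the system gives laws of single linear combinations, so a mixed moment is read off
    the variance of X + Y. *)
Lemma gs_cov X u Y v : GR X u -> GR Y v ->
  P.-integrable setT (EFin \o (fun w => X w * Y w)) /\ \int[P]_w (X w * Y w) = dotp u v.
Proof.
move=> GX GY.
have sq Z z : GR Z z -> P.-integrable setT (EFin \o (fun w => Z w ^+ 2)) /\
    \int[P]_w (Z w ^+ 2) = dotp z z.
  move=> GZ.
  by have [] := gauss1_moments (gs_measurable gs GZ) (dotp_ge0 z) (gs_gauss gs GZ).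
have [iX eX] := sq _ _ GX; have [iY eY] := sq _ _ GY.
have [iS eS] := sq _ _ (gs_lin gs 1 1 GX GY).
have E w : X w * Y w = 2^-1 * ((1 * X w + 1 * Y w) ^+ 2 - X w ^+ 2 - Y w ^+ 2) by field.
rewrite (_ : (fun w => X w * Y w) =
  fun w => 2^-1 * ((1 * X w + 1 * Y w) ^+ 2 - X w ^+ 2 - Y w ^+ 2)); last exact/funext.
have i1 : P.-integrable setT (EFin \o (fun w => (1 * X w + 1 * Y w) ^+ 2 - X w ^+ 2)).
  exact: integrableRB.
have i2 : P.-integrable setT (EFin \o (fun w => (1 * X w + 1 * Y w) ^+ 2 - X w ^+ 2 - Y w ^+ 2)).
  exact: integrableRB.
split; first exact: integrableRZ.
rewrite RintegralZl// RintegralB// RintegralB// eX eY eS !scale1r dotpDl !dotpDr (dotpC v u).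
by field.
Qed.

(** Orthogonality makes the squared lengths of the coefficient vectors add up, so the characteristic
    function of the pair factors. *)
Lemma gs_indep n k (X : T -> vec R n) M (Y : T -> vec R k) K :
  gvec X M -> gvec Y K -> M *m K^T = 0 -> indep2 P X Y.
Proof.
move=> XM YK MK; have mX := gvec_measurable XM; have mY := gvec_measurable YK.
apply: char_indep2 => // a b c.
have GX := gvec_lin a XM; have GY := gvec_lin b YK.
set p := _ *m M in GX; set q := _ *m K in GY.
have pq : dotp p q = 0.
  by rewrite /dotp /p /q trmx_mul mulmxA -(mulmxA _ M) MK mulmx0 mul0mx mxE.
have := gs_char c (gs_lin gs 1 1 GX GY).
rewrite !scale1r dotpDl !dotpDr (dotpC q p) pq addr0 add0r.
have -> : \int[P]_w cos (1 * (\sum_(i < n) a i * X w i ord0) +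
    1 * (\sum_(j < k) b j * Y w j ord0) + c) =
  \int[P]_w cos (\sum_(i < n) a i * X w i ord0 + \sum_(j < k) b j * Y w j ord0 + c).
  by apply: eq_Rintegral => w _; rewrite !mul1r.
move=> ->.
transitivity (\int[P]_w1 (cos (\sum_(i < n) a i * X w1 i ord0 + c) * expR (- (dotp q q / 2)))).
  rewrite RintegralZr//; last first.
    apply: (@bounded_integrable _ _ _ P _ 1); last by move=> w; exact: norm_cos_le1.
    apply: (measurableT_comp measurable_cosT); apply: measurable_funD => //.
    exact: gs_measurable gs _ _ GX.
  by rewrite (gs_char c GX) -mulrA -expRD; congr (_ * expR _); field.
apply: eq_Rintegral => w _; rewrite -(gs_char _ GY); apply: eq_Rintegral => w' _.
by rewrite addrA (addrC (\sum_(j < k) _)).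
Qed.

Lemma gs_mindep n (X : 'I_n -> T -> R) (u : 'I_n -> 'rV[R]_N) :
  (forall i, GR (X i) (u i)) -> (forall i j, i != j -> dotp (u i) (u j) = 0) ->
  mindep P X.
Proof.
move=> GX o.
apply: (@char_mindep R _ T P n X (fun i => dotp (u i) (u i))
  (fun i => gs_measurable gs (GX i)) (fun i => dotp_ge0 _) _).1.
move=> a b; rewrite (gs_char b (gs_sum (index_enum _) a GX)).
have -> : dotp (\sum_(i < n) a i *: u i) (\sum_(i < n) a i *: u i) =
    \sum_(i < n) a i ^+ 2 * dotp (u i) (u i).
  rewrite dotp_suml; apply: eq_bigr => i _; rewrite dotp_sumr (bigD1 i)//= big1 ?addr0.
    by rewrite dotpZl dotpZr mulrA expr2.
  by move=> j ji; rewrite dotpZl dotpZr o ?mulr0// eq_sym.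
by [].
Qed.

End gaussian_system.

(** * Gaussian rate-distortion *)

Section density_law.
Context (R : realType) d d' (T : measurableType d) (T' : measurableType d').
Variables (P : {measure set T -> \bar R}) (f : T -> T') (p : T -> R).
Hypotheses (mf : measurable_fun setT f) (mp : measurable_fun setT p) (p0 : forall w, 0 <= p w).

(** The image under [f] of the measure with density [p]. The proofs are explicit arguments so that
    the measure structure can be attached to the term. *)
Definition density_law (mf : measurable_fun setT f) (mp : measurable_fun setT p)
  (p0 : forall w, 0 <= p w) (E : set T') : \bar R := (\int[P]_(w in f @^-1` E) (p w)%:E)%E.

Let dl0 : density_law mf mp p0 set0 = 0%E.
Proof. by rewrite /density_law preimage_set0 integral_set0. Qed.

Let dl_ge0 E : (0 <= density_law mf mp p0 E)%E.
Proof. by apply: integral_ge0 => w _; rewrite lee_fin. Qed.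

Let dl_sigma : semi_sigma_additive (density_law mf mp p0).
Proof.
move=> F mF tF mUF.
have mF' n : measurable (f @^-1` F n) by rewrite -[X in measurable X]setTI; exact: mf.
rewrite /density_law preimage_bigcup ge0_integral_bigcup//=.
- apply: is_cvg_ereal_nneg_natsum_cond => n _ _.
  by apply: integral_ge0 => /= x ?; rewrite lee_fin.
- by apply/measurable_funTS; exact/measurable_EFinP.
- by move=> x _; rewrite lee_fin.
- apply/trivIsetP => /= i j _ _ ij; rewrite -preimage_setI.
  by move/trivIsetP : tF => /(_ _ _ _ _ ij) ->//; rewrite preimage_set0.
Qed.

HB.instance Definition _ := isMeasure.Build _ _ _ (density_law mf mp p0) dl0 dl_ge0 dl_sigma.

End density_law.

Lemma indep2_mul_mean0 (R : realType) d (T : measurableType d) (P : probability T R) (X Y : T -> R) :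
  measurable_fun setT X -> measurable_fun setT Y -> indep2 P X Y ->
  P.-integrable setT (EFin \o X) -> P.-integrable setT (EFin \o Y) ->
  P.-integrable setT (EFin \o (fun w => X w * Y w)) ->
  \int[P]_w X w = 0 -> \int[P]_w (X w * Y w) = 0.
Proof.
move=> mX mY iXY iX iY iM X0.
have mXY : measurable_fun setT (fun w => (X w, Y w)) by exact: measurable_fun_pair.
have mm : measurable_fun setT (fun z : R * R => z.1 * z.2) by exact: measurable_funM.
pose LX := law P mX; pose LY := law P mY.
have LE A : measurable A -> law P mXY A = (LX \x LY)%E A.
  move=> mA; apply/esym.
  apply: (@product_measure_unique _ _ _ _ _ LX LY (law P mXY)) => //.
have iL d' (T' : measurableType d') (Z : T -> T') (mZ : measurable_fun setT Z) (g : T' -> R) :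
    measurable_fun setT g -> P.-integrable setT (EFin \o (fun w => g (Z w))) ->
    (law P mZ).-integrable setT (EFin \o g).
  move=> mg /integrableP[_ ig]; apply/integrableP; split; first exact/measurable_EFinP.
  by rewrite (@ge0_integral_law _ _ _ _ _ P _ mZ (fun x => `|(g x)%:E|%E))//;
    apply: measurableT_comp => //; exact/measurable_EFinP.
have iLX : LX.-integrable setT (EFin \o id) by exact: iL.
have iLY : LY.-integrable setT (EFin \o id) by exact: iL.
have ip : (LX \x LY)%E.-integrable setT (fun z => (z.1 * z.2)%:E).
  have /integrableP[_ h] := iL _ _ _ mXY (fun z => z.1 * z.2) mm iM.
  apply/integrableP; split; first exact/measurable_EFinP.
  by apply: le_lt_trans h; rewrite le_eqVlt; apply/orP; left; apply/eqP;
    apply: eq_measure_integral => A mA _; rewrite [RHS]LE.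
rewrite -[LHS](Rintegral_law P mXY mm).
transitivity (\int[(LX \x LY)%E]_z (z.1 * z.2)).
  by rewrite /Rintegral; congr fine; apply: eq_measure_integral => A mA _; exact: LE.
rewrite /Rintegral -(integral12_prod_meas1 ip).
transitivity (fine (\int[LX]_x ((\int[LY]_y y)%:E * x%:E))%E).
  congr fine; apply: eq_integral => x _.
  rewrite /fubini_F/=; under eq_integral do rewrite EFinM.
  rewrite integralZl// muleC; congr (_ * _)%E.
  by rewrite /Rintegral fineK//; exact: integrable_fin_num iLY.
rewrite integralZl// fineM//; last exact: integrable_fin_num iLX.
have -> : fine (\int[LX]_x x%:E) = \int[P]_w X w by rewrite -(Rintegral_law P mX (@measurable_id _ _ _)).
by rewrite X0 mulr0.
Qed.

Section gauss_ratio.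
Context (R : realType).

(* [gratio v w x y] is the ratio at [x] of the densities of N(y,w) and N(0,v). *)
Definition gratio (v w x y : R) : R :=
  expR (2^-1 * ln (v / w) - (x - y) ^+ 2 / (2 * w) + x ^+ 2 / (2 * v)).

Lemma gratio_pdf v w x y : 0 < v -> 0 < w ->
  gratio v w x y * normal_pdf 0 (Num.sqrt v) x = normal_pdf y (Num.sqrt w) x.
Proof.
move=> v0 w0.
have sv : Num.sqrt v != 0 by rewrite gt_eqF// sqrtr_gt0.
have sw : Num.sqrt w != 0 by rewrite gt_eqF// sqrtr_gt0.
rewrite !normal_pdfE//= /normal_fun /normal_peak !sqr_sqrtr ?ltW// /gratio subr0.
have E : expR (2^-1 * ln (v / w)) = Num.sqrt v / Num.sqrt w.
  have vw : 0 < v / w by rewrite divr_gt0.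
  apply/eqP; rewrite -(@eqrXn2 _ 2)// ?expR_ge0 ?divr_ge0 ?sqrtr_ge0//.
  rewrite -expRM_natl mulrA mulfV// mul1r lnK ?posrE// expr_div_n !sqr_sqrtr// ltW//.
have -> : 2^-1 * ln (v / w) - (x - y) ^+ 2 / (2 * w) + x ^+ 2 / (2 * v) =
   2^-1 * ln (v / w) + (- (x - y) ^+ 2 / (w *+ 2) + x ^+ 2 / (v *+ 2)).
  by rewrite -addrA -(mulr_natl w) -(mulr_natl v) mulNr.
rewrite expRD E expRD.
have e23 : expR (x ^+ 2 / (v *+ 2)) * expR (- x ^+ 2 / (v *+ 2)) = 1.
  by rewrite -expRD mulNr subrr expR0.
have p0 : Num.sqrt (pi *+ 2) != 0 :> R by rewrite gt_eqF// sqrtr_gt0 pmulrn_lgt0// pi_gt0.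
rewrite -!mulrnAr !sqrtrM ?ltW//.
transitivity ((Num.sqrt w * Num.sqrt (pi *+ 2))^-1 * expR (- (x - y) ^+ 2 / (w *+ 2)) *
  (expR (x ^+ 2 / (v *+ 2)) * expR (- x ^+ 2 / (v *+ 2)))); last by rewrite e23 mulr1.
move: (expR _) (expR _) (expR _) sv sw p0 => e1 e2 e3.
by move: (Num.sqrt _) (Num.sqrt _) (Num.sqrt _) => a b c a0 b0 c0; field; rewrite a0 b0 c0.
Qed.

Lemma measurable_gratio v w y : measurable_fun setT (fun x => gratio v w x y).
Proof.
apply: measurableT_comp => //; apply: measurable_funD.
  apply: measurable_funB => //; apply: measurable_funM => //.
  by apply: measurable_funX; exact: measurable_funB.
by apply: measurable_funM => //; exact: measurable_funX.
Qed.

(** Change of measure: reweighting N(0, v) by the density ratio yields N(y, w). With [A] the whole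
    line it says that the ratio has mean 1. *)
Lemma gauss1_gratio d (T : measurableType d) (P : probability T R) (X : T -> R) v w y A :
  measurable_fun setT X -> 0 < v -> 0 < w -> has_gauss1 P X 0 v -> measurable A ->
  (\int[P]_t (\1_A (X t) * gratio v w (X t) y)%:E = normal_prob y (Num.sqrt w) A)%E.
Proof.
move=> mX v0 w0; rewrite /has_gauss1 /gauss1 gt_eqF// => XG mA.
have mi : measurable_fun setT (\1_A : R -> R) by exact: measurable_indic.
have mg := measurable_gratio v w y.
rewrite (@eq_law_integral _ _ _ _ _ _ _ P (normal_prob 0 (Num.sqrt v)) X id
  (fun x => (\1_A x * gratio v w x y)%:E))//; last 2 first.
- by apply/measurable_EFinP; exact: measurable_funM.
- by move=> x; rewrite lee_fin mulr_ge0 ?expR_ge0.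
rewrite ge0_normal_integral; last 2 first.
- by apply/measurable_EFinP; exact: measurable_funM.
- by move=> x; rewrite lee_fin mulr_ge0 ?expR_ge0.
rewrite normal_probE// [RHS]integral_mkcond; apply: eq_integral => x _.
rewrite -EFinM -mulrA gratio_pdf// patchE indicE.
by case: ifP => _; rewrite ?mul1r ?mul0r.
Qed.

End gauss_ratio.

Section rate_distortion.
Context (R : realType) d (T : measurableType d) (P : probability T R) (N : nat).
Variable GR : (T -> R) -> 'rV[R]_N -> Prop.
Hypothesis gs : gaussian_system P GR.
Context dh (Th : measurableType dh) (H : T -> Th).
Hypothesis mH : measurable_fun setT H.
Variables (k : nat) (x : 'I_k -> Th -> R) (u : 'I_k -> 'rV[R]_N) (lam : 'I_k -> R).
Hypotheses (mx : forall i, measurable_fun setT (x i))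
  (Gx : forall i, GR (fun w => x i (H w)) (u i))
  (uu : forall i j, dotp (u i) (u j) = (i == j)%:R * lam i)
  (lam0 : forall i, 0 < lam i).

Let u_orth i j : i != j -> dotp (u i) (u j) = 0.
Proof. by move=> /negbTE ij; rewrite uu ij mul0r. Qed.

Let x_gauss i : has_gauss1 P (fun w => x i (H w)) 0 (lam i).
Proof. by have := gs_gauss gs (Gx i); rewrite uu eqxx mul1r. Qed.

Let mxH i : measurable_fun setT (fun w => x i (H w)).
Proof. exact: gs_measurable gs _ _ (Gx i). Qed.

(** With the Gaussian log-ratio [f] as test function, Donsker-Varadhan reads E f <= B. Here E f = B
    - s / (2D) + k / 2, where s is the distortion and k / 2 comes from E x_i^2 = lam_i; the two
    copies of [B] cancel and leave k D <= s. *)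
Lemma rate_distortion_lower dv (Tv : measurableType dv) (V : T -> Tv) (y : 'I_k -> Tv -> R) (D B : R) :
  measurable_fun setT V -> (forall i, measurable_fun setT (y i)) -> 0 < D ->
  \sum_(i < k) ln (lam i / D) = 2 * B ->
  (mutual_info P V H <= B%:E)%E ->
  (forall i, P.-integrable setT (EFin \o (fun w => (x i (H w) - y i (V w)) ^+ 2))) ->
  k%:R * D <= \sum_(i < k) \int[P]_w ((x i (H w) - y i (V w)) ^+ 2).
Proof.
move=> mV my D0 lnB MI ixy.
pose F (b a : 'I_k -> R) : R := \sum_(i < k)
  (2^-1 * ln (lam i / D) - (a i - b i) ^+ 2 / (2 * D) + a i ^+ 2 / (2 * lam i)).
(* [f] is the log-density ratio of N(y, D) to N(0, lam), so its exponential moment under the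
   product law is 1. *)
pose f w := F (y ^~ (V w)) (x ^~ (H w)).
have ix2 i : P.-integrable setT (EFin \o (fun w => x i (H w) ^+ 2)).
  exact: (gs_cov gs (Gx i) (Gx i)).1.
have icst c : P.-integrable setT (EFin \o (fun=> c : R)).
  exact: finite_measure_integrable_cst.
have if1 i : P.-integrable setT (EFin \o (fun w => 2^-1 * ln (lam i / D) -
    (2 * D)^-1 * (x i (H w) - y i (V w)) ^+ 2)).
  by apply: integrableRB => //; exact: integrableRZ.
have if2 i : P.-integrable setT (EFin \o (fun w => 2^-1 * ln (lam i / D) -
    (2 * D)^-1 * (x i (H w) - y i (V w)) ^+ 2 + (2 * lam i)^-1 * x i (H w) ^+ 2)).
  by apply: integrableRD => //; exact: integrableRZ.
have fE : f = fun w => \sum_(i < k) (2^-1 * ln (lam i / D) -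
    (2 * D)^-1 * (x i (H w) - y i (V w)) ^+ 2 + (2 * lam i)^-1 * x i (H w) ^+ 2).
  apply/funext => w; apply: eq_bigr => i _.
  by rewrite (mulrC _ (2 * D)^-1) (mulrC _ (2 * lam i)^-1).
have if_ : P.-integrable setT (EFin \o f) by rewrite fE; exact: integrableR_sum.
have Ef : \int[P]_w f w = B - (2 * D)^-1 * (\sum_(i < k) \int[P]_w ((x i (H w) - y i (V w)) ^+ 2)) + k%:R / 2.
  rewrite fE Rintegral_sum//.
  have -> : B = \sum_(i < k) 2^-1 * ln (lam i / D) by rewrite -mulr_sumr lnB mulKf.
  have -> : k%:R / 2 = \sum_(i < k) 2^-1 :> R by rewrite sumr_const card_ord -[RHS]mulr_natl.
  rewrite [X in _ - X]mulr_sumr -sumrB -[RHS]big_split/=; apply: eq_bigr => i _.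
  rewrite RintegralD//; last exact: integrableRZ.
  rewrite RintegralB//; last exact: integrableRZ.
  rewrite !RintegralZl// Rintegral_cst//= probability_setT mulr1.
  have -> : \int[P]_w (x i (H w) ^+ 2) = lam i.
    by have := (gs_cov gs (Gx i) (Gx i)).2; rewrite uu eqxx mul1r.
  by congr (_ + _); rewrite invfM -mulrA mulVf ?mulr1// gt_eqF.
pose PP := product_probability P P.
have mF : measurable_fun setT (fun z : T * T => F (y ^~ (V z.1)) (x ^~ (H z.2))).
  apply: measurable_fun_bigsum => i.
  have m1 : measurable_fun setT (fun z : T * T => x i (H z.2)).
    exact: (measurableT_comp (mxH i) measurable_snd).
  have m2 : measurable_fun setT (fun z : T * T => y i (V z.1)).
    exact: (measurableT_comp (measurableT_comp (my i) mV) measurable_fst).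
  apply: measurable_funD.
    apply: measurable_funB => //; apply: measurable_funM => //.
    by apply: measurable_funX; exact: measurable_funB.
  by apply: measurable_funM => //; exact: measurable_funX.
have EPP : (\int[PP]_z (expR (F (y ^~ (V z.1)) (x ^~ (H z.2))))%:E = 1)%E.
  rewrite ge0_integral_product; last 2 first.
  - by apply/measurable_EFinP; apply: measurableT_comp.
  - by move=> z; rewrite lee_fin expR_ge0.
  transitivity (\int[P]_w (1%:E : \bar R))%E; last first.
    by rewrite integral_cst//= mul1e probability_setT.
  apply: eq_integral => w1 _.
  rewrite (_ : 1 = \prod_(i < k) 1); last by rewrite big1.
  rewrite -(@mindep_ge0_prod R _ T P k (fun i w => x i (H w))
    (fun i a => gratio (lam i) D a (y i (V w1))) (fun=> 1))//.
  - by apply: eq_integral => w2 _ /=; rewrite /F expR_sum.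
  - exact: (gs_mindep gs Gx u_orth).
  - by move=> i; exact: measurable_gratio.
  - by move=> i a; exact: expR_ge0.
  - move=> i.
    have := @gauss1_gratio R _ T P (fun w => x i (H w)) (lam i) D (y i (V w1)) setT
      (mxH i) (lam0 i) D0 (x_gauss i) measurableT.
    rewrite probability_setT => <-; apply: eq_integral => w _.
    by rewrite indicT mul1r.
(* [f] is unbounded, hence clamped. Clamping from above only lowers the exponential; clamping from
   below raises it to at most exp(-M), which disappears in the limit. *)
have key (M : nat) : \int[P]_w clamp M%:R (f w) <= B + expR (- M%:R).
  have M0 : 0 <= M%:R :> R by exact: ler0n.
  have : \int[PP]_z expR (clamp M%:R (F (y ^~ (V z.1)) (x ^~ (H z.2)))) <= 1 + expR (- M%:R).
    rewrite -lee_fin /Rintegral fineK; last first.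
      apply: (@integrable_fin_num _ _ _ PP setT _ (EFin \o (fun z : T * T => expR (clamp M%:R (F (y ^~ (V z.1)) (x ^~ (H z.2))))))) => //.
      apply: (@bounded_integrable _ _ _ PP _ (expR M%:R)).
        apply: measurableT_comp => //; apply: measurable_minr => //.
        exact: measurable_maxr.
      move=> z; rewrite ger0_norm ?expR_ge0// ler_expR.
      exact: le_trans (ler_norm _) (clamp_norm_le _ M0).
    apply: (@le_trans _ _ (\int[PP]_z ((expR (F (y ^~ (V z.1)) (x ^~ (H z.2))))%:E + (expR (- M%:R))%:E))%E).
      apply: ge0_le_integral => //.
      + apply/measurable_EFinP; apply: measurableT_comp => //; apply: measurable_minr => //.
        exact: measurable_maxr.
      + apply: emeasurable_funD => //; apply/measurable_EFinP; exact: measurableT_comp.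
      + move=> z _; rewrite -EFinD lee_fin /clamp.
        set g := F _ _; case: (leP g (- M%:R)) => gM.
          by apply: (@le_trans _ _ (expR (- M%:R))); rewrite ?lerDr ?expR_ge0// ler_expR ge_min lexx.
        by apply: (@le_trans _ _ (expR g)); rewrite ?lerDl ?expR_ge0// ler_expR ge_min lexx.
    rewrite ge0_integralD//; last by apply/measurable_EFinP; exact: measurableT_comp.
    have -> : (\int[PP]_z (expR (- M%:R))%:E = (expR (- M%:R))%:E)%E.
      rewrite integral_cst// -[RHS]mule1; congr (_ * _)%E; exact: probability_setT.
    by rewrite EPP.
  have DV' : \int[P]_w clamp M%:R (f w) + 1 <=
    B + \int[PP]_z expR (clamp M%:R (F (y ^~ (V z.1)) (x ^~ (H z.2)))).
    apply: (@donsker_varadhan R _ T P _ _ _ _ V H mV mH k k y x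
      (fun b a => clamp M%:R (F b a)) M%:R B my mx _ _ MI).
    + by move=> b a; exact: clamp_norm_le.
    + move=> b_ a_ b a cb ca; apply: cvg_clamp; apply: cvg_bigsum => i.
      have sq (c_ : nat -> R) (c : R) : c_ n @[n --> \oo] --> c ->
          c_ n ^+ 2 @[n --> \oo] --> c ^+ 2.
        by move=> h; exact: (cvgM h h).
      apply: cvgD; last by apply: cvgM; [exact: sq|exact: cvg_cst].
      apply: cvgB; first exact: cvg_cst.
      apply: cvgM; last exact: cvg_cst.
      by apply: sq; apply: cvgB; [exact: ca|exact: cb].
  lra.
have C1 : \int[P]_w clamp M%:R (f w) @[M --> \oo] --> \int[P]_w f w.
  have mf : measurable_fun setT f by case/integrableP: if_ => /measurable_EFinP.
  have [||||//] := @Rintegral_dominated_cvg _ _ _ P (fun M w => clamp M%:R (f w)) f (fun w => `|f w|).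
  - by move=> M; apply: measurable_minr => //; exact: measurable_maxr.
  - move=> w; apply/cvgrPdist_lt => e e0; near=> M.
    rewrite clamp_id ?subrr ?normr0//; near: M.
    exists (Num.truncn `|f w|).+1 => //= n /= xn; apply: ltW.
    by apply: lt_le_trans (truncnS_gt _) _; rewrite ler_nat.
  - exact: integrable_norm.
  - move=> M w; have [fM|fM] := leP `|f w| M%:R; first by rewrite clamp_id.
    by apply: le_trans (clamp_norm_le _ (ler0n _ _)) (ltW fM).
have C2 : B + expR (- M%:R) @[M --> \oo] --> B.
  rewrite -[X in _ --> X]addr0; apply: cvgD; first exact: cvg_cst.
  exact: cvgn_expR.
have : \int[P]_w f w <= B by apply: (ler_cvg_to C1 C2); exact: nearW.
rewrite Ef; set s := \sum_(i < k) _ => h.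
have : k%:R / 2 <= (2 * D)^-1 * s by lra.
by rewrite (mulrC _ s) ler_pdivlMr ?mulr_gt0// mulrA divfK.
Unshelve. all: end_near. Qed.

Section channel.
Variables (om : 'I_k -> T -> R) (o : 'I_k -> 'rV[R]_N) (nv : 'I_k -> R).
Hypotheses (Go : forall i, GR (om i) (o i))
  (oo_ : forall i j, dotp (o i) (o j) = (i == j)%:R * nv i)
  (nv0 : forall i, 0 < nv i) (uo : forall i j, dotp (u i) (o j) = 0).
Let omv w : vec R k := \col_i om i w.
Hypothesis om_H : indep2 P H omv.
Context ds (Ts : measurableType ds) (phi : vec R k -> Ts).
Hypothesis mphi : measurable_fun setT phi.

Let vv i := lam i + nv i.
Let vv0 i : 0 < vv i. Proof. exact: addr_gt0. Qed.
Let mom i : measurable_fun setT (om i). Proof. exact: gs_measurable gs _ _ (Go i). Qed.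
Let momv : measurable_fun setT omv. Proof. exact: measurable_col. Qed.
Let o_orth i j : i != j -> dotp (o i) (o j) = 0.
Proof. by move=> /negbTE ij; rewrite oo_ ij mul0r. Qed.
Let om_gauss i : has_gauss1 P (om i) 0 (nv i).
Proof. by have := gs_gauss gs (Go i); rewrite oo_ eqxx mul1r. Qed.

Let s i w := x i (H w) + om i w.
Let Gs i : GR (s i) (u i + o i).
Proof.
have := gs_lin gs 1 1 (Gx i) (Go i); rewrite !scale1r.
by rewrite (_ : (fun w => _) = s i)//; apply/funext => w; rewrite !mul1r.
Qed.
Let ms i : measurable_fun setT (s i). Proof. exact: gs_measurable gs _ _ (Gs i). Qed.
Let ss i j : dotp (u i + o i) (u j + o j) = (i == j)%:R * vv i.
Proof.
by rewrite dotpDl !dotpDr uo (dotpC (o i)) uo addr0 add0r uu oo_ -mulrDr.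
Qed.
Let s_gauss i : has_gauss1 P (s i) 0 (vv i).
Proof. by have := gs_gauss gs (Gs i); rewrite ss eqxx mul1r. Qed.
Let sv w : vec R k := \col_i s i w.
Let msv : measurable_fun setT sv. Proof. exact: measurable_col. Qed.

Let shifted (a : 'I_k -> R) w : vec R k := \col_i (a i + om i w).
Let weight (a : 'I_k -> R) w : R := \prod_(i < k) gratio (nv i) (vv i) (om i w) (- a i).

(** Under the weights the noise has law N(-a, lam + nv), so a + noise has the law of the channel
    output whatever the input [a] was. This is the change of measure that decouples output from
    input. *)
Let shifted_law (a : 'I_k -> R) E : measurable E ->
  (\int[P]_(w in shifted a @^-1` E) (weight a w)%:E = P (sv @^-1` E))%E.
Proof.
have msh : measurable_fun setT (shifted a).
  by apply: measurable_col => i; exact: measurable_funD.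
have mw : measurable_fun setT (weight a).
  apply: measurable_fun_bigprod => i.
  exact: (measurableT_comp (measurable_gratio _ _ _) (mom i)).
have w0 w : 0 <= weight a w by apply: prodr_ge0 => i _; exact: expR_ge0.
have rectE B : (forall i, measurable (B i)) ->
    density_law P msh mw w0 (rect B) = law P msv (rect B).
  move=> mB; rewrite /density_law integral_mkcond.
  have si : mindep P s.
    by apply: (gs_mindep gs Gs) => i j /negbTE ij; rewrite ss ij mul0r.
  have -> : law P msv (rect B) = P [set w | forall i, B i (s i w)].
    rewrite [LHS]/(P (sv @^-1` rect B)); congr (_ _).
    by apply/seteqP; split => w h i; have := h i; rewrite mxE.
  rewrite si//.
  rewrite -(@mindep_ge0_prod R _ T P k om
    (fun i z => \1_(B i) (a i + z) * gratio (nv i) (vv i) z (- a i))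
    (fun i => fine (P (s i @^-1` B i))))//.
  - apply: eq_integral => w _; rewrite patchE big_split/= -/(weight a w).
    case: ifPn => [/set_mem h|/negP h].
      rewrite big1 ?mul1r// => i _; rewrite indicE mem_set//.
      by have := h i; rewrite mxE.
    have [i Bi] : exists i, ~ B i (a i + om i w).
      apply/existsNP => h'; apply: h; apply/mem_set => i; rewrite mxE; exact: h'.
    by rewrite (bigD1 i)//= indicE memNset// !mul0r.
  - exact: (gs_mindep gs Go o_orth).
  - move=> i; apply: measurable_funM; last exact: measurable_gratio.
    by apply: (measurableT_comp (measurable_indic (mB i))); exact: measurable_funD.
  - by move=> i z; rewrite mulr_ge0 ?expR_ge0.
  - move=> i.
    have mB' : measurable ((fun z => a i + z) @^-1` B i).
      by rewrite -[Y in measurable Y]setTI; apply: measurable_funD.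
    have := @gauss1_gratio R _ T P (om i) (nv i) (vv i) (- a i) _ (mom i) (nv0 i) (vv0 i) (om_gauss i) mB'.
    rewrite -[X in X = _ -> _]/(\int[P]_t (\1_(B i) (a i + om i t) * gratio (nv i) (vv i) (om i t) (- a i))%:E)%E.
    move=> ->; rewrite fineK; last first.
      by apply: fin_num_measure; rewrite -[Y in measurable Y]setTI; exact: ms.
    rewrite s_gauss//.
    have sv0 : Num.sqrt (vv i) != 0 by rewrite gt_eqF// sqrtr_gt0.
    apply: (@char_gauss1 R _ _ (normal_prob (- a i) (Num.sqrt (vv i))) (fun z => a i + z)) => //.
    + exact: measurable_funD.
    + exact: ltW.
    + move=> c b; under eq_Rintegral do rewrite mulrDr -addrA addrCA.
      rewrite normal_cos// sqr_sqrtr ?ltW// mulrN addrA addNr add0r mulr0 add0r//.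
move=> mE; apply: (@vec_measure_unique R k (density_law P msh mw w0) (law P msv) _ _ E mE) => //.
have := rectE (fun=> setT) (fun=> measurableT).
rewrite (_ : rect _ = setT); last by apply/seteqP; split.
move=> e; apply: (eq_ind_r (fun z => (z < +oo)%E) _ e).
exact: (le_lt_trans (probability_le1 (law P msv) measurableT) (ltry 1)).
Qed.

(** [L] is the log-ratio of the conditional to the marginal density of the output. Its two quadratic
    terms have equal means and cancel, leaving the Gaussian formula. A measurable map [phi] is
    allowed because events of phi(s) are events of s. *)
Lemma gaussian_channel_info :
  (mutual_info P (fun w => phi (sv w)) H <= (\sum_(i < k) 2^-1 * ln (vv i / nv i))%:E)%E.
Proof.
pose L w := \sum_(i < k) (2^-1 * ln (vv i / nv i) +
  (2 * vv i)^-1 * s i w ^+ 2 - (2 * nv i)^-1 * om i w ^+ 2).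
have is2 i : P.-integrable setT (EFin \o (fun w => s i w ^+ 2)).
  exact: (gs_cov gs (Gs i) (Gs i)).1.
have io2 i : P.-integrable setT (EFin \o (fun w => om i w ^+ 2)).
  exact: (gs_cov gs (Go i) (Go i)).1.
have icst c : P.-integrable setT (EFin \o (fun=> c : R)).
  exact: finite_measure_integrable_cst.
have i1 i : P.-integrable setT (EFin \o (fun w => 2^-1 * ln (vv i / nv i) + (2 * vv i)^-1 * s i w ^+ 2)).
  by apply: integrableRD => //; exact: integrableRZ.
have i2 i : P.-integrable setT (EFin \o (fun w => 2^-1 * ln (vv i / nv i) +
    (2 * vv i)^-1 * s i w ^+ 2 - (2 * nv i)^-1 * om i w ^+ 2)).
  by apply: integrableRB => //; exact: integrableRZ.
have iL : P.-integrable setT (EFin \o L) by exact: integrableR_sum.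
have mL : measurable_fun setT L by case/integrableP: iL => /measurable_EFinP.
have -> : \sum_(i < k) 2^-1 * ln (vv i / nv i) = \int[P]_w L w.
  rewrite Rintegral_sum//; apply: eq_bigr => i _.
  rewrite RintegralB//; last exact: integrableRZ.
  rewrite RintegralD//; last exact: integrableRZ.
  rewrite !RintegralZl// Rintegral_cst//= probability_setT mulr1.
  have -> : \int[P]_w (s i w ^+ 2) = vv i.
    by have := (gs_cov gs (Gs i) (Gs i)).2; rewrite ss eqxx mul1r.
  have -> : \int[P]_w (om i w ^+ 2) = nv i.
    by have := (gs_cov gs (Go i) (Go i)).2; rewrite oo_ eqxx mul1r.
  by field; rewrite (gt_eqF (nv0 i)) (gt_eqF (vv0 i)).
apply: mutual_info_le_log => //; first exact: (measurableT_comp mphi msv).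
move=> A B mA mB.
have mphiA : measurable (phi @^-1` A) by rewrite -[Y in measurable Y]setTI; exact: mphi.
(* The integrand rewritten as a function of the independent pair (history, noise), so that the noise
   can be integrated first. *)
pose h (z : Th * vec R k) : \bar R := ((\1_B z.1 * \1_(phi @^-1` A) (\col_i (x i z.1 + z.2 i ord0) : vec R k) *
  \prod_(i < k) gratio (nv i) (vv i) (z.2 i ord0) (- x i z.1))%:E).
have mh : measurable_fun setT h.
  have m1 i : measurable_fun setT (fun z : Th * vec R k => x i z.1).
    exact: (measurableT_comp (mx i) measurable_fst).
  have m2 i : measurable_fun setT (fun z : Th * vec R k => z.2 i ord0).
    exact: (measurableT_comp (measurable_coord i) measurable_snd).
  apply/measurable_EFinP; apply: measurable_funM.
    apply: measurable_funM.
      exact: (measurableT_comp (measurable_indic mB) measurable_fst).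
    apply: (measurableT_comp (measurable_indic mphiA)).
    by apply: measurable_col => i; exact: measurable_funD.
  apply: measurable_fun_bigprod => i; apply: measurableT_comp => //; apply: measurable_funD.
    apply: measurable_funB => //; apply: measurable_funM => //; apply: measurable_funX.
    by apply: measurable_funB => //; exact: measurableT_comp.
  by apply: measurable_funM => //; exact: measurable_funX.
have h0 z : (0 <= h z)%E.
  by rewrite lee_fin !mulr_ge0//; apply: prodr_ge0 => i _; exact: expR_ge0.
have -> : (\int[P]_(w in (fun w => phi (sv w)) @^-1` A `&` H @^-1` B) (expR (- L w))%:E =
    \int[P]_w h (H w, omv w))%E.
  rewrite integral_mkcond; apply: eq_integral => w _; rewrite patchE /h /=.
  have -> : \col_i (x i (H w) + omv w i ord0) = sv w.
    by apply/matrixP => i j; rewrite !mxE.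
  have -> : \prod_(i < k) gratio (nv i) (vv i) (omv w i ord0) (- x i (H w)) = expR (- L w).
    rewrite /L -sumrN expR_sum; apply: eq_bigr => i _; rewrite mxE /gratio; congr expR.
    rewrite -(invf_div (vv i)) lnV ?posrE ?divr_gt0// opprK /s (addrC (om i w)).
    by field; rewrite (gt_eqF (nv0 i)) (gt_eqF (vv0 i)).
  rewrite !indicE; case: ifPn => [/set_mem [/= hA hB]|/negP nAB].
    by rewrite !mem_set// !mul1r.
  case: (boolP (H w \in B)) => [/set_mem hB|_]; last by rewrite !mul0r.
  rewrite memNset ?mulr0 ?mul0r// => hA; apply: nAB; exact/mem_set.
rewrite (indep2_integral mH momv om_H mh h0).
rewrite le_eqVlt; apply/orP; left; apply/eqP.
transitivity (\int[P]_w1 (P ((fun w => phi (sv w)) @^-1` A) * (\1_(H @^-1` B) w1)%:E))%E.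
  apply: eq_integral => w1 _.
  rewrite -[(fun w => phi (sv w)) @^-1` A]/(sv @^-1` (phi @^-1` A)).
  rewrite -(shifted_law (x ^~ (H w1)) mphiA) [in RHS]integral_mkcond.
  have -> : (\1_(H @^-1` B) w1 : R) = \1_B (H w1) by rewrite !indicE.
  rewrite /h/=; case: (boolP (H w1 \in B)) => hB; rewrite !indicE/= ?hB ?(negbTE hB).
    rewrite mule1; apply: eq_integral => w2 _; rewrite patchE mul1r indicE.
    have -> : \col_i (x i (H w1) + omv w2 i ord0) = shifted (x ^~ (H w1)) w2.
      by apply/matrixP => i j; rewrite !mxE.
    have -> : \prod_(i < k) gratio (nv i) (vv i) (omv w2 i ord0) (- x i (H w1)) = weight (x ^~ (H w1)) w2.
      by apply: eq_bigr => i _; rewrite mxE.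
    rewrite [w2 \in _ @^-1` _](_ : _ = (shifted (x ^~ (H w1)) w2 \in phi @^-1` A)).
      by case: (_ \in _); rewrite ?mul1r ?mul0r.
    by apply/idP/idP => /set_mem hh; apply/mem_set.
  by rewrite mule0; under eq_integral do rewrite !mul0r; rewrite integral0.
rewrite ge0_integralZl//; last by apply/measurable_EFinP; apply: measurable_indic; rewrite -[Y in measurable Y]setTI; exact: mH.
by rewrite integral_indic// ?setIT// -[Y in measurable Y]setTI; exact: mH.
Qed.

End channel.

End rate_distortion.

(** * Linear algebra of the filter *)

Section psd.
Context (R : realType).

Let block_form n (a : 'M[R]_1) (b : 'M[R]_(1, n)) (S : 'M[R]_n) (s : 'M[R]_1) (v : 'cV[R]_n) :
  ((col_mx s v)^T *m block_mx a b b^T S *m col_mx s v) ord0 ord0 =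
  s ord0 ord0 ^+ 2 * a ord0 ord0 + 2 * s ord0 ord0 * (b *m v) ord0 ord0 +
  (v^T *m S *m v) ord0 ord0.
Proof.
rewrite tr_col_mx mul_row_block mul_row_col !mulmxDl [LHS]mxE [X in X + _]mxE [X in _ + X]mxE.
have e1 : (s^T *m a *m s) ord0 ord0 = s ord0 ord0 ^+ 2 * a ord0 ord0.
  rewrite (mx11_scalar s) (mx11_scalar a) tr_scalar_mx -!scalar_mxM !mxE eqxx !mulr1n; ring.
have e2 : (s^T *m b *m v) ord0 ord0 = s ord0 ord0 * (b *m v) ord0 ord0.
  by rewrite {1}(mx11_scalar s) tr_scalar_mx -mulmxA mul_scalar_mx mxE.
have e3 : (v^T *m b^T *m s) ord0 ord0 = s ord0 ord0 * (b *m v) ord0 ord0.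
  by rewrite {1}(mx11_scalar s) mul_mx_scalar -trmx_mul !mxE.
rewrite e1 e2 e3; ring.
Qed.

(** Cholesky factorisation by Schur complements. A zero pivot is harmless: it forces the whole row
    to vanish, and the convention 0^-1 = 0 then makes the same formulas valid. *)
Lemma psd_factor n (S : 'M[R]_n) : psd S -> exists L : 'M[R]_n, L *m L^T = S.
Proof.
elim: n S => [|n ih] S [symS posS]; first by exists 0; apply/matrixP => -[].
pose S1 := S : 'M[R]_(1 + n, 1 + n).
pose a := ulsubmx S1; pose b := ursubmx S1; pose S' := drsubmx S1.
have bT : dlsubmx S1 = b^T by rewrite /b trmx_ursub symS.
have S1E : S1 = block_mx a b b^T S' by rewrite -bT submxK.
pose a0 := a ord0 ord0.
have form (s : R) (v : 'cV[R]_n) : 0 <= s ^+ 2 * a0 + 2 * s * (b *m v) ord0 ord0 + (v^T *m S' *m v) ord0 ord0.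
  have := posS (col_mx s%:M v : 'cV[R]_(1 + n)); rewrite -[S]/S1 S1E block_form.
  by rewrite mxE eqxx mulr1n.
have a0_ge0 : 0 <= a0.
  by have := form 1 0; rewrite mulmx0 mulmx0 mxE expr1n mul1r mulr0 !addr0.
have b0 : a0 = 0 -> b = 0.
  move=> az; apply/matrixP => i j; rewrite ord1 [RHS]mxE; apply/eqP/negP => /negP bj.
  pose v : 'cV[R]_n := delta_mx j ord0.
  have bv : (b *m v) ord0 ord0 = b ord0 j by rewrite -colE mxE.
  (* With a zero pivot the form is affine in s; this s gives it the value -1, against positivity. *)
  have := form (- (1 + (v^T *m S' *m v) ord0 ord0) / (2 * b ord0 j)) v.
  rewrite az bv mulr0 add0r.
  set c := (_ *m v) ord0 ord0.
  rewrite (_ : _ + c = -1); first by rewrite oppr_ge0 ler10.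
  by field.
have schur : psd (S' - a0^-1 *: (b^T *m b)).
  split.
    rewrite linearB/= linearZ/= trmx_mul trmxK; congr (_ - _).
    by rewrite /S' trmx_drsub symS.
  move=> v.
  have vbbv : (v^T *m (b^T *m b) *m v) ord0 ord0 = (b *m v) ord0 ord0 ^+ 2.
    rewrite mulmxA -trmx_mul -mulmxA.
    by rewrite (mx11_scalar (b *m v)) tr_scalar_mx -scalar_mxM !mxE eqxx !mulr1n.
  rewrite mulmxBr mulmxBl mxE [X in _ + X]mxE -scalemxAr -scalemxAl [X in _ - X]mxE vbbv.
  (* The minimiser in s, at which the form equals that of the Schur complement. *)
  have := form (- a0^-1 * (b *m v) ord0 ord0) v.
  have [az|az] := eqVneq a0 0.
    by rewrite az invr0 !mul0r subr0 mulr0 oppr0 !mul0r mulr0 mul0r !add0r.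
  set c := (b *m v) ord0 ord0; set q := (v^T *m S' *m v) ord0 ord0.
  by rewrite (_ : _ + q = q - a0^-1 * c ^+ 2)//; field.
have [L' L'E] := ih _ schur.
pose r := Num.sqrt a0.
have rr : r * r = a0 by rewrite -expr2 sqr_sqrtr.
suff [L LE] : exists L : 'M[R]_(1 + n, 1 + n), L *m L^T = block_mx a b b^T S'.
  by exists L; rewrite -[RHS]/S1 S1E.
exists (block_mx r%:M 0 (r^-1 *: b^T) L').
rewrite tr_block_mx mulmx_block trmx0 !mulmx0 !mul0mx !addr0.
rewrite tr_scalar_mx linearZ/= trmxK -scalar_mxM rr.
have rb : r *: (r^-1 *: b) = b.
  rewrite scalerA; have [r0|r0] := eqVneq r 0; last by rewrite mulfV// scale1r.
  by rewrite b0 ?scaler0// -rr r0 mul0r.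
congr block_mx.
- by rewrite [RHS]mx11_scalar.
- by rewrite mul_scalar_mx.
- by rewrite mul_mx_scalar -[X in _ = X^T]rb; apply/matrixP => i j; rewrite !mxE.
- rewrite L'E -scalemxAl -scalemxAr scalerA -invfM rr addrC subrK//.
Qed.

Lemma psd_mulmxT n k (L : 'M[R]_(n, k)) : psd (L *m L^T).
Proof.
split; first by rewrite trmx_mul trmxK.
move=> a; rewrite mulmxA -(mulmxA _ L^T) -[L^T *m a]trmxK trmx_mul trmxK mxE.
by apply: sumr_ge0 => i _; rewrite [X in _ * X]mxE -expr2 sqr_ge0.
Qed.

Lemma mulmxT_eq0 n k (M : 'M[R]_(n, k)) : M *m M^T = 0 -> M = 0.
Proof.
move=> M0; apply/matrixP => i j; rewrite [RHS]mxE; apply/eqP.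
have /eqP : (M *m M^T) i i = 0 by rewrite M0 mxE.
rewrite mxE psumr_eq0 => [/allP/(_ j)|l _]; last by rewrite mxE -expr2 sqr_ge0.
by rewrite mem_index_enum mxE -expr2 sqrf_eq0 => /(_ isT).
Qed.

(* Solvable even when [I *m I^T] is singular, since its kernel is that of [I^T]. *)
Lemma normal_equations n k l (X : 'M[R]_(n, l)) (I : 'M[R]_(k, l)) :
  X *m I^T *m pinvmx (I *m I^T) *m (I *m I^T) = X *m I^T.
Proof.
apply: mulmxKpV; rewrite submxE -mulmxA.
set c := cokermx _.
have Ic : I^T *m c = 0.
  apply: trmx_inj; rewrite trmx0; apply: mulmxT_eq0.
  by rewrite trmxK trmx_mul trmxK mulmxA -(mulmxA c^T) -mulmxA mulmx_coker mulmx0.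
by rewrite Ic mulmx0.
Qed.

End psd.

(** * Orthonormal blocks of coordinates *)

Section blocks.
Context (R : realType) (D J : nat).

(** The projection onto the j-th block of [D] consecutive coordinates. Distinct blocks model
    independent noises. *)
Definition sel (j : nat) : 'M[R]_(D, J * D) := \matrix_(a, b) (b == j * D + a :> nat)%:R.

Lemma sel_orth i j : (i < J)%N -> (j < J)%N -> sel i *m (sel j)^T = (i == j)%:R%:M.
Proof.
move=> iJ jJ; apply/matrixP => a c; rewrite !mxE.
have lt : (i * D + a < J * D)%N.
  by apply: (@leq_trans (i.+1 * D)); rewrite ?leq_mul2r ?iJ ?orbT// mulSnr ltn_add2l.
rewrite (bigD1 (Ordinal lt))//= big1 => [|b bn]; last first.
  rewrite !mxE (_ : (_ == _ :> nat) = false) ?mul0r//.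
  by apply/negbTE; apply: contra bn => /eqP e; apply/eqP/val_inj.
rewrite !mxE eqxx mul1r addr0 /=.
have [->|ij] := eqVneq i j; first by rewrite eqn_add2l.
rewrite mul0rn; case: eqP => // e; case/eqP: ij.
have D0 : (0 < D)%N by case: D a {lt c e} => // -[].
have := congr1 (divn^~ D) e; rewrite /= !divnMDl// !divn_small ?addn0//.
Qed.

Lemma sel_neq i j : (i < J)%N -> (j < J)%N -> i != j -> sel i *m (sel j)^T = 0.
Proof. by move=> iJ jJ /negbTE ij; rewrite sel_orth// ij raddf0. Qed.

Lemma sel_id i : (i < J)%N -> sel i *m (sel i)^T = 1%:M.
Proof. by move=> iJ; rewrite sel_orth// eqxx. Qed.

End blocks.

(** * The Kalman recursion on coefficient matrices *)

Section kalman.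
Context (R : realType) (d m T : nat).
Variables (A : 'M[R]_d) (C : 'M[R]_(m, d)).
Variables (L0 Lw : 'M[R]_(d, d + m)) (Lv : 'M[R]_(m, d + m)).

Local Notation N := ((3 * T).+1 * (d + m))%N.
Local Notation sel := (sel R (d + m) (3 * T).+1).

(* Blocks: 0 carries the initial state, 3t+1 and 3t+2 the state and observation noise
   of step t -> t+1, and 3t+3 the private noise of an agent at that step. *)
Fixpoint th_mx t : 'M[R]_(d, N) :=
  if t is t'.+1 then A *m th_mx t' + Lw *m sel (3 * t').+1 else L0 *m sel 0.
(** For t > 0, [(3 * t).-1] is 3(t-1) + 2, the observation block of the step from t-1 to t.
    Histories start at time 1, so the value at 0 is never observed. *)
Definition y_mx t : 'M[R]_(m, N) := C *m th_mx t + Lv *m sel (3 * t).-1.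

(** The filter is run on the estimation error instead of the estimate: prediction error and
    innovation are functions of the current error and of fresh noise only, and the gain is the
    regression of the first on the second. *)
Definition pred_mx (E : 'M[R]_(d, N)) t := A *m E + Lw *m sel (3 * t).+1.
Definition innov_mx (E : 'M[R]_(d, N)) t := C *m pred_mx E t + Lv *m sel (3 * t).+2.
Definition gain (E : 'M[R]_(d, N)) t : 'M[R]_(d, m) :=
  pred_mx E t *m (innov_mx E t)^T *m pinvmx (innov_mx E t *m (innov_mx E t)^T).
Fixpoint err_mx t : 'M[R]_(d, N) :=
  if t is t'.+1 then pred_mx (err_mx t') t' - gain (err_mx t') t' *m innov_mx (err_mx t') t'
  else th_mx 0.
Definition kgain t := gain (err_mx t) t.
Definition bar_mx t := th_mx t - err_mx t.

Lemma y_mx_succ t : y_mx t.+1 = C *m th_mx t.+1 + Lv *m sel (3 * t).+2.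
Proof. by rewrite /y_mx mulnS. Qed.

Lemma innov_mx_bar t : innov_mx (err_mx t) t = y_mx t.+1 - C *m A *m bar_mx t.
Proof.
rewrite y_mx_succ /innov_mx /pred_mx /bar_mx /= mulmxBr !mulmxDr !mulmxA.
move: (C *m A *m err_mx t) (C *m A *m th_mx t) (C *m Lw *m _) (Lv *m _) => a b c e.
by apply/matrixP => i j; rewrite !mxE; ring.
Qed.

Lemma bar_mx0 : bar_mx 0 = 0. Proof. by rewrite /bar_mx subrr. Qed.

Lemma bar_mxS t : bar_mx t.+1 = A *m bar_mx t + kgain t *m (y_mx t.+1 - C *m A *m bar_mx t).
Proof.
rewrite -innov_mx_bar /bar_mx /= -/(kgain t) mulmxBr {1}/pred_mx.
move: (kgain t *m _) (A *m err_mx t) (A *m th_mx t) (Lw *m _) => a b c e.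
by apply/matrixP => i j; rewrite !mxE; ring.
Qed.

Lemma th_mx_fresh t j : (t <= T)%N -> (3 * t < j <= 3 * T)%N -> th_mx t *m (sel j)^T = 0.
Proof.
elim: t j => [|t ih] j tT /andP[tj jT] /=; first by rewrite -mulmxA sel_neq ?mulmx0//; lia.
by rewrite mulmxDl -!mulmxA ih ?sel_neq ?mulmx0 ?addr0//; lia.
Qed.

(** Blocks 3j with j > 0 never enter the environment; they are reserved for private randomness. *)
Lemma th_mx_agent t j : (t <= T)%N -> (0 < j <= T)%N -> th_mx t *m (sel (3 * j))^T = 0.
Proof.
elim: t j => [|t ih] j tT /andP[j0 jT] /=; first by rewrite -mulmxA sel_neq ?mulmx0//; lia.
by rewrite mulmxDl -!mulmxA ih ?sel_neq ?mulmx0 ?addr0//; lia.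
Qed.

Lemma y_mx_agent t j : (0 < t <= T)%N -> (0 < j <= T)%N -> y_mx t *m (sel (3 * j))^T = 0.
Proof.
move=> tT jT; rewrite /y_mx mulmxDl -!mulmxA th_mx_agent ?sel_neq ?mulmx0 ?addr0//; lia.
Qed.

Lemma y_mx_fresh t j : (0 < t <= T)%N -> (3 * t < j <= 3 * T)%N -> y_mx t *m (sel j)^T = 0.
Proof.
move=> tT jT; rewrite /y_mx mulmxDl -!mulmxA th_mx_fresh ?sel_neq ?mulmx0 ?addr0//; lia.
Qed.

Lemma err_mx_fresh t j : (t <= T)%N -> (3 * t < j <= 3 * T)%N -> err_mx t *m (sel j)^T = 0.
Proof.
elim: t j => [|t ih] j tT tjT /=; first by rewrite -mulmxA sel_neq ?mulmx0//; lia.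
have pj : pred_mx (err_mx t) t *m (sel j)^T = 0.
  by rewrite /pred_mx mulmxDl -!mulmxA ih ?sel_neq ?mulmx0 ?addr0//; lia.
have -> : innov_mx (err_mx t) t = C *m pred_mx (err_mx t) t + Lv *m sel (3 * t).+2 by [].
by rewrite mulmxBl pj -mulmxA mulmxDl -!mulmxA pj sel_neq ?mulmx0 ?addr0 ?mulmx0 ?subr0//; lia.
Qed.

Lemma bar_mx_fresh t j : (t <= T)%N -> (3 * t < j <= 3 * T)%N -> bar_mx t *m (sel j)^T = 0.
Proof. by move=> tT tj; rewrite /bar_mx mulmxBl th_mx_fresh// err_mx_fresh// subrr. Qed.

Lemma gain_normal t :
  kgain t *m (innov_mx (err_mx t) t *m (innov_mx (err_mx t) t)^T) = pred_mx (err_mx t) t *m (innov_mx (err_mx t) t)^T.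
Proof. exact: normal_equations. Qed.

Lemma err_mx_innov t : err_mx t.+1 *m (innov_mx (err_mx t) t)^T = 0.
Proof. by rewrite /= -/(kgain t) mulmxBl -mulmxA gain_normal subrr. Qed.

(** Orthogonality to the past survives an update, because the new error combines the old one with
    noise that the past does not contain. *)
Let err_mxS_old n t (M : 'M[R]_(n, N)) : (t < T)%N ->
  err_mx t *m M^T = 0 -> M *m (sel (3 * t).+1)^T = 0 -> M *m (sel (3 * t).+2)^T = 0 ->
  err_mx t.+1 *m M^T = 0.
Proof.
move=> tT e1 e2 e3.
have f2 : sel (3 * t).+1 *m M^T = 0 by apply: trmx_inj; rewrite trmx_mul trmxK e2 trmx0.
have f3 : sel (3 * t).+2 *m M^T = 0 by apply: trmx_inj; rewrite trmx_mul trmxK e3 trmx0.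
have pj : pred_mx (err_mx t) t *m M^T = 0.
  by rewrite /pred_mx mulmxDl -!mulmxA e1 f2 !mulmx0 addr0.
have ij : innov_mx (err_mx t) t *m M^T = 0.
  by rewrite /innov_mx mulmxDl -!mulmxA pj f3 !mulmx0 addr0.
by rewrite /= mulmxBl pj -mulmxA ij mulmx0 subr0.
Qed.

(** The orthogonality principle. The newest observation is the innovation, orthogonal to the new
    error by the choice of gain, plus a linear function of the previous estimate, which belongs to
    the past. *)
Lemma err_mx_orth t : (t <= T)%N -> err_mx t *m (bar_mx t)^T = 0 /\
  forall s, (0 < s <= t)%N -> err_mx t *m (y_mx s)^T = 0.
Proof.
elim: t => [|t ih] tT.
  by rewrite bar_mx0 trmx0 mulmx0; split => // s; lia.
have [eb ey] := ih (ltnW tT).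
have eb' : err_mx t.+1 *m (bar_mx t)^T = 0 by apply: err_mxS_old; rewrite ?bar_mx_fresh//; lia.
have ei := err_mx_innov t; split.
  by rewrite bar_mxS -innov_mx_bar linearD/= !trmx_mul mulmxDr !mulmxA eb' ei !mul0mx addr0.
move=> s /andP[s0]; rewrite leq_eqVlt => /predU1P[->|st].
  have -> : y_mx t.+1 = innov_mx (err_mx t) t + C *m A *m bar_mx t by rewrite innov_mx_bar subrK.
  by rewrite linearD/= mulmxDr ei trmx_mul mulmxA eb' mul0mx addr0.
apply: err_mxS_old; rewrite ?ey ?y_mx_fresh//; lia.
Qed.

(** This identifies the matrix [Pt] of the main statement as a prediction error covariance; the
    cross terms vanish since the state noise is fresh. *)
Lemma pred_mx_cov t : (t < T)%N ->
  pred_mx (err_mx t) t *m (pred_mx (err_mx t) t)^T = A *m (err_mx t *m (err_mx t)^T) *m A^T + Lw *m Lw^T.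
Proof.
move=> tT; rewrite /pred_mx linearD/= !trmx_mul mulmxDl !mulmxDr.
have e : err_mx t *m (sel (3 * t).+1)^T = 0 by rewrite err_mx_fresh//; lia.
have e' : sel (3 * t).+1 *m (err_mx t)^T = 0 by apply: trmx_inj; rewrite trmx_mul trmxK e trmx0.
rewrite !mulmxA -(mulmxA A _ (sel _)^T) e -(mulmxA Lw _ (err_mx t)^T) e' !mulmx0 !mul0mx addr0 add0r.
by rewrite -(mulmxA Lw) sel_id ?mulmx1//; lia.
Qed.

Lemma innov_mx_cov t : (t < T)%N ->
  innov_mx (err_mx t) t *m (innov_mx (err_mx t) t)^T =
    C *m (pred_mx (err_mx t) t *m (pred_mx (err_mx t) t)^T) *m C^T + Lv *m Lv^T /\
  pred_mx (err_mx t) t *m (innov_mx (err_mx t) t)^T = pred_mx (err_mx t) t *m (pred_mx (err_mx t) t)^T *m C^T.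
Proof.
move=> tT.
have e : pred_mx (err_mx t) t *m (sel (3 * t).+2)^T = 0.
  by rewrite /pred_mx mulmxDl -!mulmxA err_mx_fresh ?sel_neq ?mulmx0 ?addr0//; lia.
have e' : sel (3 * t).+2 *m (pred_mx (err_mx t) t)^T = 0.
  by apply: trmx_inj; rewrite trmx_mul trmxK e trmx0.
rewrite /innov_mx; move: (pred_mx _ _) e e' => X e e'.
have tr : (C *m X + Lv *m sel (3 * t).+2)^T = X^T *m C^T + (sel (3 * t).+2)^T *m Lv^T.
  by rewrite linearD/= !trmx_mul.
split; last by rewrite tr mulmxDr !mulmxA e mul0mx addr0.
rewrite tr mulmxDl !mulmxDr !mulmxA -(mulmxA C _ (sel _)^T) e -(mulmxA Lv _ X^T) e' !mulmx0 !mul0mx addr0 add0r.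
by rewrite -(mulmxA Lv) sel_id ?mulmx1//; lia.
Qed.

End kalman.

Section vec_measurability.
Context (R : realType) d (T : measurableType d).

Lemma measurable_mulmx n k (M : 'M[R]_(n, k)) (f : T -> vec R k) :
  measurable_fun setT f -> measurable_fun setT (fun w => (M *m f w : vec R n)).
Proof.
move=> mf; apply: measurable_fun_vec => i.
rewrite (_ : (fun w => _) = fun w => \sum_j M i j * f w j ord0); last first.
  by apply/funext => w; rewrite mxE.
apply: measurable_fun_bigsum => j; apply: measurable_funM => //.
exact: (measurableT_comp (measurable_coord j) mf).
Qed.

Lemma measurable_addmx n (f g : T -> vec R n) : measurable_fun setT f ->
  measurable_fun setT g -> measurable_fun setT (fun w => (f w + g w : vec R n)).
Proof.
move=> mf mg; apply: measurable_fun_vec => i.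
rewrite (_ : (fun w => _) = fun w => f w i ord0 + g w i ord0); last first.
  by apply/funext => w; rewrite mxE.
by apply: measurable_funD; exact: (measurableT_comp (measurable_coord i)).
Qed.

Lemma measurable_submx n (f g : T -> vec R n) : measurable_fun setT f ->
  measurable_fun setT g -> measurable_fun setT (fun w => (f w - g w : vec R n)).
Proof.
move=> mf mg; apply: measurable_fun_vec => i.
rewrite (_ : (fun w => _) = fun w => f w i ord0 - g w i ord0); last first.
  by apply/funext => w; rewrite !mxE.
by apply: measurable_funB; exact: (measurableT_comp (measurable_coord i)).
Qed.

Lemma integrable_mul_sqr (P : probability T R) (f g : T -> R) :
  measurable_fun setT f -> measurable_fun setT g ->
  P.-integrable setT (EFin \o (fun w => f w ^+ 2)) ->
  P.-integrable setT (EFin \o (fun w => g w ^+ 2)) ->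
  P.-integrable setT (EFin \o (fun w => f w * g w)).
Proof.
move=> mf mg f2 g2; apply: (le_integrable measurableT _ _ (integrableRD f2 g2)).
  by apply/measurable_EFinP; exact: measurable_funM.
move=> w _ /=; rewrite lee_fin normrM [leRHS]ger0_norm ?addr_ge0 ?sqr_ge0//.
rewrite -(real_normK (num_real (f w))) -(real_normK (num_real (g w))).
by move: (normr_ge0 (f w)) (normr_ge0 (g w)); nra.
Qed.

Lemma integrable_of_sqr (P : probability T R) (f : T -> R) : measurable_fun setT f ->
  P.-integrable setT (EFin \o (fun w => f w ^+ 2)) -> P.-integrable setT (EFin \o f).
Proof.
move=> mf f2; rewrite (_ : f = fun w => f w * 1); last by apply/funext => w; rewrite mulr1.
apply: integrable_mul_sqr => //.
exact: finite_measure_integrable_cst.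
Qed.

Lemma integrable_sqrB (P : probability T R) (f g : T -> R) :
  measurable_fun setT f -> measurable_fun setT g ->
  P.-integrable setT (EFin \o (fun w => f w ^+ 2)) ->
  P.-integrable setT (EFin \o (fun w => g w ^+ 2)) ->
  P.-integrable setT (EFin \o (fun w => (f w - g w) ^+ 2)).
Proof.
move=> mf mg f2 g2.
rewrite (_ : (fun w => _) = fun w => f w ^+ 2 + g w ^+ 2 - 2 * (f w * g w)); last first.
  by apply/funext => w; ring.
apply: integrableRB; first exact: integrableRD.
by apply: integrableRZ; exact: integrable_mul_sqr.
Qed.

End vec_measurability.

(** * Lower bound for the cost of one step *)

Section cost_lower.
Context (R : realType) d (T : measurableType d) (P : probability T R) (N : nat).
Variable GR : (T -> R) -> 'rV[R]_N -> Prop.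
Hypothesis gs : gaussian_system P GR.
Context dh (Th : measurableType dh) (H : T -> Th).
Hypothesis mH : measurable_fun setT H.
Variables (n : nat) (th : T -> vec R n) (Mt : 'M[R]_(n, N)) (xb : Th -> vec R n) (Mb : 'M[R]_(n, N)).
Hypotheses (mxb : measurable_fun setT xb) (Gt : gvec GR th Mt) (Gb : gvec GR (fun w => xb (H w)) Mb).
Hypothesis orth : (Mt - Mb) *m Mb^T = 0.
Variables (U : 'M[R]_n) (lam : 'rV[R]_n) (D B : R).
Hypotheses (UU : U^T *m U = 1%:M) (MbE : Mb *m Mb^T = U *m diag_mx lam *m U^T).
Hypotheses (lam0 : forall i, 0 < lam ord0 i) (D0 : 0 < D).
Hypothesis lnB : \sum_(i < n) ln (lam ord0 i / D) = 2 * B.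

Lemma dist_orthogonal (x y : vec R n) :
  \sum_(i < n) ((U^T *m x) i ord0 - (U^T *m y) i ord0) ^+ 2 = sqerr x y.
Proof.
have sq (z : vec R n) : \sum_(i < n) z i ord0 ^+ 2 = (z^T *m z) ord0 ord0.
  by rewrite mxE; apply: eq_bigr => i _; rewrite mxE expr2.
transitivity (\sum_(i < n) (U^T *m (x - y)) i ord0 ^+ 2).
  by apply: eq_bigr => i _; rewrite mulmxBr [X in _ = X ^+ 2]mxE [X in _ = (_ + X) ^+ 2]mxE.
rewrite sq trmx_mul trmxK -mulmxA (mulmxA U) (mulmx1C UU) mul1mx -sq.
by apply: eq_bigr => i _; rewrite !mxE.
Qed.

(** With e = th - xb, the squared error is |e|^2 + |xb - V|^2 plus cross terms of mean zero: e is
    orthogonal to xb and independent of V. The trace comes from the first term and the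
    rate-distortion bound, in the eigenbasis, handles the second. *)
Lemma cost_lower (V : T -> vec R n) : measurable_fun setT V ->
  indep2 P (fun w => th w - xb (H w) : vec R n) V ->
  (mutual_info P V H <= B%:E)%E ->
  ((\tr ((Mt - Mb) *m (Mt - Mb)^T) + n%:R * D)%:E <= \int[P]_w (sqerr (th w) (V w))%:E)%E.
Proof.
move=> mV eV MI.
pose e w i := th w i ord0 - xb (H w) i ord0.
have Ge i : GR (e ^~ i) (row i (Mt - Mb)).
  have := gvec_sub gs Gt Gb i; congr GR.
  by apply/funext => w; rewrite /e !mxE.
have mc k (X : T -> vec R k) : measurable_fun setT X -> forall i, measurable_fun setT (fun w => X w i ord0).
  by move=> mX i; exact: (measurableT_comp (measurable_coord i) mX).
have mth := gvec_measurable gs Gt.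
have mxbH := gvec_measurable gs Gb.
have me i : measurable_fun setT (e ^~ i) by exact: gs_measurable gs _ _ (Ge i).
have msq : measurable_fun setT (fun w => sqerr (th w) (V w)).
  by apply: measurable_fun_bigsum => i; apply: measurable_funX; apply: measurable_funB; exact: mc.
have sq0 w : 0 <= sqerr (th w) (V w) by apply: sumr_ge0 => i _; exact: sqr_ge0.
have [->|fin] := eqVneq (\int[P]_w (sqerr (th w) (V w))%:E)%E +oo%E; first by rewrite leey.
have isq : P.-integrable setT (EFin \o (fun w => sqerr (th w) (V w))).
  apply/integrableP; split; first exact/measurable_EFinP.
  rewrite ltey; apply: contra fin => /eqP <-; apply/eqP/esym.
  by apply: eq_integral => w _ /=; rewrite ger0_norm.
have itV i : P.-integrable setT (EFin \o (fun w => (th w i ord0 - V w i ord0) ^+ 2)).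
  apply: (le_integrable measurableT _ _ isq).
    by apply/measurable_EFinP; apply: measurable_funX; apply: measurable_funB; exact: mc.
  move=> w _ /=; rewrite lee_fin !ger0_norm ?sqr_ge0//.
  by rewrite /sqerr (bigD1 i)//= lerDl sumr_ge0// => j _; exact: sqr_ge0.
have ith i : P.-integrable setT (EFin \o (fun w => th w i ord0 ^+ 2)).
  exact: (gs_cov gs (Gt i) (Gt i)).1.
have ixb i : P.-integrable setT (EFin \o (fun w => xb (H w) i ord0 ^+ 2)).
  exact: (gs_cov gs (Gb i) (Gb i)).1.
have ie i : P.-integrable setT (EFin \o (fun w => e w i ^+ 2)).
  exact: (gs_cov gs (Ge i) (Ge i)).1.
(* Finite cost together with a Gaussian [th] makes [V] square integrable; infinite cost was
   discarded as trivial. *)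
have iV i : P.-integrable setT (EFin \o (fun w => V w i ord0 ^+ 2)).
  rewrite (_ : (fun w => _) = fun w => (th w i ord0 - (th w i ord0 - V w i ord0)) ^+ 2); last first.
    by apply/funext => w; ring.
  apply: integrable_sqrB => //; first exact: mc.
  by apply: measurable_funB; exact: mc.
have ixV i : P.-integrable setT (EFin \o (fun w => (xb (H w) i ord0 - V w i ord0) ^+ 2)).
  by apply: integrable_sqrB => //; exact: mc.
have iexb i : P.-integrable setT (EFin \o (fun w => e w i * xb (H w) i ord0)).
  exact: (gs_cov gs (Ge i) (Gb i)).1.
have ieV i : P.-integrable setT (EFin \o (fun w => e w i * V w i ord0)).
  by apply: integrable_mul_sqr => //; exact: mc.
have Eexb i : \int[P]_w (e w i * xb (H w) i ord0) = 0.
  by rewrite (gs_cov gs (Ge i) (Gb i)).2 dotp_row orth mxE.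
have EeV i : \int[P]_w (e w i * V w i ord0) = 0.
  apply: indep2_mul_mean0 => //; first exact: mc.
  - move=> A1 A2 mA1 mA2.
    have mA1' : measurable ((fun z : vec R n => z i ord0) @^-1` A1).
      by rewrite -[Y in measurable Y]setTI; exact: measurable_coord.
    have mA2' : measurable ((fun z : vec R n => z i ord0) @^-1` A2).
      by rewrite -[Y in measurable Y]setTI; exact: measurable_coord.
    have := eV _ _ mA1' mA2'.
    rewrite (_ : (fun w => th w - xb (H w)) @^-1` _ = (e ^~ i) @^-1` A1)//.
    by apply/seteqP; split => w; rewrite /= !mxE.
  - exact: (gs_mean gs (Ge i)).1.
  - by apply: integrable_of_sqr => //; exact: mc.
  - exact: (gs_mean gs (Ge i)).2.
have EE : (\int[P]_w (sqerr (th w) (V w))%:E = (\int[P]_w sqerr (th w) (V w))%:E)%E.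
  by rewrite /Rintegral fineK//; exact: integrable_fin_num isq.
rewrite EE lee_fin.
have -> : \int[P]_w sqerr (th w) (V w) = \sum_(i < n) (\int[P]_w (e w i ^+ 2) +
    \int[P]_w ((xb (H w) i ord0 - V w i ord0) ^+ 2)).
  rewrite /sqerr Rintegral_sum//; apply: eq_bigr => i _.
  have i1 : P.-integrable setT (EFin \o (fun w => e w i * xb (H w) i ord0 - e w i * V w i ord0)).
    exact: integrableRB.
  have i2 : P.-integrable setT (EFin \o (fun w => 2 * (e w i * xb (H w) i ord0 - e w i * V w i ord0))).
    exact: integrableRZ.
  transitivity (\int[P]_w (e w i ^+ 2 + (xb (H w) i ord0 - V w i ord0) ^+ 2 +
      2 * (e w i * xb (H w) i ord0 - e w i * V w i ord0))).
    by apply: eq_Rintegral => w _; rewrite /e; ring.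
  rewrite RintegralD//; last exact: integrableRD.
  by rewrite RintegralD// RintegralZl// RintegralB// Eexb EeV subr0 mulr0 addr0.
rewrite big_split/=; apply: lerD.
  rewrite /mxtrace le_eqVlt; apply/orP; left; apply/eqP; apply: eq_bigr => i _.
  by rewrite -dotp_row -(gs_cov gs (Ge i) (Ge i)).2.
have := @rate_distortion_lower R _ T P N GR gs _ Th H mH n (fun i h => (U^T *m xb h) i ord0)
  (fun i => row i (U^T *m Mb)) (fun i => lam ord0 i) _ _ _ lam0 _ (vec R n) V
  (fun i v => (U^T *m v) i ord0) D B mV.
have ixy i : P.-integrable setT (EFin \o (fun w => ((U^T *m xb (H w)) i ord0 - (U^T *m V w) i ord0) ^+ 2)).
  have isx : P.-integrable setT (EFin \o (fun w => \sum_(i < n) (xb (H w) i ord0 - V w i ord0) ^+ 2)).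
    exact: integrableR_sum.
  apply: (le_integrable measurableT _ _ isx).
    apply/measurable_EFinP; apply: measurable_funX; apply: measurable_funB; apply: mc; exact: measurable_mulmx.
  move=> w _ /=; rewrite lee_fin !ger0_norm ?sqr_ge0//; last first.
    by apply: sumr_ge0 => j _; exact: sqr_ge0.
  rewrite -/(sqerr (xb (H w)) (V w)) -dist_orthogonal (bigD1 i)//= lerDl.
  by apply: sumr_ge0 => j _; exact: sqr_ge0.
have -> : \sum_(i < n) \int[P]_w (xb (H w) i ord0 - V w i ord0) ^+ 2 =
    \sum_(i < n) \int[P]_w ((U^T *m xb (H w)) i ord0 - (U^T *m V w) i ord0) ^+ 2.
  rewrite -!Rintegral_sum//; apply: eq_Rintegral => w _.
  by rewrite [RHS]dist_orthogonal.
apply => //.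
- by move=> i; exact: (measurableT_comp (measurable_coord i) (measurable_mulmx _ mxb)).
- by move=> i; exact: (gvec_mul gs U^T Gb i).
- move=> i j; rewrite dotp_row trmx_mul trmxK mulmxA -(mulmxA U^T) MbE.
  by rewrite !mulmxA UU mul1mx -mulmxA UU mulmx1 mxE mulr_natl.
- by move=> i; exact: (measurableT_comp (measurable_coord i) (measurable_mulmx _ (@measurable_id _ _ _))).
Qed.

End cost_lower.

(** * Independence is preserved by sampling *)

Section independence_sampling.
Context (R : realType) d (T : measurableType d) (P : probability T R).

(** For fixed [A] both sides are finite measures in the event for (Y, Z); they agree on rectangles,
    hence everywhere. *)
Lemma indep2_pair d1 d2 d3 (T1 : measurableType d1) (T2 : measurableType d2) (T3 : measurableType d3)
    (X : T -> T1) (Y : T -> T2) (Z : T -> T3) :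
  measurable_fun setT X -> measurable_fun setT Y -> measurable_fun setT Z ->
  (forall A B C, measurable A -> measurable B -> measurable C ->
    P (X @^-1` A `&` (Y @^-1` B `&` Z @^-1` C)) = (P (X @^-1` A) * P (Y @^-1` B `&` Z @^-1` C))%E) ->
  indep2 P X (fun w => (Y w, Z w)).
Proof.
move=> mX mY mZ e A E mA mE.
have mYZ : measurable_fun setT (fun w => (Y w, Z w)) by exact: measurable_fun_pair.
have pX B : measurable B -> measurable (X @^-1` B).
  by move=> mB; rewrite -[W in measurable W]setTI; exact: mX.
have pY B : measurable B -> measurable (Y @^-1` B).
  by move=> mB; rewrite -[W in measurable W]setTI; exact: mY.
have pZ B : measurable B -> measurable (Z @^-1` B).
  by move=> mB; rewrite -[W in measurable W]setTI; exact: mZ.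
have pYZ B : measurable B -> measurable ((fun w => (Y w, Z w)) @^-1` B).
  by move=> mB; rewrite -[W in measurable W]setTI; exact: mYZ.
have pA := pX _ mA.
have p0 : 0 <= fine (P (X @^-1` A)) by exact: fine_ge0.
pose m1 := density_law P mYZ (@measurable_indic _ _ R setT _ pA) (fun w => ler0n _ _).
pose m2 := mscale (NngNum p0) (law P mYZ).
have m1E B : measurable B -> m1 B = P (X @^-1` A `&` (fun w => (Y w, Z w)) @^-1` B).
  by move=> mB; rewrite /m1 /density_law integral_indic//; exact: pYZ.
have m2E B : m2 B = (P (X @^-1` A) * P ((fun w => (Y w, Z w)) @^-1` B))%E.
  by rewrite /m2 /mscale/= fineK//; exact: fin_num_measure.
rewrite -m1E// -m2E.
apply: (measure_unique [set A `*` B | A in measurable & B in measurable] (fun=> setT)) => //.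
- by rewrite measurable_prod_measurableType.
- move=> _ _ [X1 mX1 [X2 mX2 <-]] [Y1 mY1 [Y2 mY2 <-]].
  exists (X1 `&` Y1); first exact: measurableI.
  by exists (X2 `&` Y2); [exact: measurableI|rewrite setXI].
- by move=> _; exists setT => //; exists setT => //; rewrite setXTT.
- by rewrite bigcup_const//; exists 0%N.
- by move=> _ [B mB [C mC <-]]; rewrite [LHS]m1E ?[RHS]m2E; [exact: e|exact: measurableX].
- move=> _; rewrite [ltLHS]m1E//.
  by apply: le_lt_trans (ltry 1); apply: probability_le1; apply: measurableI; [exact: pX|exact: pYZ].
Qed.

Lemma indep2_comp d1 d2 d3 (T1 : measurableType d1) (T2 : measurableType d2) (T3 : measurableType d3)
    (X : T -> T1) (Y : T -> T2) (f : T2 -> T3) : measurable_fun setT f ->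
  indep2 P X Y -> indep2 P X (fun w => f (Y w)).
Proof.
move=> mf iXY A B mA mB; apply: (iXY A (f @^-1` B)) => //.
by rewrite -[W in measurable W]setTI; exact: mf.
Qed.

(** Given sigma(G), the law of [V] depends on [Z] alone, so integrating the kernel against the
    independent pair (X, Z) factors. Retaining [Z] next to [V] in the conclusion is what allows the
    argument to be iterated. *)
Lemma samples_indep d1 d2 d3 d4 (T1 : measurableType d1) (Tz : measurableType d2)
    (Tw : measurableType d3) (Tv : measurableType d4)
    (X : T -> T1) (Z : T -> Tz) (f : Tz -> Tw) (k : R.-pker Tw ~> Tv) (V : T -> Tv) G :
  measurable_fun setT X -> measurable_fun setT Z -> measurable_fun setT f ->
  measurable_fun setT V -> samples_from P (fun w => f (Z w)) k V G ->
  ev X `<=` <<s G >> -> ev Z `<=` <<s G >> ->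
  indep2 P X Z -> indep2 P X (fun w => (V w, Z w)).
Proof.
move=> mX mZ mf mV smp XG ZG iXZ; apply: indep2_pair => // A B C mA mB mC.
pose h (z : T1 * Tz) : \bar R := ((\1_A z.1)%:E * ((\1_C z.2)%:E * k (f z.2) B))%E.
have mk : measurable_fun setT (fun z : Tz => k (f z) B).
  by apply: (measurableT_comp (measurable_kernel k B mB) mf).
have mh2 : measurable_fun setT (fun z : Tz => ((\1_C z)%:E * k (f z) B)%E).
  by apply: emeasurable_funM => //; apply/measurable_EFinP; exact: measurable_indic.
have mh : measurable_fun setT h.
  apply: emeasurable_funM; last exact: (measurableT_comp mh2 measurable_snd).
  by apply/measurable_EFinP; exact: (measurableT_comp (measurable_indic mA) measurable_fst).
have h0 z : (0 <= h z)%E by rewrite !mule_ge0// ?lee_fin.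
have sG : <<s G >> (X @^-1` A `&` Z @^-1` C).
  by apply: (@measurableI _ (g_sigma_algebraType G)); [apply: XG; exists A|apply: ZG; exists C].
have EC : P (V @^-1` B `&` Z @^-1` C) = (\int[P]_w ((\1_C (Z w))%:E * k (f (Z w)) B))%E.
  rewrite smp//; last by apply: ZG; exists C.
  rewrite [LHS]integral_mkcond; apply: eq_integral => w _; rewrite patchE indicE.
  rewrite (_ : (w \in _) = (Z w \in C)); last by apply/idP/idP => /set_mem ?; exact/mem_set.
  by case: (_ \in _); rewrite ?mul1e ?mul0e.
rewrite setICA smp//.
transitivity (\int[P]_w h (X w, Z w))%E.
  rewrite [LHS]integral_mkcond; apply: eq_integral => w _; rewrite patchE /h/= !indicE.
  rewrite in_setI.
  rewrite (_ : (w \in X @^-1` A) = (X w \in A)); last by apply/idP/idP => /set_mem ?; exact/mem_set.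
  rewrite (_ : (w \in Z @^-1` C) = (Z w \in C)); last by apply/idP/idP => /set_mem ?; exact/mem_set.
  by case: (_ \in A); case: (_ \in C); rewrite ?mul1e ?mul0e ?mule0.
rewrite (indep2_integral mX mZ iXZ mh h0) /h/=.
have pX : measurable (X @^-1` A) by rewrite -[W in measurable W]setTI; exact: mX.
transitivity (\int[P]_w ((\1_(X @^-1` A) w)%:E * P (V @^-1` B `&` Z @^-1` C)))%E.
  apply: eq_integral => w _; rewrite EC -ge0_integralZl//.
  exact: (measurableT_comp mh2 mZ).
rewrite ge0_integralZr//; last by apply/measurable_EFinP; exact: measurable_indic.
by rewrite integral_indic// setIT.
Qed.

End independence_sampling.

(** * Histories and the Kalman filter *)

Section history.
Context (R : realType) (m : nat).

Lemma hist_nth d (Om : measurableType d) (Y : nat -> Om -> vec R m) t w s :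
  (s < t)%N -> nth 0 (hist Y t w) s = Y s.+1 w.
Proof. by move=> st; rewrite -(tnth_nth 0 _ (Ordinal st)) tnth_mktuple. Qed.

Lemma measurable_hist d (Om : measurableType d) (Y : nat -> Om -> vec R m) t :
  (forall s, (1 <= s <= t)%N -> measurable_fun setT (Y s)) -> measurable_fun setT (hist Y t).
Proof.
move=> mY; apply/measurable_fun_tnthP => i.
rewrite (_ : _ \o _ = Y i.+1); first by apply: mY; rewrite /= ltn_ord.
by apply/funext => w /=; rewrite tnth_mktuple.
Qed.

Lemma measurable_tuple_nth t s :
  measurable_fun setT (fun h : t.-tuple (vec R m) => (nth 0 h s : vec R m)).
Proof.
have [st|ts] := ltnP s t.
  rewrite (_ : (fun h => _) = fun h => tnth h (Ordinal st)); first exact: measurable_tnth.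
  by apply/funext => h; rewrite (tnth_nth 0).
rewrite (_ : (fun h => _) = fun=> 0); first exact: measurable_cst.
by apply/funext => h; rewrite nth_default// size_tuple.
Qed.

(** Turns inclusion of events into measurability for sigma(G), where composition and pairing lemmas
    apply. *)
Lemma ev_sub_sigma d (Om : measurableType d) d' (T' : measurableType d') (X : Om -> T') G :
  ev X `<=` <<s G >> <-> measurable_fun (setT : set (g_sigma_algebraType G)) X.
Proof.
split=> [XG _ A mA|mX _ [A mA ->]]; first by rewrite setTI; apply: XG; exists A.
by have := mX measurableT A mA; rewrite setTI.
Qed.

Context d (Om : measurableType d) (P : probability Om R) (N : nat).
Variable GR : (Om -> R) -> 'rV[R]_N -> Prop.
Hypothesis gs : gaussian_system P GR.
Variables (t : nat) (Y : nat -> Om -> vec R m) (My : nat -> 'M[R]_(m, N)).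
Hypothesis GY : forall s, (1 <= s <= t)%N -> gvec GR (Y s) (My s).

(** Flattens the history into one vector, so that the independence criterion for Gaussian vectors
    applies to it. *)
Let stack w : vec R (t * m) := (mxvec (\matrix_(i < t, j < m) Y i.+1 w j ord0))^T.
Let stackM : 'M[R]_(t * m, N) := \matrix_(k, l) mxvec (\matrix_(i < t, j < m) My i.+1 j l) ord0 k.
Let unstack (v : vec R (t * m)) : t.-tuple (vec R m) :=
  [tuple (row i (vec_mx v^T))^T | i < t].

Let unstackK w : unstack (stack w) = hist Y t w.
Proof.
apply: eq_from_tnth => i; rewrite !tnth_mktuple /stack trmxK mxvecK.
by apply/matrixP => j k; rewrite (ord1 k) !mxE.
Qed.

Let measurable_unstack : measurable_fun setT unstack.
Proof.
apply/measurable_fun_tnthP => i; apply: measurable_fun_vec => j.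
rewrite (_ : (fun w => _) = fun v : vec R (t * m) => v (mxvec_index i j) ord0); first exact: measurable_coord.
by apply/funext => v /=; rewrite tnth_mktuple !mxE.
Qed.

Let Gstack : gvec GR stack stackM.
Proof.
move=> k; case/mxvec_indexP: k => i j.
have := GY (s := i.+1) _ j; rewrite /= ltn_ord => /(_ isT).
rewrite (_ : row j _ = row (mxvec_index i j) stackM); last first.
  by apply/rowP => l; rewrite !mxE mxvecE mxE.
by congr GR; apply/funext => w; rewrite /stack mxE mxvecE mxE.
Qed.

Lemma gs_indep_hist n (X : Om -> vec R n) (M : 'M[R]_(n, N)) : gvec GR X M ->
  (forall s, (1 <= s <= t)%N -> M *m (My s)^T = 0) -> indep2 P X (hist Y t).
Proof.
move=> GX MY.
have -> : hist Y t = fun w => unstack (stack w) by apply/funext => w; rewrite unstackK.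
apply: (indep2_comp measurable_unstack); apply: (gs_indep gs GX Gstack).
apply/matrixP => a k; case/mxvec_indexP: k => i j.
have := congr1 (fun Z : 'M[R]_(n, m) => Z a j) (MY i.+1 _); rewrite /= ltn_ord => /(_ isT).
move=> h; transitivity ((M *m (My i.+1)^T) a j); last by rewrite h !mxE.
rewrite [LHS]mxE [RHS]mxE; apply: eq_bigr => l _; congr (_ * _).
by rewrite !mxE mxvecE mxE.
Qed.

End history.

Section filter.
Context (R : realType) (d m : nat) (A : 'M[R]_d) (C : 'M[R]_(m, d)) (K : nat -> 'M[R]_(d, m)).

(** Indices are shifted by one: [y s] is the observation made at time s+1, as in the entries of
    [hist]. *)
Fixpoint kfilter (y : nat -> vec R m) t : vec R d :=
  if t is s.+1 then A *m kfilter y s + K s *m (y s - C *m A *m kfilter y s) else 0.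

Lemma eq_kfilter y1 y2 t : (forall s, (s < t)%N -> y1 s = y2 s) -> kfilter y1 t = kfilter y2 t.
Proof.
elim: t => //= t ih e; rewrite ih ?e// => s st; exact: e (leqW st).
Qed.

Lemma measurable_kfilter dO (Om : measurableType dO) (y : nat -> Om -> vec R m) t :
  (forall s, measurable_fun setT (y s)) -> measurable_fun setT (fun w => kfilter (y ^~ w) t).
Proof.
move=> my; elim: t => [|t ih] /=; first exact: measurable_cst.
apply: measurable_addmx; first exact: measurable_mulmx.
by apply: measurable_mulmx; apply: measurable_submx => //; exact: measurable_mulmx.
Qed.

Definition hfilter t (h : t.-tuple (vec R m)) : vec R d := kfilter (nth 0 h) t.

Lemma measurable_hfilter t : measurable_fun setT (@hfilter t).
Proof. by apply: measurable_kfilter => s; exact: measurable_tuple_nth. Qed.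

Lemma hfilter_hist dO (Om : measurableType dO) (Y : nat -> Om -> vec R m) t w :
  hfilter (hist Y t w) = kfilter (fun s => Y s.+1 w) t.
Proof. by apply: eq_kfilter => s st; rewrite hist_nth. Qed.

End filter.

(** * Gaussian system of a family of independent noises *)

Section noise_system.
Context (R : realType) d (Om : measurableType d) (P : probability Om R) (n D N : nat).
Variables (Z : 'I_n -> Om -> vec R D) (L : 'I_n -> 'M[R]_D) (sl : 'I_n -> 'M[R]_(D, N)).
Hypotheses (mZ : forall i, measurable_fun setT (Z i))
  (GZ : forall i (a : 'rV[R]_D),
    has_gauss1 P (fun w => (a *m Z i w) ord0 ord0) 0 (dotp (a *m L i) (a *m L i)))
  (iZ : mutually_independent P (fun i => ev (Z i)))
  (sl_id : forall i, sl i *m (sl i)^T = 1%:M)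
  (sl_neq : forall i j, i != j -> sl i *m (sl j)^T = 0).

(** A relation, since degenerate noises may represent one variable by several coefficient families;
    any of them gives the right variance. *)
Definition noise_rel (X : Om -> R) (u : 'rV[R]_N) := exists a : 'I_n -> 'rV[R]_D,
  X = (fun w => \sum_i (a i *m Z i w) ord0 ord0) /\ u = \sum_i a i *m L i *m sl i.

Let mcomp i (a : 'rV[R]_D) : measurable_fun setT (fun w => (a *m Z i w) ord0 ord0).
Proof. exact: (measurableT_comp (measurable_coord ord0) (measurable_mulmx _ (mZ i))). Qed.

Let dotp_noise (a : 'I_n -> 'rV[R]_D) :
  dotp (\sum_i a i *m L i *m sl i) (\sum_i a i *m L i *m sl i) =
  \sum_i dotp (a i *m L i) (a i *m L i).
Proof.
rewrite dotp_suml; apply: eq_bigr => i _; rewrite dotp_sumr (bigD1 i)//= big1 ?addr0 => [|j ji].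
  by rewrite /dotp trmx_mul mulmxA -(mulmxA _ (sl i)) sl_id mulmx1.
by rewrite /dotp trmx_mul mulmxA -(mulmxA _ (sl i)) sl_neq 1?eq_sym// mulmx0 mul0mx mxE.
Qed.

Let noise_mindep (a : 'I_n -> 'rV[R]_D) :
  mindep P (fun i w => (a i *m Z i w) ord0 ord0).
Proof.
move=> B mB.
pose E i : set Om := (fun w => (a i *m Z i w) ord0 ord0) @^-1` B i.
rewrite (_ : [set w | _] = \bigcap_(i in [set: 'I_n]) E i); last first.
  by apply/seteqP; split => w h i => [_|]; exact: h.
apply: (iZ (E := E)) => i; exists ((fun z : vec R D => (a i *m z : vec R 1) ord0 ord0) @^-1` B i) => //.
rewrite -[Y in measurable Y]setTI.
exact: (measurableT_comp (measurable_coord ord0) (measurable_mulmx _ (@measurable_id _ _ _))).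
Qed.

(** Independence makes the variances of the summands add, and orthonormality of the blocks makes the
    squared length of the coefficient vector the same sum. *)
Lemma noise_gaussian_system : gaussian_system P noise_rel.
Proof.
split.
- exists (fun=> 0); split; last by rewrite big1// => i _; rewrite !mul0mx.
  by apply/funext => w; rewrite big1// => i _; rewrite mul0mx mxE.
- move=> c X u b X' v [a [-> ->]] [a' [-> ->]].
  exists (fun i => c *: a i + b *: a' i); split.
    apply/funext => w; rewrite !mulr_sumr -big_split/=; apply: eq_bigr => i _.
    by rewrite mulmxDl -!scalemxAl [RHS]mxE [X in _ = X + _]mxE [X in _ = _ + X]mxE.
  rewrite !scaler_sumr -big_split/=; apply: eq_bigr => i _.
  by rewrite !mulmxDl -!scalemxAl.
- by move=> _ u [a [-> _]]; exact: measurable_fun_bigsum.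
- move=> _ _ [a [-> ->]]; rewrite dotp_noise.
  apply: char_gauss1.
  + exact: measurable_fun_bigsum.
  + by apply: sumr_ge0 => i _; exact: dotp_ge0.
  move=> c b; rewrite mulr0 add0r.
  have := @mindep_char R _ Om P n (fun i w => ((c *: a i) *m Z i w) ord0 ord0)
    (fun i => dotp (c *: a i *m L i) (c *: a i *m L i)) _ _ b _ _.
  have -> : \sum_i dotp (c *: a i *m L i) (c *: a i *m L i) =
      c ^+ 2 * \sum_i dotp (a i *m L i) (a i *m L i).
    rewrite mulr_sumr; apply: eq_bigr => i _.
    by rewrite -!scalemxAl dotpZl dotpZr mulrA expr2.
  move=> <- //.
  + apply: eq_Rintegral => w _; congr (cos (_ + _)); rewrite mulr_sumr.
    by apply: eq_bigr => i _; rewrite -scalemxAl [RHS]mxE.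
  + by move=> i; exact: dotp_ge0.
Qed.

Lemma noise_gvec i : gvec noise_rel (Z i) (L i *m sl i).
Proof.
move=> l; exists (fun j => if j == i then delta_mx ord0 l else 0); split.
  apply/funext => w; rewrite (bigD1 i)//= eqxx big1 ?addr0 => [|j /negbTE ->].
    by rewrite -rowE mxE.
  by rewrite mul0mx mxE.
rewrite (bigD1 i)//= eqxx big1 ?addr0 => [|j /negbTE ->].
  by rewrite -mulmxA -rowE.
by rewrite !mul0mx.
Qed.

End noise_system.

Lemma gauss_rv_lin (R : realType) dO (Om : measurableType dO) (P : probability Om R) n k
    (X : Om -> vec R n) (L : 'M[R]_(n, k)) (a : 'rV[R]_n) :
  is_gauss_rv P X 0 (L *m L^T) ->
  has_gauss1 P (fun w => (a *m X w) ord0 ord0) 0 (dotp (a *m L) (a *m L)).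
Proof.
move=> [_ [_ XG]] E mE; have := XG a^T E mE; rewrite trmxK mulmx0 mxE => ->.
by rewrite /dotp trmx_mul !mulmxA.
Qed.

Section environment.
Context (R : realType) (d m T : nat) (A : 'M[R]_d) (C : 'M[R]_(m, d)).
Variables (S0 Sw : 'M[R]_d) (Sv : 'M[R]_m).
Variables (L0 Lw : 'M[R]_(d, d + m)) (Lv : 'M[R]_(m, d + m)).
Hypotheses (L0E : L0 *m L0^T = S0) (LwE : Lw *m Lw^T = Sw) (LvE : Lv *m Lv^T = Sv).

Local Notation th_mx := (th_mx T A L0 Lw).
Local Notation y_mx := (y_mx T A C L0 Lw Lv).
Local Notation err_mx := (err_mx T A C L0 Lw Lv).
Local Notation bar_mx := (bar_mx T A C L0 Lw Lv).
Local Notation K := (kgain T A C L0 Lw Lv).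

Section abstract.
Context dO (Om : measurableType dO) (P : probability Om R).
Variables (th : nat -> Om -> vec R d) (Y : nat -> Om -> vec R m).

(** An arbitrary environment is put in the common frame by solving its equations for the noises,
    which are independent by assumption, and rebuilding states and observations linearly from
    them. *)
Lemma env_gaussian_system : env_real P T A C S0 Sw Sv th Y ->
  exists GR : (Om -> R) -> 'rV[R]_((3 * T).+1 * (d + m)) -> Prop,
  [/\ gaussian_system P GR, forall t, (t <= T)%N -> gvec GR (th t) (th_mx t) &
      forall t, (1 <= t <= T)%N -> gvec GR (Y t) (y_mx t)].
Proof.
move=> [mthY th0G omG nuG ind].
pose om t := fun w => (th t.+1 w - A *m th t w : vec R d).
pose nu t := fun w => (Y t w - C *m th t w : vec R m).
have mth t : measurable_fun setT (th t) by case: (mthY t).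
have mY t : measurable_fun setT (Y t) by case: (mthY t).
have mom t : measurable_fun setT (om t).
  by apply: measurable_submx => //; exact: measurable_mulmx.
have mnu t : measurable_fun setT (nu t).
  by apply: measurable_submx => //; exact: measurable_mulmx.
pose I := 'I_(T + T).+1.
(* State and observation noises have different dimensions; padding with zeros puts them in one
   family of (d+m)-vectors. *)
pose up : 'M[R]_(d + m, d) := col_mx 1%:M 0; pose dn : 'M[R]_(d + m, m) := col_mx 0 1%:M.
pose Z (i : I) : Om -> vec R (d + m) := if (i == 0 :> nat) then fun w => up *m th 0 w
  else if (i <= T)%N then fun w => up *m om i.-1 w else fun w => dn *m nu (i - T)%N w.
pose L (i : I) : 'M[R]_(d + m) := if (i == 0 :> nat) then up *m L0
  else if (i <= T)%N then up *m Lw else dn *m Lv.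
(* Translates the numbering of [env_real] (initial state, then T state noises, then T observation
   noises) into the interleaved blocks of [th_mx] and [y_mx]. *)
pose idx (i : nat) : nat := if i == 0 then 0 else if (i <= T)%N then (3 * i.-1).+1
  else (3 * (i - T).-1).+2.
have idxJ (i : I) : (idx i < (3 * T).+1)%N.
  by have := ltn_ord i; rewrite /idx; case: eqP => //; case: ifP; lia.
have idxI (i j : I) : i != j -> idx i != idx j.
  apply: contraNneq => e; apply/eqP/val_inj => /=.
  have := ltn_ord i; have := ltn_ord j; move: e; rewrite /idx.
  by repeat case: ifP => ?; lia.
pose sl (i : I) := sel R (d + m) (3 * T).+1 (idx i).
have mZ i : measurable_fun setT (Z i).
  by rewrite /Z; case: ifP => _; [|case: ifP => _]; exact: measurable_mulmx.
have GZ i (a : 'rV[R]_(d + m)) :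
    has_gauss1 P (fun w => (a *m Z i w) ord0 ord0) 0 (dotp (a *m L i) (a *m L i)).
  have E n k (M : 'M[R]_(d + m, n)) (X : Om -> vec R n) (L' : 'M[R]_(n, k)) :
      is_gauss_rv P X 0 (L' *m L'^T) -> has_gauss1 P (fun w => (a *m (M *m X w)) ord0 ord0) 0
        (dotp (a *m (M *m L')) (a *m (M *m L'))).
    move=> XG; rewrite mulmxA (_ : (fun w => _) = (fun w => (a *m M *m X w) ord0 ord0)).
      exact: gauss_rv_lin.
    by apply/funext => w; rewrite mulmxA.
  rewrite /Z /L; case: ifP => [_|/eqP i0]; first by apply: E; rewrite L0E.
  case: ifP => iT; apply: E; rewrite ?LwE ?LvE.
    by apply: omG; lia.
  by apply: nuG; have := ltn_ord i; lia.
have iZ : mutually_independent P (fun i => ev (Z i)).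
  move=> E EZ; apply: ind => i; have [B mB ->] := EZ i; rewrite /Z.
  case: ifP => _; [|case: ifP => _].
  - exists ((fun z : vec R d => up *m z : vec R (d + m)) @^-1` B) => //.
    by rewrite -[X in measurable X]setTI; apply: measurable_mulmx => //; exact: measurable_id.
  - exists ((fun z : vec R d => up *m z : vec R (d + m)) @^-1` B) => //.
    by rewrite -[X in measurable X]setTI; apply: measurable_mulmx => //; exact: measurable_id.
  - exists ((fun z : vec R m => dn *m z : vec R (d + m)) @^-1` B) => //.
    by rewrite -[X in measurable X]setTI; apply: measurable_mulmx => //; exact: measurable_id.
have sl_id i : sl i *m (sl i)^T = 1%:M by exact: sel_id.
have sl_neq i j : i != j -> sl i *m (sl j)^T = 0 by move=> ij; apply: sel_neq => //; exact: idxI.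
have gs := noise_gaussian_system mZ GZ iZ sl_id sl_neq.
have upK k (M : 'M[R]_(d, k)) : row_mx 1%:M 0 *m (up *m M) = M.
  by rewrite mulmxA mul_row_col mulmx1 mul0mx addr0 mul1mx.
have dnK k (M : 'M[R]_(m, k)) : row_mx 0 1%:M *m (dn *m M) = M.
  by rewrite mulmxA mul_row_col mulmx1 mul0mx add0r mul1mx.
have Gth0 : gvec (noise_rel Z L sl) (th 0) (L0 *m sel R (d + m) (3 * T).+1 0).
  have := gvec_mul gs (row_mx 1%:M 0) (noise_gvec Z L sl ord0).
  rewrite /L /sl/= -mulmxA upK; congr gvec.
  by apply/funext => w; rewrite /Z/= upK.
have Gom t : (t < T)%N -> gvec (noise_rel Z L sl) (om t) (Lw *m sel R (d + m) (3 * T).+1 (3 * t).+1).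
  move=> tT; have lt : (t.+1 < (T + T).+1)%N by lia.
  have := gvec_mul gs (row_mx 1%:M 0) (noise_gvec Z L sl (Ordinal lt)).
  rewrite /L /sl /idx /= tT -mulmxA upK; congr gvec.
  by apply/funext => w; rewrite /Z/= tT upK.
have Gnu t : (1 <= t <= T)%N -> gvec (noise_rel Z L sl) (nu t) (Lv *m sel R (d + m) (3 * T).+1 (3 * t).-1).
  move=> tT; have lt : (T + t < (T + T).+1)%N by lia.
  have := gvec_mul gs (row_mx 0 1%:M) (noise_gvec Z L sl (Ordinal lt)).
  have n0 : (T + t == 0)%N = false by lia.
  have nT : (T + t <= T)%N = false by lia.
  rewrite /L /sl /idx /= n0 nT -mulmxA dnK addKn.
  rewrite (_ : (3 * t.-1).+2 = (3 * t).-1)%N; last by lia.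
  congr gvec.
  by apply/funext => w; rewrite /Z/= n0 nT dnK addKn.
have Gth t : (t <= T)%N -> gvec (noise_rel Z L sl) (th t) (th_mx t).
  elim: t => [//|t ih] tT /=.
  rewrite (_ : th t.+1 = fun w => A *m th t w + om t w); last first.
    by apply/funext => w; rewrite /om addrC subrK.
  by apply: (gvec_add gs); [apply: (gvec_mul gs); apply: ih; exact: ltnW|exact: Gom].
exists (noise_rel Z L sl); split => // t tT.
rewrite (_ : Y t = fun w => C *m th t w + nu t w); last first.
  by apply/funext => w; rewrite /nu addrC subrK.
apply: (gvec_add gs); last exact: Gnu.
by apply: (gvec_mul gs); apply: Gth; case/andP: tT.
Qed.

Variable GR : (Om -> R) -> 'rV[R]_((3 * T).+1 * (d + m)) -> Prop.
Hypotheses (gs : gaussian_system P GR)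
  (Gth : forall t, (t <= T)%N -> gvec GR (th t) (th_mx t))
  (GY : forall t, (1 <= t <= T)%N -> gvec GR (Y t) (y_mx t)).

Local Notation hf := (@hfilter R d m A C K).

Lemma filter_gvec t : (t <= T)%N -> gvec GR (fun w => hf (hist Y t w)) (bar_mx t).
Proof.
move=> tT; under eq_fun do rewrite hfilter_hist.
elim: t tT => [|t ih] tT /=.
  rewrite bar_mx0 => i; rewrite (_ : row i 0 = 0); last by apply/rowP => j; rewrite !mxE.
  by rewrite (_ : (fun w => _) = fun=> 0); [exact: gs0 gs|apply/funext => w; rewrite mxE].
have G := ih (ltnW tT).
rewrite bar_mxS; apply: (gvec_add gs); first exact: (gvec_mul gs).
apply: (gvec_mul gs); apply: (gvec_sub gs); first by apply: GY; lia.
exact: (gvec_mul gs).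
Qed.

Lemma error_gvec t : (t <= T)%N -> gvec GR (fun w => th t w - hf (hist Y t w)) (err_mx t).
Proof.
move=> tT; have := gvec_sub gs (Gth tT) (filter_gvec tT).
by rewrite /bar_mx subKr.
Qed.

Lemma error_indep_hist t : (t <= T)%N ->
  indep2 P (fun w => th t w - hf (hist Y t w) : vec R d) (hist Y t).
Proof.
move=> tT; apply: (gs_indep_hist gs _ (error_gvec tT)).
  by move=> s st; apply: GY; lia.
by move=> s st; apply: (err_mx_orth _ _ _ _ _ tT).2.
Qed.

Lemma measurable_hist_le t : (t <= T)%N -> measurable_fun setT (hist Y t).
Proof. by move=> tT; apply: measurable_hist => s st; apply: (gvec_measurable gs (GY _)); lia. Qed.

Lemma env_sigma t G : (t <= T)%N -> env_events T th Y `<=` G ->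
  ev (hist Y t) `<=` <<s G >> /\
  ev (fun w => th t w - hf (hist Y t w) : vec R d) `<=` <<s G >>.
Proof.
move=> tT EG.
have sub X : env_events T th Y X -> <<s G >> X by move=> /EG; exact: sub_sigma_algebra.
have mhist : measurable_fun (setT : set (g_sigma_algebraType G)) (hist Y t).
  apply: (@measurable_hist _ _ _ (g_sigma_algebraType G)) => s st.
  by apply/ev_sub_sigma => X eX; apply: sub; right; exists s => //=; lia.
split; first exact/ev_sub_sigma.
apply/ev_sub_sigma; apply: (@measurable_submx _ _ (g_sigma_algebraType G)).
  by apply/ev_sub_sigma => X eX; apply: sub; left; exists t.
exact: (measurableT_comp (measurable_hfilter A C K (t := t)) mhist).
Qed.

End abstract.

End environment.

(** * Lower bounds *)

Section lower_bound.
Context (R : realType) (d m T : nat) (A : 'M[R]_d) (C : 'M[R]_(m, d)).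
Variables (S0 Sw : 'M[R]_d) (Sv : 'M[R]_m).
Variables (L0 Lw : 'M[R]_(d, d + m)) (Lv : 'M[R]_(m, d + m)).
Hypotheses (L0E : L0 *m L0^T = S0) (LwE : Lw *m Lw^T = Sw) (LvE : Lv *m Lv^T = Sv).

Local Notation err_mx := (err_mx T A C L0 Lw Lv).
Local Notation bar_mx := (bar_mx T A C L0 Lw Lv).
Local Notation K := (kgain T A C L0 Lw Lv).
Local Notation hf := (@hfilter R d m A C K).

Variables (B : R) (U : nat -> 'M[R]_d) (lam : nat -> 'rV[R]_d) (D : nat -> R).
Hypotheses (UU : forall t, (1 <= t <= T)%N -> (U t)^T *m U t = 1%:M)
  (barE : forall t, (1 <= t <= T)%N -> bar_mx t *m (bar_mx t)^T = U t *m diag_mx (lam t) *m (U t)^T)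
  (lam0 : forall t, (1 <= t <= T)%N -> forall i, 0 < lam t ord0 i)
  (D0 : forall t, (1 <= t <= T)%N -> 0 < D t)
  (lnB : forall t, (1 <= t <= T)%N -> \sum_(i < d) ln (lam t ord0 i / D t) = 2 * B).

Definition optimal_cost : R :=
  \sum_(1 <= t < T.+1) (\tr (err_mx t *m (err_mx t)^T) + d%:R * D t).

Context dO (Om : measurableType dO) (P : probability Om R).
Variables (th : nat -> Om -> vec R d) (Y : nat -> Om -> vec R m).
Hypothesis env : env_real P T A C S0 Sw Sv th Y.

Let err t w : vec R d := th t w - hf (hist Y t w).

Let err_measurable t : (t <= T)%N -> measurable_fun setT (err t).
Proof.
move=> tT; have [GR [gs Gth GY]] := env_gaussian_system L0E LwE LvE env.
exact: (gvec_measurable gs (error_gvec gs Gth GY tT)).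
Qed.

Let hist_measurable t : (t <= T)%N -> measurable_fun setT (hist Y t).
Proof.
move=> tT; have [GR [gs Gth GY]] := env_gaussian_system L0E LwE LvE env.
exact: (measurable_hist_le gs GY tT).
Qed.

Let err_hist t : (t <= T)%N -> indep2 P (err t) (hist Y t).
Proof.
move=> tT; have [GR [gs Gth GY]] := env_gaussian_system L0E LwE LvE env.
exact: (error_indep_hist gs Gth GY tT).
Qed.

Lemma step_cost_lower t (V : Om -> vec R d) : (1 <= t <= T)%N -> measurable_fun setT V ->
  indep2 P (err t) V -> (mutual_info P V (hist Y t) <= B%:E)%E ->
  ((\tr (err_mx t *m (err_mx t)^T) + d%:R * D t)%:E <= \int[P]_w (sqerr (th t w) (V w))%:E)%E.
Proof.
move=> tT mV iV MI; have tT' : (t <= T)%N by case/andP: tT.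
have [GR [gs Gth GY]] := env_gaussian_system L0E LwE LvE env.
have eE : th_mx T A L0 Lw t - bar_mx t = err_mx t by rewrite /bar_mx subKr.
rewrite -eE; apply: (cost_lower gs (hist_measurable tT') (measurable_hfilter A C K (t := t))
  (Gth _ tT') (filter_gvec gs GY tT') _ (UU tT) (barE tT) (lam0 tT) (D0 tT) (lnB tT)) => //.
by rewrite eE (err_mx_orth _ _ _ _ _ tT').1.
Qed.

Lemma total_cost_lower (th_hat : nat -> Om -> vec R d) :
  (forall t, (1 <= t <= T)%N -> [/\ measurable_fun setT (th_hat t), indep2 P (err t) (th_hat t) &
    (mutual_info P (th_hat t) (hist Y t) <= B%:E)%E]) ->
  (optimal_cost%:E <= total_cost P T th th_hat)%E.
Proof.
move=> h; rewrite /optimal_cost /total_cost -sumEFin.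
rewrite big_nat_cond [leRHS]big_nat_cond; apply: lee_sum => t; rewrite andbT => tT.
by have [] := h t tT; exact: step_cost_lower.
Qed.

Lemma prediction_lower (q : forall t : nat, R.-pker (t.-tuple (vec R m)) ~> vec R d)
    (th_hat : nat -> Om -> vec R d) :
  (forall t, measurable_fun setT (th_hat t)) ->
  (forall t, (1 <= t <= T)%N -> samples_from P (hist Y t) (q t) (th_hat t)
     (env_events T th Y `|` (\bigcup_(s in [set s | (1 <= s < t)%N]) ev (th_hat s)))) ->
  (forall t, (1 <= t <= T)%N -> (mutual_info P (th_hat t) (hist Y t) <= B%:E)%E) ->
  (optimal_cost%:E <= total_cost P T th th_hat)%E.
Proof.
move=> mh smp MI; apply: total_cost_lower => t tT; have tT' : (t <= T)%N by case/andP: tT.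
split => //; last exact: MI.
have [hG eG] := @env_sigma R d m T A C L0 Lw Lv _ _ th Y t _ tT' (@subsetUl _ _
  (\bigcup_(s in [set s | (1 <= s < t)%N]) ev (th_hat s))).
have := samples_indep (f := id) (err_measurable tT') (hist_measurable tT') (@measurable_id _ _ _)
  (mh t) (smp t tT) eG hG (err_hist tT').
exact: (indep2_comp measurable_fst).
Qed.

(** The error at time t must be shown independent of the estimate although states are produced step
    by step; the information bound on the estimate comes from that on the state by data
    processing. *)
Lemma agent_lower dx (X : measurableType dx) (x0 : X)
    (p : nat -> R.-pker (X * vec R m)%type ~> X) (q : nat -> R.-pker X ~> vec R d)
    (S : nat -> Om -> X) (th_hat : nat -> Om -> vec R d) :
  agent_real P T A C S0 Sw Sv x0 p q th Y S th_hat ->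
  (forall t, (1 <= t <= T)%N -> (mutual_info P (S t) (hist Y t) <= B%:E)%E) ->
  (optimal_cost%:E <= total_cost P T th th_hat)%E.
Proof.
move=> [_ mSh S00 smpS smph] MI; apply: total_cost_lower => t tT.
have tT' : (t <= T)%N by case/andP: tT.
have mS s : measurable_fun setT (S s) by case: (mSh s).
have mh s : measurable_fun setT (th_hat s) by case: (mSh s).
have mH := hist_measurable tT'.
have pairG s (G : set (set Om)) : ev (S s) `<=` <<s G >> -> ev (hist Y t) `<=` <<s G >> ->
    ev (fun w => (S s w, hist Y t w)) `<=` <<s G >>.
  move=> /ev_sub_sigma SG /ev_sub_sigma HG; apply/ev_sub_sigma.
  exact: (@measurable_fun_pair _ _ _ (g_sigma_algebraType G)).
(* The target time t stays fixed while s grows. Pairing [S s] with the full history up to t keeps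
   Y_{s+1} available as an input of the next transition. *)
have ind s : (s <= t)%N -> indep2 P (err t) (fun w => (S s w, hist Y t w)).
  elim: s => [_|s ih st].
    have := indep2_comp (f := fun h => (x0, h)) (measurable_fun_pair (measurable_cst x0) (@measurable_id _ _ _)) (err_hist tT').
    by rewrite (_ : (fun w => (x0, hist Y t w)) = (fun w => (S 0 w, hist Y t w)))//;
      apply/funext => w; rewrite S00.
  have := smpS s (leq_trans st tT').
  set G := (X in samples_from _ _ _ _ X) => smp.
  have EG : env_events T th Y `<=` G by move=> E hE; left; left.
  have [hG eG] := @env_sigma R d m T A C L0 Lw Lv _ _ th Y t _ tT' EG.
  have SG : ev (S s) `<=` <<s G >>.
    by move=> E hE; apply: sub_sigma_algebra; left; right; exists s => /=.
  pose f (z : X * t.-tuple (vec R m)) : X * vec R m := (z.1, nth 0 z.2 s).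
  have mf : measurable_fun setT f.
    apply: measurable_fun_pair => //.
    exact: (measurableT_comp (measurable_tuple_nth (t := t) s) measurable_snd).
  have fE : (fun w => (S s w, Y s.+1 w)) = fun w => f (S s w, hist Y t w).
    by apply/funext => w; rewrite /f/= hist_nth.
  rewrite fE in smp.
  have := samples_indep (err_measurable tT') (measurable_fun_pair (mS s) mH) mf (mS s.+1) smp eG
    (pairG _ _ SG hG) (ih (ltnW st)).
  apply: (indep2_comp (f := fun z : X * (X * t.-tuple (vec R m)) => (z.1, z.2.2))).
  apply: measurable_fun_pair => //.
  exact: (measurableT_comp measurable_snd measurable_snd).
have := smph t tT; set G := (X in samples_from _ _ _ _ X) => smp.
have EG : env_events T th Y `<=` G by move=> E hE; left; left.
have [hG eG] := @env_sigma R d m T A C L0 Lw Lv _ _ th Y t _ tT' EG.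
have SG : ev (S t) `<=` <<s G >>.
  by move=> E hE; apply: sub_sigma_algebra; left; right; exists t => /=.
split => //; last exact: (data_processing (mS t) (mh t) mH smp hG (MI t tT)).
have := samples_indep (f := fst) (err_measurable tT') (measurable_fun_pair (mS t) mH) measurable_fst (mh t) smp eG
    (pairG _ _ SG hG) (ind t (leqnn t)).
exact: (indep2_comp measurable_fst).
Qed.

End lower_bound.

(** * The canonical Gaussian space *)

Section canonical.
Context (R : realType) (N : nat).
Let P := std_gauss R N.

Definition canon_rel (X : vec R N -> R) (u : 'rV[R]_N) := X = fun w => (u *m w) ord0 ord0.

Lemma canon_gaussian_system : gaussian_system P canon_rel.
Proof.
split.
- by apply/funext => w; rewrite mul0mx mxE.
- move=> a _ u b _ v -> ->; apply/funext => w.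
  by rewrite mulmxDl -!scalemxAl [RHS]mxE [X in _ = X + _]mxE [X in _ = _ + X]mxE.
- move=> _ u ->; exact: (measurableT_comp (measurable_coord ord0) (measurable_mulmx _ (@measurable_id _ _ _))).
- move=> _ u ->; apply: char_gauss1.
  + exact: (measurableT_comp (measurable_coord ord0) (measurable_mulmx _ (@measurable_id _ _ _))).
  + exact: dotp_ge0.
  + move=> a b; rewrite mulr0 add0r.
    have := @std_gauss_char R N (fun i => a * u ord0 i) b.
    have -> : \sum_(i < N) (a * u ord0 i) ^+ 2 = a ^+ 2 * dotp u u.
      by rewrite dotpE mulr_sumr; apply: eq_bigr => i _; rewrite exprMn expr2.
    move=> <-; apply: eq_Rintegral => w _; congr (cos (_ + _)).
    by rewrite mxE mulr_sumr; apply: eq_bigr => i _; rewrite mulrA.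
Qed.

Lemma canon_gvec n (M : 'M[R]_(n, N)) : gvec canon_rel (fun w => M *m w : vec R n) M.
Proof. by move=> i; apply/funext => w; rewrite -row_mul [RHS]mxE. Qed.

Lemma canon_gauss_rv n (M : 'M[R]_(n, N)) :
  is_gauss_rv P (fun w => M *m w : vec R n) 0 (M *m M^T).
Proof.
have [sym pos] := psd_mulmxT M; split => //; split => // a E mE.
have := gs_gauss canon_gaussian_system (X := fun w => (a^T *m M *m w) ord0 ord0) erefl mE.
rewrite mulmx0 mxE /dotp trmx_mul trmxK !mulmxA => <-; congr (P _).
by apply/funext => w /=; rewrite mulmxA.
Qed.

Lemma canon_law n (M : 'M[R]_(n, N)) : M *m M^T = 1%:M -> forall E, measurable E ->
  P ((fun w => M *m w : vec R n) @^-1` E) = std_gauss R n E.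
Proof.
move=> MM E mE.
apply: (@char_eq_law _ _ _ _ R P (std_gauss R n) n (fun w => M *m w) id) => //.
  by apply: measurable_mulmx; exact: measurable_id.
move=> a b; rewrite [RHS]std_gauss_char.
have := gs_char canon_gaussian_system b (gvec_lin canon_gaussian_system a (canon_gvec M)).
have -> : dotp (\row_i a i *m M) (\row_i a i *m M) = \sum_(i < n) a i ^+ 2.
  rewrite /dotp trmx_mul mulmxA -(mulmxA _ M) MM mulmx1 mxE.
  by apply: eq_bigr => i _; rewrite !mxE expr2.
by [].
Qed.

(** One block is split off at a time: it is orthogonal to the projection [Pi] onto the blocks
    already treated, and the event [F s] depends on the sample point only through [Pi]. *)
Lemma canon_mutually_independent n D (sl : 'I_n -> 'M[R]_(D, N)) :
  (forall i, sl i *m (sl i)^T = 1%:M) -> (forall i j, i != j -> sl i *m (sl j)^T = 0) ->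
  mutually_independent P (fun i => ev (fun w : vec R N => sl i *m w : vec R D)).
Proof.
move=> sl_id sl_neq E EE.
have /choice[B BE] : forall i, exists B : set (vec R D),
    measurable B /\ E i = (fun w : vec R N => sl i *m w : vec R D) @^-1` B.
  by move=> i; have [B mB e] := EE i; exists B.
have mmul k (M : 'M[R]_(k, N)) : measurable_fun setT (fun w : vec R N => M *m w : vec R k).
  by apply: measurable_mulmx; exact: measurable_id.
have mE i : measurable (E i).
  have [mB ->] := BE i; rewrite -[Y in measurable Y]setTI; exact: mmul.
pose F s : set (vec R N) := \big[setI/setT]_(i <- s) E i.
have FE s w : F s w <-> forall i, i \in s -> E i w.
  rewrite /F; elim: s => [|i s ih]; first by rewrite big_nil.
  rewrite big_cons; split => [[Ei /ih Fs] j|h].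
    by rewrite inE => /predU1P[->|/Fs].
  split; first by apply: h; rewrite mem_head.
  by apply/ih => j js; apply: h; rewrite inE js orbT.
have mF s : measurable (F s) by exact: bigsetI_measurable.
suff key s : uniq s -> P (F s) = (\prod_(i <- s) Pr P (E i))%:E.
  rewrite (_ : \bigcap_(i in _) E i = F (index_enum _)); first exact/key/index_enum_uniq.
  apply/seteqP; split => w h; first by apply/FE => i _; exact: h.
  by move=> i _; move/FE: h; apply; rewrite mem_index_enum.
elim: s => [_|i s ih /= /andP[iNs us]].
  by rewrite /F !big_nil; exact: probability_setT.
pose Pi := \sum_(j <- s) (sl j)^T *m sl j.
have PiE j : j \in s -> sl j *m Pi = sl j.
  move=> js; rewrite /Pi mulmx_sumr (bigD1_seq j)//= mulmxA sl_id mul1mx big1 ?addr0// => l lj.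
  by rewrite mulmxA sl_neq ?mul0mx// eq_sym.
have Pi0 : sl i *m Pi^T = 0.
  rewrite /Pi raddf_sum/= mulmx_sumr big_seq big1// => j js.
  rewrite trmx_mul trmxK mulmxA sl_neq ?mul0mx//.
  by apply: contraNneq iNs => ->.
have := gs_indep canon_gaussian_system (canon_gvec (sl i)) (canon_gvec Pi) Pi0.
pose G : set (vec R N) := [set z | forall j, j \in s -> B j (sl j *m z)].
have GE : (fun w : vec R N => Pi *m w : vec R N) @^-1` G = F s.
  apply/seteqP; split => w.
    move=> h; apply/FE => j js; have [_ ->] := BE j.
    by have := h j js; rewrite mulmxA PiE.
  move=> /FE h j js; have := h j js; have [_ ->] := BE j.
  by rewrite /= mulmxA PiE.
have mG : measurable G.
  rewrite (_ : G = \big[setI/setT]_(j <- s) ((fun z : vec R N => sl j *m z : vec R D) @^-1` B j)).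
    apply: bigsetI_measurable => j _; rewrite -[Y in measurable Y]setTI; apply: mmul => //.
    by have [] := BE j.
  rewrite /G; elim: {+}s => [|j s' ih']; first by rewrite big_nil; apply/seteqP; split.
  rewrite big_cons -ih'; apply/seteqP; split => z.
    move=> h; split; first by apply: h; rewrite mem_head.
    by move=> l ls; apply: h; rewrite inE ls orbT.
  by move=> [Bj h] l; rewrite inE => /predU1P[->|/h].
have [mBi Ei] := BE i.
move=> /(_ _ _ mBi mG); rewrite -Ei GE ih// => e.
by rewrite /F !big_cons -/(F s) e EFinM /Pr fineK// fin_num_measure.
Qed.

End canonical.

(** * Kernels realised by fresh randomness *)

Section push_kernel.
Context (R : realType) dx dn dv (X : measurableType dx) (Tn : measurableType dn) (V : measurableType dv).
Variables (mu : probability Tn R) (phi : X * Tn -> V).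
Hypothesis mphi : measurable_fun setT phi.

Let msec x : measurable_fun setT (fun z => phi (x, z)).
Proof. exact: (measurableT_comp mphi (pair1_measurable x)). Qed.

Definition push_kernel (x : X) : {measure set V -> \bar R} :=
  law mu (msec x).

Let measurable_push_kernel A : measurable A -> measurable_fun setT (push_kernel ^~ A).
Proof.
move=> mA.
have mp : measurable (phi @^-1` A) by rewrite -[Y in measurable Y]setTI; exact: mphi.
have := measurable_fun_xsection mu mp; congr measurable_fun.
apply/funext => x /=; rewrite /push_kernel/= [RHS]/(mu _); congr (mu _).
by apply/seteqP; split => z; rewrite /xsection/= inE.
Qed.

HB.instance Definition _ := isKernel.Build _ _ _ _ _ (push_kernel) measurable_push_kernel.

Let push_kernel_prob x : push_kernel x setT = 1%E.
Proof. exact: (probability_setT (law mu (msec x))). Qed.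

HB.instance Definition _ := Kernel_isProbability.Build _ _ _ _ _ (push_kernel) push_kernel_prob.

Lemma push_kernelE x A : push_kernel x A = mu ((fun z => phi (x, z)) @^-1` A).
Proof. by []. Qed.

End push_kernel.

Section fresh_sampling.
Context (R : realType) d (Om : measurableType d) (P : probability Om R).

Lemma sub_ev_sigma d' (T' : measurableType d') (Z : Om -> T') G :
  G `<=` ev Z -> <<s G >> `<=` ev Z.
Proof.
move=> GZ; apply: smallest_sub => //; split.
- by exists set0 => //; rewrite preimage_set0.
- move=> _ [A mA ->]; exists (~` A); first exact: measurableC.
  by rewrite setTD preimage_setC.
- move=> F FZ.
  have /choice[A AE] : forall n, exists A, measurable A /\ F n = Z @^-1` A.
    by move=> n; have [A mA e] := FZ n; exists A.
  exists (\bigcup_n A n); first by apply: bigcupT_measurable => n; case: (AE n).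
  by rewrite preimage_bigcup; apply: eq_bigcupr => n _; case: (AE n).
Qed.

(** A deterministic function of the past and an independent [zeta] is a draw from the pushed-forward
    kernel; [Z] stands for everything conditioned upon, and integrating out [zeta] first proves
    it. *)
Lemma fresh_samples dx dn dv dz (X : measurableType dx) (Tn : measurableType dn)
    (V : measurableType dv) (Tz : measurableType dz) (mu : probability Tn R)
    (phi : X * Tn -> V) (mphi : measurable_fun setT phi)
    (Z : Om -> Tz) (f : Tz -> X) (zeta : Om -> Tn) G :
  measurable_fun setT Z -> measurable_fun setT f -> measurable_fun setT zeta ->
  indep2 P Z zeta -> (forall E, measurable E -> P (zeta @^-1` E) = mu E) -> G `<=` ev Z ->
  samples_from P (fun w => f (Z w)) (push_kernel mu mphi) (fun w => phi (f (Z w), zeta w)) G.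
Proof.
move=> mZ mf mzeta iZ zlaw GZ A mA E /(sub_ev_sigma GZ)[B mB ->].
have mpA : measurable (phi @^-1` A) by rewrite -[Y in measurable Y]setTI; exact: mphi.
pose h (z : Tz * Tn) : \bar R := ((\1_B z.1)%:E * (\1_(phi @^-1` A) (f z.1, z.2))%:E)%E.
have mpair : measurable_fun setT (fun z : Tz * Tn => (f z.1, z.2)).
  by apply: measurable_fun_pair => //; exact: (measurableT_comp mf measurable_fst).
have mh : measurable_fun setT h.
  apply: emeasurable_funM; apply/measurable_EFinP.
    exact: (measurableT_comp (measurable_indic mB) measurable_fst).
  exact: (measurableT_comp (measurable_indic mpA) mpair).
have h0 z : (0 <= h z)%E by rewrite mule_ge0// lee_fin.
have mV : measurable_fun setT (fun w => phi (f (Z w), zeta w)).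
  apply: (measurableT_comp mphi); apply: measurable_fun_pair => //.
  exact: (measurableT_comp mf mZ).
have mZB : measurable (Z @^-1` B) by rewrite -[Y in measurable Y]setTI; exact: mZ.
have mVA : measurable ((fun w => phi (f (Z w), zeta w)) @^-1` A).
  by rewrite -[Y in measurable Y]setTI; exact: mV.
have -> : P ((fun w => phi (f (Z w), zeta w)) @^-1` A `&` Z @^-1` B) =
    (\int[P]_w h (Z w, zeta w))%E.
  transitivity (\int[P]_w (\1_((fun w => phi (f (Z w), zeta w)) @^-1` A `&` Z @^-1` B) w)%:E)%E.
    by rewrite integral_indic ?setIT//; exact: measurableI.
  apply: eq_integral => w _; rewrite /h/= !indicE in_setI -EFinM -natrM mulnb andbC.
  by congr ((_ && _)%:R%:E); apply/idP/idP => /set_mem ?; exact/mem_set.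
rewrite (indep2_integral mZ mzeta iZ mh h0) [RHS]integral_mkcond; apply: eq_integral => w _.
rewrite patchE.
rewrite -[LHS]/(\int[P]_w2 ((\1_B (Z w))%:E * (\1_(phi @^-1` A) (f (Z w), zeta w2))%:E))%E.
have -> : (w \in Z @^-1` B) = (Z w \in B) by apply/idP/idP => /set_mem ?; exact/mem_set.
have mpA' : measurable ((fun z => phi (f (Z w), z)) @^-1` A).
  by rewrite -[Y in measurable Y]setTI; apply: (measurableT_comp mphi).
case: (boolP (Z w \in B)) => hB; rewrite indicE ?hB ?(negbTE hB).
  rewrite push_kernelE -zlaw//.
  transitivity (\int[P]_w2 (\1_(zeta @^-1` ((fun z => phi (f (Z w), z)) @^-1` A)) w2)%:E)%E.
    apply: eq_integral => w2 _; by rewrite mul1e !indicE.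
  by rewrite integral_indic ?setIT// -[Y in measurable Y]setTI; exact: mzeta.
by under eq_integral do rewrite mul0e; rewrite integral0.
Qed.

Lemma dirac_samples dx dv (X : measurableType dx) (V : measurableType dv) (f : X -> V)
    (mf : measurable_fun setT f) (S : Om -> X) G :
  measurable_fun setT S -> <<s G >> `<=` measurable ->
  samples_from P S (kdirac mf : R.-pker X ~> V) (fun w => f (S w)) G.
Proof.
move=> mS Gm A mA E /Gm mE.
have mfA : measurable ((fun w => f (S w)) @^-1` A).
  by rewrite -[Y in measurable Y]setTI; exact: (measurableT_comp mf mS).
transitivity (\int[P]_(w in E) (\1_((fun w => f (S w)) @^-1` A) w)%:E)%E.
  by rewrite integral_indic.
by apply: eq_integral => w _; rewrite /kdirac/= diracE indicE.
Qed.

End fresh_sampling.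

Section gaussian_kernels.
Context (R : realType).

Lemma affine_gauss_measure n D (b : vec R n) (L : 'M[R]_(n, D)) :
  is_gauss_measure (fun A => std_gauss R D ((fun z => b + L *m z : vec R n) @^-1` A)) b (L *m L^T).
Proof.
have [sym pos] := psd_mulmxT L; split => //; split => // a E mE.
apply: (@char_gauss1 R _ _ (std_gauss R D) (fun z => (a^T *m (b + L *m z)) ord0 ord0)) => //.
  apply: (measurableT_comp (measurable_coord ord0)); apply: measurable_mulmx.
  apply: measurable_addmx => //; apply: measurable_mulmx; exact: measurable_id.
move=> c e.
have := @std_gauss_char R D (fun i => c * (a^T *m L) ord0 i) (c * (a^T *m b) ord0 ord0 + e).
have -> : \sum_(i < D) (c * (a^T *m L) ord0 i) ^+ 2 = c ^+ 2 * (a^T *m (L *m L^T) *m a) ord0 ord0.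
  rewrite mulmxA -mulmxA -[L^T *m a]trmxK trmx_mul trmxK [in RHS]mxE mulr_sumr.
  by apply: eq_bigr => i _; rewrite exprMn [X in _ = _ * (_ * X)]mxE expr2.
move=> <-; apply: eq_Rintegral => z _; congr cos.
rewrite mulmxDr [X in c * X]mxE mulrDr mulmxA -addrA addrCA; congr (_ + _).
by rewrite mxE mulr_sumr; apply: eq_bigr => i _; rewrite mulrA.
Qed.

Lemma dirac_gauss_measure n (b : vec R n) : is_gauss_measure (\d_b : set (vec R n) -> \bar R) b 0.
Proof.
split; first by rewrite trmx0.
split=> [a|a E mE]; first by rewrite mulmx0 mul0mx mxE.
rewrite (_ : (a^T *m 0 *m a) ord0 ord0 = 0) ?mulmx0 ?mul0mx ?[LHS]mxE// /gauss1 eqxx !diracE; congr (_%:R%:E).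
Qed.

End gaussian_kernels.

(** * The canonical environment *)

Section conditional_expectation.
Context (R : realType) d (Om : measurableType d) (P : probability Om R).
Context dh (Th : measurableType dh) (H : Om -> Th).
Hypothesis mH : measurable_fun setT H.

(** [is_cond_cov] supplies its own version of the conditional expectation, which must be matched
    with the filter almost surely. *)
Lemma cond_exp_unique n (X : Om -> vec R n) (g1 g2 : Th -> vec R n) i :
  is_cond_exp P X H g1 -> is_cond_exp P X H g2 ->
  ae_eq P setT (fun w => g1 (H w) i ord0) (fun w => g2 (H w) i ord0).
Proof.
move=> [mg1 [ig1 e1]] [mg2 [ig2 e2]].
pose f (g : Th -> vec R n) (h : Th) : \bar R := (g h i ord0)%:E.
have mf g : measurable_fun setT g -> measurable_fun setT (f g).
  by move=> mg; apply/measurable_EFinP; exact: (measurableT_comp (measurable_coord i) mg).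
have iE g E : measurable_fun setT g -> P.-integrable setT (f g \o H) -> measurable E ->
    (\int[law P mH]_(h in E) f g h = \int[P]_(w in H @^-1` E) f g (H w))%E.
  move=> mg ig mE.
  apply: (integral_pushforward mH (mf _ mg)) => //.
  apply: integrableS ig => //.
  by rewrite -[X in measurable X]setTI; exact: mH.
have [N [mN N0 sN]] : ae_eq (law P mH) setT (f g1) (f g2).
  apply: integral_ae_eq => //.
  - by apply: (integrable_pushforward mH (mf _ mg1)); [exact: ig1|exact: measurableT].
  - exact: mf.
  - by move=> E _ mE; rewrite !iE//; [rewrite -e1//; exact: e2|exact: ig2|exact: ig1].
exists (H @^-1` N); split => //.
  by rewrite -[X in measurable X]setTI; exact: mH.
move=> w /= h; apply: sN => /= h'; apply: h => _.
by have [] := h' I.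
Qed.

End conditional_expectation.

Section canonical_environment.
Context (R : realType) (d m T : nat) (A : 'M[R]_d) (C : 'M[R]_(m, d)).
Variables (S0 Sw : 'M[R]_d) (Sv : 'M[R]_m).
Variables (L0 Lw : 'M[R]_(d, d + m)) (Lv : 'M[R]_(m, d + m)).
Hypotheses (L0E : L0 *m L0^T = S0) (LwE : Lw *m Lw^T = Sw) (LvE : Lv *m Lv^T = Sv).

Local Notation N := ((3 * T).+1 * (d + m))%N.
Local Notation sel := (sel R (d + m) (3 * T).+1).
Local Notation th_mx := (th_mx T A L0 Lw).
Local Notation y_mx := (y_mx T A C L0 Lw Lv).
Local Notation err_mx := (err_mx T A C L0 Lw Lv).
Local Notation bar_mx := (bar_mx T A C L0 Lw Lv).
Local Notation K := (kgain T A C L0 Lw Lv).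
Local Notation hf := (@hfilter R d m A C K _).
Let P := std_gauss R N.

Definition cth t (w : vec R N) : vec R d := th_mx t *m w.
Definition cY t (w : vec R N) : vec R m := y_mx t *m w.

Let gs := @canon_gaussian_system R N.

Lemma measurable_canon n (M : 'M[R]_(n, N)) : measurable_fun setT (fun w : vec R N => M *m w : vec R n).
Proof. by apply: measurable_mulmx; exact: measurable_id. Qed.

Lemma cth_gvec t : (t <= T)%N -> gvec (@canon_rel R N) (cth t) (th_mx t).
Proof. by move=> _; exact: canon_gvec. Qed.

Lemma cY_gvec t : (1 <= t <= T)%N -> gvec (@canon_rel R N) (cY t) (y_mx t).
Proof. by move=> _; exact: canon_gvec. Qed.

(** The hypotheses on [Pc] and [Cb] range over all environments; evaluating them at this one turns
    them into explicit matrices. *)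
Lemma canon_env : env_real P T A C S0 Sw Sv cth cY.
Proof.
have omE t : (fun w => cth t.+1 w - A *m cth t w) = fun w => Lw *m sel (3 * t).+1 *m w.
  apply/funext => w; rewrite /cth /= mulmxDl !mulmxA addrC addKr//.
have nuE t : (fun w => cY t w - C *m cth t w) = fun w => Lv *m sel (3 * t).-1 *m w.
  apply/funext => w; rewrite /cY /cth /y_mx mulmxDl !mulmxA addrC addKr//.
have gv n (L : 'M[R]_(n, d + m)) j : (j < (3 * T).+1)%N ->
    is_gauss_rv P (fun w => L *m sel j *m w : vec R n) 0 (L *m L^T).
  move=> jJ; have <- : L *m sel j *m (L *m sel j)^T = L *m L^T.
    by rewrite trmx_mul mulmxA -(mulmxA L) sel_id// mulmx1.
  exact: canon_gauss_rv.
split => /=.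
- by move=> t; split; exact: measurable_canon.
- by rewrite -L0E; exact: gv.
- by move=> t tT; rewrite omE -LwE; apply: gv; lia.
- by move=> t tT; rewrite nuE -LvE; apply: gv; lia.
pose idx (i : nat) : nat := if i == 0 then 0 else if (i <= T)%N then (3 * i.-1).+1
  else (3 * (i - T)).-1.
have idxJ (i : 'I_(T + T).+1) : (idx i < (3 * T).+1)%N.
  by have := ltn_ord i; rewrite /idx; repeat case: ifP => ?; lia.
have idxI (i j : 'I_(T + T).+1) : i != j -> idx i != idx j.
  apply: contraNneq => e; apply/eqP/val_inj => /=.
  have := ltn_ord i; have := ltn_ord j; move: e; rewrite /idx.
  by repeat case: ifP => ?; lia.
move=> E EE.
apply: (@canon_mutually_independent R N _ (d + m) (fun i : 'I_(T + T).+1 => sel (idx i))).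
- by move=> i; exact: sel_id.
- by move=> i j ij; apply: sel_neq => //; exact: idxI.
move=> i.
have sub n (L : 'M[R]_(n, d + m)) (X : vec R N -> vec R n) j : X = (fun w => L *m sel j *m w) ->
    ev X `<=` ev (fun w : vec R N => sel j *m w : vec R (d + m)).
  move=> -> _ [B mB ->]; exists ((fun z : vec R (d + m) => L *m z : vec R n) @^-1` B).
    by rewrite -[X in measurable X]setTI; apply: measurable_mulmx => //; exact: measurable_id.
  by apply/funext => w /=; rewrite mulmxA.
have := EE i; rewrite /idx; case: ifP => [_|/eqP i0]; first exact: (@sub _ L0).
case: ifP => iT; last exact: (@sub _ Lv).
by apply: (@sub _ Lw); rewrite omE.
Qed.

(** The filtering error has mean zero and is independent of the history, so its integral over any
    history event vanishes. *)
Lemma canon_cond_exp t : (t <= T)%N -> is_cond_exp P (cth t) (hist cY t) hf.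
Proof.
move=> tT; have mH := measurable_hist_le gs cY_gvec tT.
have Gb := filter_gvec gs cY_gvec tT.
have Ge := error_gvec gs cth_gvec cY_gvec tT.
split; first exact: measurable_hfilter.
split=> [i|E mE i]; first exact: (gs_mean gs (Gb i)).1.
have mHE : measurable (hist cY t @^-1` E) by rewrite -[X in measurable X]setTI; exact: mH.
have ith : P.-integrable setT (EFin \o (fun w => cth t w i ord0)).
  exact: (gs_mean gs (cth_gvec tT i)).1.
have ib : P.-integrable setT (EFin \o (fun w => hf (hist cY t w) i ord0)).
  exact: (gs_mean gs (Gb i)).1.
have ind : indep2 P (fun w => cth t w i ord0 - hf (hist cY t w) i ord0)
    (fun w => \1_E (hist cY t w) : R).
  have iH := error_indep_hist gs cth_gvec cY_gvec tT.
  move=> A1 A2 mA1 mA2.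
  have mA1' : measurable ((fun z : vec R d => z i ord0) @^-1` A1).
    by rewrite -[Y in measurable Y]setTI; exact: measurable_coord.
  have mA2' : measurable ((\1_E : _ -> R) @^-1` A2).
    by rewrite -[Y in measurable Y]setTI; exact: measurable_indic.
  have := iH _ _ mA1' mA2'.
  rewrite (_ : (fun w => cth t w - hf (hist cY t w)) @^-1` _ =
    (fun w => cth t w i ord0 - hf (hist cY t w) i ord0) @^-1` A1)//.
  by apply/seteqP; split => w; rewrite /= !mxE.
have m1 : measurable_fun setT (fun w => \1_E (hist cY t w) : R).
  exact: (measurableT_comp (measurable_indic mE) mH).
have me : measurable_fun setT (fun w => cth t w i ord0 - hf (hist cY t w) i ord0).
  by apply: measurable_funB; [case/integrableP: ith|case/integrableP: ib] => /measurable_EFinP.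
have ie : P.-integrable setT (EFin \o (fun w => cth t w i ord0 - hf (hist cY t w) i ord0)).
  exact: integrableRB.
have iM : P.-integrable setT (EFin \o (fun w =>
    (cth t w i ord0 - hf (hist cY t w) i ord0) * \1_E (hist cY t w))).
  apply: (le_integrable measurableT _ _ ie); first by apply/measurable_EFinP; exact: measurable_funM.
  move=> w _ /=; rewrite lee_fin normrM ler_piMr// indicE.
  by case: (_ \in _); rewrite ?normr1 ?normr0.
have i1 : P.-integrable setT (EFin \o (fun w => \1_E (hist cY t w) : R)).
  apply: (@bounded_integrable _ _ _ P _ 1) => // w; rewrite indicE.
  by case: (_ \in _); rewrite ?normr1 ?normr0.
have z := indep2_mul_mean0 me m1 ind ie i1 iM.
have e0 : \int[P]_w (cth t w i ord0 - hf (hist cY t w) i ord0) = 0.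
  have := (gs_mean gs (Ge i)).2; rewrite -[RHS in _ -> RHS]/(_ = _) => <-.
  by apply: eq_Rintegral => w _; rewrite !mxE.
have {z} := z e0.
have rs (X : vec R N -> R) : P.-integrable setT (EFin \o X) ->
    P.-integrable (hist cY t @^-1` E) (EFin \o X) by exact: integrableS.
move=> z.
have : (\int[P]_(w in hist cY t @^-1` E) (cth t w i ord0 - hf (hist cY t w) i ord0)%:E = 0)%E.
  have : (\int[P]_w ((cth t w i ord0 - hf (hist cY t w) i ord0) * \1_E (hist cY t w))%:E = 0)%E.
    by rewrite -[LHS]fineK; [rewrite -[fine _]/(Rintegral P setT _) z|exact: integrable_fin_num iM].
  move=> <-; rewrite [LHS]integral_mkcond; apply: eq_integral => w _; rewrite patchE indicE.
  rewrite (_ : (w \in _) = (hist cY t w \in E)); last by apply/idP/idP => /set_mem ?; exact/mem_set.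
  by case: (_ \in _); rewrite ?mulr1 ?mulr0.
under eq_integral do rewrite EFinB.
rewrite integralB//; [|exact: rs|exact: rs] => /eqP.
rewrite sube_eq ?add0e; [move/eqP => //| |].
  exact: integrable_fin_num (rs _ ith).
by rewrite fin_num_adde_defl// (integrable_fin_num mHE (rs _ ib)).
Qed.

Lemma canon_cond_cov t M : (t <= T)%N -> is_cond_cov P (cth t) (hist cY t) M ->
  M = err_mx t *m (err_mx t)^T.
Proof.
move=> tT [g [gE /(_ setT measurableT) cov]].
have mH := measurable_hist_le gs cY_gvec tT.
have Ge := error_gvec gs cth_gvec cY_gvec tT.
have fE := canon_cond_exp tT.
have mg : measurable_fun setT g by case: gE.
have mth k : measurable_fun setT (fun w => cth t w k ord0).
  exact: (measurableT_comp (measurable_coord k) (measurable_canon _)).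
have mgk k (g' : _ -> vec R d) : measurable_fun setT g' -> measurable_fun setT (fun w => g' (hist cY t w) k ord0).
  by move=> mg'; exact: (measurableT_comp (measurable_coord k) (measurableT_comp mg' mH)).
have mhf := measurable_hfilter A C K (t := t).
apply/matrixP => i j; have := cov i j; rewrite preimage_setT.
rewrite [X in _ = (_ * X)%E]probability_setT mule1 => cij; apply: EFin_inj; rewrite -cij.
rewrite -dotp_row -(gs_cov gs (Ge i) (Ge j)).2 /Rintegral fineK; last first.
  exact: (integrable_fin_num measurableT (gs_cov gs (Ge i) (Ge j)).1).
apply: ae_eq_integral => //.
- by apply/measurable_EFinP; apply: measurable_funM; apply: measurable_funB => //; exact: mgk.
- apply/measurable_EFinP; apply: measurable_funM; [case/integrableP: (gs_mean gs (Ge i)).1|case/integrableP: (gs_mean gs (Ge j)).1] => /measurable_EFinP //.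
have ei := cond_exp_unique mH i gE fE; have ej := cond_exp_unique mH j gE fE.
apply: filterS2 ei ej => w /(_ I) -> /(_ I) -> _.
by rewrite !mxE.
Qed.

Lemma canon_covmx t : (t <= T)%N -> covmx P (fun w => hf (hist cY t w)) = bar_mx t *m (bar_mx t)^T.
Proof.
move=> tT; have Gb := filter_gvec gs cY_gvec tT.
have mean0 i : mean P (fun w => hf (hist cY t w)) i = 0 by exact: (gs_mean gs (Gb i)).2.
apply/matrixP => i j; rewrite mxE !mean0 -dotp_row -(gs_cov gs (Gb i) (Gb j)).2.
by congr fine; apply: eq_integral => w _; rewrite !subr0.
Qed.

End canonical_environment.

(** * Attaining the lower bound *)

Lemma indep2_sym (R : realType) d (T : measurableType d) (P : probability T R) d1 d2
    (T1 : measurableType d1) (T2 : measurableType d2) (X : T -> T1) (Y : T -> T2) :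
  indep2 P X Y -> indep2 P Y X.
Proof. by move=> iXY A B mA mB; rewrite setIC muleC; exact: iXY. Qed.

(** * Functional calculus in a fixed eigenbasis *)

Section spectral.
Context (R : realType) (d : nat) (U : 'M[R]_d).
Hypothesis UU : U^T *m U = 1%:M.

Definition spectral_mx (f : 'I_d -> R) : 'M[R]_d := U *m diag_mx (\row_i f i) *m U^T.

Lemma eq_spectral_mx f g : f =1 g -> spectral_mx f = spectral_mx g.
Proof. by move=> fg; congr (_ *m diag_mx _ *m _); apply/rowP => i; rewrite !mxE. Qed.

Lemma spectral_mxM f g : spectral_mx f *m spectral_mx g = spectral_mx (fun i => f i * g i).
Proof.
rewrite /spectral_mx !mulmxA -(mulmxA _ U^T) UU mulmx1 -(mulmxA U) mulmx_diag.
by congr (_ *m diag_mx _ *m _); apply/rowP => i; rewrite !mxE.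
Qed.

Lemma spectral_mxD f g : spectral_mx f + spectral_mx g = spectral_mx (fun i => f i + g i).
Proof.
rewrite /spectral_mx -mulmxDl -mulmxDr -raddfD.
by congr (_ *m diag_mx _ *m _); apply/rowP => i; rewrite !mxE.
Qed.

Lemma spectral_mxB f g : spectral_mx f - spectral_mx g = spectral_mx (fun i => f i - g i).
Proof.
rewrite /spectral_mx -mulmxBl -mulmxBr -raddfB.
by congr (_ *m diag_mx _ *m _); apply/rowP => i; rewrite !mxE.
Qed.

Lemma spectral_mx1 : spectral_mx (fun=> 1) = 1%:M.
Proof.
rewrite /spectral_mx (_ : diag_mx _ = 1%:M) ?mulmx1 ?(mulmx1C UU)//.
by apply/matrixP => i j; rewrite !mxE.
Qed.

Lemma spectral_mxT f : (spectral_mx f)^T = spectral_mx f.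
Proof. by rewrite /spectral_mx !trmx_mul trmxK tr_diag_mx mulmxA. Qed.

Lemma tr_spectral_mx f : \tr (spectral_mx f) = \sum_i f i.
Proof.
rewrite /spectral_mx mxtrace_mulC mulmxA UU mul1mx mxtrace_diag.
by apply: eq_bigr => i _; rewrite mxE.
Qed.

Lemma spectral_mxV f : (forall i, f i != 0) -> invmx (spectral_mx f) = spectral_mx (fun i => (f i)^-1).
Proof.
move=> f0; have e : spectral_mx (fun i => (f i)^-1) *m spectral_mx f = 1%:M.
  by rewrite spectral_mxM -spectral_mx1; apply: eq_spectral_mx => i; rewrite mulVf.
have [_ u] := mulmx1_unit e.
by rewrite -[LHS]mul1mx -e mulmxK.
Qed.

End spectral.

Section attaining.
Context (R : realType) (d m T : nat) (A : 'M[R]_d) (C : 'M[R]_(m, d)).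
Variables (S0 Sw : 'M[R]_d) (Sv : 'M[R]_m).
Variables (L0 Lw : 'M[R]_(d, d + m)) (Lv : 'M[R]_(m, d + m)).
Hypotheses (L0E : L0 *m L0^T = S0) (LwE : Lw *m Lw^T = Sw) (LvE : Lv *m Lv^T = Sv).

Local Notation N := ((3 * T).+1 * (d + m))%N.
Local Notation sel := (sel R (d + m) (3 * T).+1).
Local Notation th_mx := (th_mx T A L0 Lw).
Local Notation y_mx := (y_mx T A C L0 Lw Lv).
Local Notation err_mx := (err_mx T A C L0 Lw Lv).
Local Notation bar_mx := (bar_mx T A C L0 Lw Lv).
Local Notation K := (kgain T A C L0 Lw Lv).
Local Notation hf := (@hfilter R d m A C K _).
Local Notation cth := (@cth R d m T A L0 Lw).
Local Notation cY := (@cY R d m T A C L0 Lw Lv).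
Local Notation P := (std_gauss R N).
Local Notation gs := (canon_gaussian_system R N).

Variables (B : R) (U : nat -> 'M[R]_d) (lam : nat -> 'rV[R]_d) (D : nat -> R).
Hypotheses (UU : forall t, (1 <= t <= T)%N -> (U t)^T *m U t = 1%:M)
  (barE : forall t, (1 <= t <= T)%N -> bar_mx t *m (bar_mx t)^T = spectral_mx (U t) (lam t ord0))
  (lamD : forall t, (1 <= t <= T)%N -> forall i, D t < lam t ord0 i)
  (D0 : forall t, (1 <= t <= T)%N -> 0 < D t)
  (lnB : forall t, (1 <= t <= T)%N -> \sum_(i < d) ln (lam t ord0 i / D t) = 2 * B).

(** The optimal test channel per eigenvalue: observing lam + n with n = D lam / (lam - D), the
    regression coefficient lam / (lam + n) is 1 - D / lam, the error lam n / (lam + n) is D, and the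
    ratio (lam + n) / n is lam / D. *)
Definition shrinkage t := spectral_mx (U t) (fun i => 1 - D t / lam t ord0 i).
Definition channel_cov t := spectral_mx (U t) (fun i => D t * lam t ord0 i / (lam t ord0 i - D t)).

Let lam0 t : (1 <= t <= T)%N -> forall i, 0 < lam t ord0 i.
Proof. by move=> tT i; exact: lt_trans (D0 tT) (lamD tT i). Qed.

Lemma bar_mx_orth t n (M : 'M[R]_(n, N)) :
  (forall s, (1 <= s <= t)%N -> y_mx s *m M^T = 0) -> bar_mx t *m M^T = 0.
Proof.
elim: t => [|t ih] yM; first by rewrite bar_mx0 mul0mx.
have b0 : bar_mx t *m M^T = 0 by apply: ih => s st; apply: yM; lia.
have y0 : y_mx t.+1 *m M^T = 0 by apply: yM; lia.
have CAb : C *m A *m bar_mx t *m M^T = 0 by rewrite -mulmxA b0 mulmx0.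
by rewrite bar_mxS mulmxDl -(mulmxA A) b0 mulmx0 add0r -(mulmxA (K t)) mulmxBl CAb y0 subrr mulmx0.
Qed.

Lemma canon_hfilter t w : (t <= T)%N -> hf (hist cY t w) = bar_mx t *m w.
Proof.
move=> tT; apply/matrixP => i j; rewrite (ord1 j).
have := filter_gvec gs (@cY_gvec R d m T A C L0 Lw Lv) tT i.
by move=> /(congr1 (fun X : vec R N -> R => X w)) /= ->; rewrite -row_mul mxE.
Qed.

(** In the eigenbasis of [bar_mx t] the noisy estimate is d independent scalar channels; [phi]
    covers both the state itself and the shrunk estimate. *)
Lemma channel_info t (Wc : 'M[R]_(d, N)) ds (Ts : measurableType ds) (phi : vec R d -> Ts) :
  (1 <= t <= T)%N -> Wc *m Wc^T = channel_cov t ->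
  (forall s, (1 <= s <= t)%N -> y_mx s *m Wc^T = 0) -> measurable_fun setT phi ->
  (mutual_info P (fun w => phi ((bar_mx t + Wc) *m w)) (hist cY t) <= B%:E)%E.
Proof.
move=> tT WW yW mphi; have tT' : (t <= T)%N by case/andP: tT.
have mH := measurable_hist_le gs (@cY_gvec R d m T A C L0 Lw Lv) tT'.
pose nv i := D t * lam t ord0 i / (lam t ord0 i - D t).
have nv0 i : 0 < nv i by rewrite divr_gt0 ?subr_gt0 ?lamD// mulr_gt0 ?D0 ?lam0.
have GW : gvec (@canon_rel R N) (fun w => ((U t)^T *m Wc) *m w : vec R d) ((U t)^T *m Wc).
  exact: canon_gvec.
have mU : measurable_fun setT (fun v : vec R d => phi (U t *m v)).
  by apply: (measurableT_comp mphi); apply: measurable_mulmx; exact: measurable_id.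
have diagE f (M : 'M[R]_(d, N)) i j : M *m M^T = spectral_mx (U t) f ->
    dotp (row i ((U t)^T *m M)) (row j ((U t)^T *m M)) = (i == j)%:R * f i.
  move=> Mf; rewrite dotp_row trmx_mul trmxK mulmxA -(mulmxA (U t)^T) Mf /spectral_mx.
  by rewrite !mulmxA UU// mul1mx -mulmxA UU// mulmx1 !mxE mulr_natl.
have ub : forall i j : 'I_d, dotp (row i ((U t)^T *m bar_mx t)) (row j ((U t)^T *m Wc)) = 0.
  move=> i j; rewrite dotp_row trmx_mul trmxK mulmxA -(mulmxA (U t)^T).
  by rewrite (bar_mx_orth yW) mulmx0 mul0mx mxE.
have om_H : indep2 P (hist cY t) (fun w => \col_i ((U t)^T *m Wc *m w) i ord0 : vec R d).
  apply: indep2_sym.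
  rewrite (_ : (fun w => \col_i _) = (fun w => (U t)^T *m Wc *m w)); last first.
    by apply/funext => w; apply/matrixP => i j; rewrite (ord1 j) mxE.
  apply: (gs_indep_hist gs (t := t) _ GW) => s st.
    by apply: cY_gvec; lia.
  rewrite -mulmxA -[Wc *m _]trmxK trmx_mul trmxK yW ?trmx0 ?mulmx0//.
have := @gaussian_channel_info R _ _ P N (@canon_rel R N) gs _ _ (hist cY t) mH d
  (fun i h => ((U t)^T *m hf h) i ord0) (fun i => row i ((U t)^T *m bar_mx t)) (fun i => lam t ord0 i)
  _ _ (fun i j => diagE _ _ i j (barE tT)) (lam0 tT)
  (fun i w => ((U t)^T *m Wc *m w) i ord0) (fun i => row i ((U t)^T *m Wc)) nv
  GW (fun i j => diagE _ _ i j WW) nv0 ub om_H _ Ts (fun v => phi (U t *m v)) mU.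
rewrite (_ : (fun w => phi (U t *m _)) = (fun w => phi ((bar_mx t + Wc) *m w))); last first.
  apply/funext => w; congr phi.
  rewrite (_ : \col_i _ = (U t)^T *m ((bar_mx t + Wc) *m w)).
    by rewrite mulmxA (mulmx1C (UU tT)) mul1mx.
  apply/matrixP => i j; rewrite (ord1 j) [LHS]mxE canon_hfilter//.
  rewrite (_ : (bar_mx t + Wc) *m w = bar_mx t *m w + Wc *m w); last by rewrite mulmxDl.
  rewrite (_ : (U t)^T *m (bar_mx t *m w + Wc *m w) = (U t)^T *m (bar_mx t *m w) + (U t)^T *m Wc *m w).
    by rewrite [RHS]mxE.
  by rewrite mulmxDr -(mulmxA (U t)^T Wc).
rewrite (_ : \sum_(i < d) _ = B).
  apply.
  - move=> i; apply: (measurableT_comp (measurable_coord i)); apply: measurable_mulmx.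
    exact: measurable_hfilter.
  - move=> i; exact: (gvec_mul gs (U t)^T (filter_gvec gs (@cY_gvec R d m T A C L0 Lw Lv) tT') i).
transitivity (\sum_(i < d) 2^-1 * ln (lam t ord0 i / D t)); last first.
  by rewrite -mulr_sumr lnB// mulKf.
apply: eq_bigr => i _; congr (_ * ln _); rewrite /nv; field.
by rewrite subr_eq0 !gt_eqF ?D0 ?lam0 ?lamD.
Qed.

Lemma canon_sqerr n (M1 M2 : 'M[R]_(n, N)) :
  (\int[P]_w (sqerr (M1 *m w : vec R n) (M2 *m w : vec R n))%:E = (\tr ((M1 - M2) *m (M1 - M2)^T))%:E)%E.
Proof.
have G := canon_gvec (M1 - M2).
transitivity (\int[P]_w (\sum_i ((M1 - M2) *m w) i ord0 * ((M1 - M2) *m w) i ord0)%:E)%E.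
  apply: eq_integral => w _; congr EFin; apply: eq_bigr => i _.
  by rewrite mulmxBl expr2 !mxE.
have ii i := (gs_cov gs (G i) (G i)).1.
rewrite -[LHS]fineK; last first.
  by apply: (integrable_fin_num measurableT); exact: (integrableR_sum _ _ ii).
rewrite -[fine _]/(Rintegral P setT _) Rintegral_sum//; congr EFin; apply: eq_bigr => i _.
by rewrite (gs_cov gs (G i) (G i)).2 dotp_row.
Qed.

(** The deviation is the sum of three orthogonal terms: filtering error, shrinkage bias (1 - F) bar
    and passed noise F W. Per eigenvalue the last two contribute D^2 / lam and D (lam - D) / lam,
    which add up to D. *)
Lemma channel_cost t (Wc : 'M[R]_(d, N)) :
  (1 <= t <= T)%N -> Wc *m Wc^T = channel_cov t -> th_mx t *m Wc^T = 0 ->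
  (forall s, (1 <= s <= t)%N -> y_mx s *m Wc^T = 0) ->
  (\int[P]_w (sqerr (cth t w) (shrinkage t *m ((bar_mx t + Wc) *m w)))%:E =
   (\tr (err_mx t *m (err_mx t)^T) + d%:R * D t)%:E)%E.
Proof.
move=> tT WW tW yW; have tT' : (t <= T)%N by case/andP: tT.
have bW := bar_mx_orth yW.
have eW : err_mx t *m Wc^T = 0.
  have -> : err_mx t = th_mx t - bar_mx t by rewrite /bar_mx subKr.
  by rewrite mulmxBl tW bW subrr.
have eb := (err_mx_orth A C L0 Lw Lv tT').1.
under eq_integral do rewrite mulmxA.
rewrite canon_sqerr; congr EFin.
have -> : th_mx t - shrinkage t *m (bar_mx t + Wc) = err_mx t + ((1%:M - shrinkage t) *m bar_mx t - shrinkage t *m Wc).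
  rewrite mulmxBl mul1mx mulmxDr /bar_mx.
  move: (shrinkage t *m (th_mx t - err_mx t)) (shrinkage t *m Wc) (th_mx t) (err_mx t) => a b c e.
  by apply/matrixP => i j; rewrite !mxE; ring.
have FT : (shrinkage t)^T = shrinkage t by exact: spectral_mxT.
have GT : (1%:M - shrinkage t)^T = 1%:M - shrinkage t by rewrite linearB/= FT trmx1.
have be : bar_mx t *m (err_mx t)^T = 0 by apply: trmx_inj; rewrite trmx_mul trmxK eb trmx0.
have We : Wc *m (err_mx t)^T = 0 by apply: trmx_inj; rewrite trmx_mul trmxK eW trmx0.
have Wb : Wc *m (bar_mx t)^T = 0 by apply: trmx_inj; rewrite trmx_mul trmxK bW trmx0.
set X := (1%:M - shrinkage t) *m bar_mx t; set Z := shrinkage t *m Wc.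
have XT : X^T = (bar_mx t)^T *m (1%:M - shrinkage t) by rewrite /X trmx_mul GT.
have ZT : Z^T = Wc^T *m shrinkage t by rewrite /Z trmx_mul FT.
have eX : err_mx t *m X^T = 0 by rewrite XT mulmxA eb mul0mx.
have eZ : err_mx t *m Z^T = 0 by rewrite ZT mulmxA eW mul0mx.
have Xe : X *m (err_mx t)^T = 0 by rewrite /X -mulmxA be mulmx0.
have Ze : Z *m (err_mx t)^T = 0 by rewrite /Z -mulmxA We mulmx0.
have XZ : X *m Z^T = 0 by rewrite ZT /X -mulmxA (mulmxA (bar_mx t)) bW mul0mx mulmx0.
have ZX : Z *m X^T = 0 by rewrite XT /Z -mulmxA (mulmxA Wc) Wb mul0mx mulmx0.
rewrite linearD/= linearB/= mulmxDl !mulmxDr !mulmxN !mulmxBl eX eZ Xe Ze XZ ZX.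
rewrite !(subr0, sub0r, addr0, add0r, oppr0, opprK) mxtraceD; congr (_ + _).
have -> : X *m X^T = (1%:M - shrinkage t) *m spectral_mx (U t) (lam t ord0) *m (1%:M - shrinkage t).
  by rewrite XT /X (mulmxA _ (bar_mx t)^T) -(mulmxA _ (bar_mx t)) barE.
have -> : Z *m Z^T = shrinkage t *m channel_cov t *m shrinkage t.
  by rewrite ZT /Z (mulmxA _ Wc^T) -(mulmxA _ Wc) WW.
rewrite -(spectral_mx1 (UU tT)) /shrinkage /channel_cov !(spectral_mxB, spectral_mxM (UU tT)) spectral_mxD (tr_spectral_mx (UU tT)).
transitivity (\sum_(i < d) D t); last by rewrite sumr_const card_ord mulr_natl.
apply: eq_bigr => i _; field.
by rewrite subr_eq0 !gt_eqF ?D0 ?lam0 ?lamD.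
Qed.

End attaining.

(** * Optimal predictor and optimal agent *)

Section attaining_agents.
Context (R : realType) (d m T : nat) (A : 'M[R]_d) (C : 'M[R]_(m, d)).
Variables (S0 Sw : 'M[R]_d) (Sv : 'M[R]_m).
Variables (L0 Lw : 'M[R]_(d, d + m)) (Lv : 'M[R]_(m, d + m)).
Hypotheses (L0E : L0 *m L0^T = S0) (LwE : Lw *m Lw^T = Sw) (LvE : Lv *m Lv^T = Sv).

Local Notation N := ((3 * T).+1 * (d + m))%N.
Local Notation sel := (sel R (d + m) (3 * T).+1).
Local Notation th_mx := (th_mx T A L0 Lw).
Local Notation y_mx := (y_mx T A C L0 Lw Lv).
Local Notation err_mx := (err_mx T A C L0 Lw Lv).
Local Notation bar_mx := (bar_mx T A C L0 Lw Lv).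
Local Notation K := (kgain T A C L0 Lw Lv).
Local Notation hf := (@hfilter R d m A C K _).
Local Notation cth := (@cth R d m T A L0 Lw).
Local Notation cY := (@cY R d m T A C L0 Lw Lv).
Local Notation P := (std_gauss R N).
Local Notation gs := (canon_gaussian_system R N).

Variables (B : R) (U : nat -> 'M[R]_d) (lam : nat -> 'rV[R]_d) (D : nat -> R).
Hypotheses (UU : forall t, (1 <= t <= T)%N -> (U t)^T *m U t = 1%:M)
  (barE : forall t, (1 <= t <= T)%N -> bar_mx t *m (bar_mx t)^T = spectral_mx (U t) (lam t ord0))
  (lamD : forall t, (1 <= t <= T)%N -> forall i, D t < lam t ord0 i)
  (D0 : forall t, (1 <= t <= T)%N -> 0 < D t)
  (lnB : forall t, (1 <= t <= T)%N -> \sum_(i < d) ln (lam t ord0 i / D t) = 2 * B).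


Local Notation shrinkage := (shrinkage U lam D).
Local Notation channel_cov := (channel_cov U lam D).

(** The sample point with block j erased: whatever does not involve block j is a function of it, so
    it serves as the past when block j supplies the fresh noise. *)
Definition coproj j : 'M[R]_N := 1%:M - (sel j)^T *m sel j.

Lemma coproj_sel j : (j < (3 * T).+1)%N -> coproj j *m (sel j)^T = 0.
Proof. by move=> jJ; rewrite /coproj mulmxBl mul1mx -mulmxA sel_id// mulmx1 subrr. Qed.

Lemma coproj_id n j (M : 'M[R]_(n, N)) : M *m (sel j)^T = 0 -> M *m coproj j = M.
Proof. by move=> M0; rewrite /coproj mulmxBr mulmx1 mulmxA M0 mul0mx subr0. Qed.

Lemma ev_coproj n j (M : 'M[R]_(n, N)) : M *m (sel j)^T = 0 ->
  ev (fun w : vec R N => M *m w : vec R n) `<=` ev (fun w : vec R N => coproj j *m w : vec R N).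
Proof.
move=> M0 _ [E mE ->]; exists ((fun w : vec R N => M *m w : vec R n) @^-1` E).
  by rewrite -[Y in measurable Y]setTI; exact: measurable_canon.
by apply/funext => w /=; rewrite mulmxA coproj_id.
Qed.

Lemma canon_fresh_samples j dx dv (X : measurableType dx) (V : measurableType dv)
    (phi : X * vec R (d + m) -> V) (mphi : measurable_fun setT phi) (f : vec R N -> X)
    (W : vec R N -> X) (S : vec R N -> V) G :
  (j < (3 * T).+1)%N -> measurable_fun setT f ->
  (forall w, W w = f (coproj j *m w)) -> (forall w, S w = phi (W w, sel j *m w)) ->
  G `<=` ev (fun w : vec R N => coproj j *m w : vec R N) ->
  samples_from P W (push_kernel (std_gauss R (d + m)) mphi) S G.
Proof.
move=> jJ mf WE SE GZ.
have -> : S = fun w => phi (f (coproj j *m w), sel j *m w).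
  by apply/funext => w; rewrite SE WE.
have -> : W = fun w => f (coproj j *m w) by apply/funext => w; exact: WE.
refine (@fresh_samples R _ (vec R N) P _ _ _ _ X (vec R (d + m)) V (vec R N) (std_gauss R (d + m))
  phi mphi (fun w => coproj j *m w) f (fun w => sel j *m w) G _ mf _ _ _ GZ).
- exact: measurable_canon.
- exact: measurable_canon.
- by apply: (gs_indep gs (canon_gvec _) (canon_gvec _)); exact: coproj_sel.
- by move=> E mE; apply: canon_law => //; exact: sel_id.
Qed.

Lemma env_coproj t G : (1 <= t <= T)%N -> G `<=` ev (fun w : vec R N => coproj (3 * t) *m w : vec R N) ->
  env_events T cth cY `|` G `<=` ev (fun w : vec R N => coproj (3 * t) *m w : vec R N).
Proof.
move=> tT GE E [[[s /= sT]|[s /= sT]]|]; last exact: GE.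
  by apply: ev_coproj; exact: th_mx_agent.
by apply: ev_coproj; exact: y_mx_agent.
Qed.

Section prediction.
Variable Lr : nat -> 'M[R]_(d, d + m).
Hypothesis LrE : forall t, (1 <= t <= T)%N -> Lr t *m (Lr t)^T = channel_cov t.

Let Wr t : 'M[R]_(d, N) := Lr t *m sel (3 * t).

Let phi t (z : t.-tuple (vec R m) * vec R (d + m)) : vec R d :=
  shrinkage t *m (hf z.1 + Lr t *m z.2).

Let mphi t : measurable_fun setT (@phi t).
Proof.
apply: measurable_mulmx; apply: measurable_addmx.
  exact: (measurableT_comp (measurable_hfilter A C K (t := t)) measurable_fst).
by apply: measurable_mulmx; exact: measurable_snd.
Qed.

(** Each time t uses its own block 3t. The noises need not be linked over time, so no Loewner
    condition is involved here. *)
Lemma prediction_attains :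
  RX_costs T A C S0 Sw Sv B (optimal_cost T A C L0 Lw Lv D)%:E.
Proof.
have WrE t : (1 <= t <= T)%N -> Wr t *m (Wr t)^T = channel_cov t.
  move=> tT; rewrite /Wr trmx_mul mulmxA -(mulmxA (Lr t)) sel_id ?mulmx1 ?LrE//; lia.
have yW t s : (1 <= t <= T)%N -> (1 <= s <= t)%N -> y_mx s *m (Wr t)^T = 0.
  by move=> tT st; rewrite /Wr trmx_mul mulmxA y_mx_agent ?mul0mx//; lia.
have tW t : (1 <= t <= T)%N -> th_mx t *m (Wr t)^T = 0.
  by move=> tT; rewrite /Wr trmx_mul mulmxA th_mx_agent ?mul0mx//; lia.
pose th_hat t (w : vec R N) : vec R d := shrinkage t *m ((bar_mx t + Wr t) *m w).
exists (fun t => push_kernel (std_gauss R (d + m)) (@mphi t)), _, (vec R N), P, cth, cY, th_hat.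
split.
- exact: (canon_env T A C L0E LwE LvE).
- by move=> t; apply: measurable_mulmx; exact: measurable_canon.
- move=> t tT; have tT' : (t <= T)%N by case/andP: tT.
  apply: (@canon_fresh_samples (3 * t) _ _ _ _ _ _ (hist cY t)).
  + by lia.
  + exact: (measurable_hist_le gs (@cY_gvec R d m T A C L0 Lw Lv) tT').
  + move=> w; apply: eq_from_tnth => i; rewrite !tnth_mktuple /cY mulmxA coproj_id//.
    by apply: y_mx_agent => //; have := ltn_ord i; lia.
  + by move=> w; rewrite /phi/= canon_hfilter// /th_hat /Wr mulmxDl mulmxA.
  + apply: env_coproj => // E [s /= st].
    rewrite (_ : th_hat s = fun w => shrinkage s *m (bar_mx s + Wr s) *m w); last first.
      by apply/funext => w; rewrite /th_hat mulmxA.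
    apply: ev_coproj; rewrite -mulmxA mulmxDl bar_mx_fresh ?add0r; [|lia|lia].
    by rewrite /Wr -!mulmxA sel_neq ?mulmx0//; lia.
- move=> t tT.
  refine (@channel_info R d m T A C L0 Lw Lv B U lam D UU barE lamD D0 lnB t (Wr t) _ (vec R d)
    (fun v => shrinkage t *m v) tT (WrE t tT) (fun s st => yW t s tT st) _).
  by apply: measurable_mulmx; exact: measurable_id.
- rewrite /total_cost /optimal_cost -sumEFin big_nat_cond [RHS]big_nat_cond.
  apply: eq_bigr => t; rewrite andbT => tT.
  by rewrite (@channel_cost R d m T A C L0 Lw Lv U lam D UU barE lamD D0 t (Wr t) tT (WrE _ tT) (tW _ tT))// => s st; exact: yW.
Qed.

End prediction.

Section agent.
Variable Lq : nat -> 'M[R]_(d, d + m).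

(** Solving the filter recursion for the old estimate gives A b + K (y - C A b) = (I - K C) A b + K
    y; run on a noisy state, the old noise is multiplied by the same matrix. *)
Definition agent_mx t := (1%:M - K t *m C) *m A.

Hypotheses (Lq0 : Lq 0 *m (Lq 0)^T = channel_cov 1)
  (LqE : forall t, (1 <= t < T)%N ->
    Lq t *m (Lq t)^T = channel_cov t.+1 - agent_mx t *m channel_cov t *m (agent_mx t)^T).

Fixpoint noise_mx t : 'M[R]_(d, N) :=
  if t is s.+1 then agent_mx s *m noise_mx s + Lq s *m sel (3 * s.+1) else 0.
Definition state_mx t := bar_mx t + noise_mx t.

Lemma state_mxS t : state_mx t.+1 = agent_mx t *m state_mx t + K t *m y_mx t.+1 + Lq t *m sel (3 * t.+1).
Proof.
rewrite /state_mx bar_mxS /= /agent_mx; move: (bar_mx t) (noise_mx t) (y_mx t.+1) (Lq t *m _) => b n y l.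
rewrite mulmxBr !mulmxDr !mulmxBl !mul1mx !mulmxA.
move: (A *m b) (K t *m y) (K t *m C *m A *m b) (K t *m C *m A *m n) (A *m n) => a c e f g.
by apply/matrixP => i j; rewrite !mxE; ring.
Qed.

Lemma noise_mx_fresh t j : (t < j <= T)%N -> noise_mx t *m (sel (3 * j))^T = 0.
Proof.
elim: t => [|t ih] tj /=; first by rewrite mul0mx.
by rewrite mulmxDl -!mulmxA ih ?sel_neq ?mulmx0 ?addr0//; lia.
Qed.

Lemma noise_mx_orth n (M : 'M[R]_(n, N)) t : (t <= T)%N ->
  (forall j, (0 < j <= T)%N -> M *m (sel (3 * j))^T = 0) -> M *m (noise_mx t)^T = 0.
Proof.
move=> tT M0; elim: t tT => [|t ih] tT /=; first by rewrite trmx0 mulmx0.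
rewrite linearD/= !trmx_mul mulmxDr (mulmxA M) ih ?(ltnW tT)// mul0mx (mulmxA M) M0 ?mul0mx ?addr0//; lia.
Qed.

(** The private noise injected at each step is exactly what the propagated noise lacks to reach
    [channel_cov]; at time 0 the state is constant, so the first injection supplies it all. *)
Lemma noise_mx_cov t : (1 <= t <= T)%N -> noise_mx t *m (noise_mx t)^T = channel_cov t.
Proof.
case: t => // t; elim: t => [|t ih] tT.
  rewrite /= mulmx0 add0r trmx_mul mulmxA -(mulmxA (Lq 0)) sel_id ?mulmx1 ?Lq0//; lia.
have {}ih : noise_mx t.+1 *m (noise_mx t.+1)^T = channel_cov t.+1 by apply: ih; lia.
have f : noise_mx t.+1 *m (sel (3 * t.+2))^T = 0 by apply: noise_mx_fresh; lia.
have f' : sel (3 * t.+2) *m (noise_mx t.+1)^T = 0.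
  by apply: trmx_inj; rewrite trmx_mul trmxK f trmx0.
have -> : noise_mx t.+2 = agent_mx t.+1 *m noise_mx t.+1 + Lq t.+1 *m sel (3 * t.+2) by [].
move: (noise_mx t.+1) ih f f' => W ih f f'.
rewrite linearD/= (trmx_mul (agent_mx _)) (trmx_mul (Lq _)) mulmxDl !mulmxDr.
have e1 : agent_mx t.+1 *m W *m (W^T *m (agent_mx t.+1)^T) =
    agent_mx t.+1 *m channel_cov t.+1 *m (agent_mx t.+1)^T.
  by rewrite (mulmxA _ W^T) -(mulmxA _ W) ih.
have e2 : agent_mx t.+1 *m W *m ((sel (3 * t.+2))^T *m (Lq t.+1)^T) = 0.
  by rewrite (mulmxA _ (sel _)^T) -(mulmxA _ W) f mulmx0 mul0mx.
have e3 : Lq t.+1 *m sel (3 * t.+2) *m (W^T *m (agent_mx t.+1)^T) = 0.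
  by rewrite (mulmxA _ W^T) -(mulmxA _ (sel _)) f' mulmx0 mul0mx.
have e4 : Lq t.+1 *m sel (3 * t.+2) *m ((sel (3 * t.+2))^T *m (Lq t.+1)^T) = Lq t.+1 *m (Lq t.+1)^T.
  by rewrite (mulmxA _ (sel _)^T) -(mulmxA _ (sel _)) sel_id ?mulmx1//; lia.
rewrite e1 e2 e3 e4 addr0 add0r LqE; last by lia.
by rewrite addrC subrK.
Qed.

Let phi t (z : (vec R d * vec R m) * vec R (d + m)) : vec R d :=
  agent_mx t *m z.1.1 + K t *m z.1.2 + Lq t *m z.2.

Let mphi t : measurable_fun setT (phi t).
Proof.
apply: measurable_addmx; last by apply: measurable_mulmx; exact: measurable_snd.
apply: measurable_addmx; apply: measurable_mulmx.
  exact: (measurableT_comp measurable_fst measurable_fst).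
exact: (measurableT_comp measurable_snd measurable_fst).
Qed.

Let mF t : measurable_fun setT (fun s : vec R d => shrinkage t *m s : vec R d).
Proof. by apply: measurable_mulmx; exact: measurable_id. Qed.

Lemma agent_attains : exists (p : nat -> R.-pker (vec R d * vec R m)%type ~> vec R d)
    (q : nat -> R.-pker (vec R d) ~> vec R d),
  lin_gauss_agent p q /\
  agent_costs T A C S0 Sw Sv B (0 : vec R d) p q (optimal_cost T A C L0 Lw Lv D)%:E.
Proof.
pose p t : R.-pker (vec R d * vec R m)%type ~> vec R d := push_kernel (std_gauss R (d + m)) (mphi t).
pose q t : R.-pker (vec R d) ~> vec R d := kdirac (mF t).
exists p, q; split.
  exists agent_mx, K, (fun t => Lq t *m (Lq t)^T), shrinkage, (fun=> 0); split => [t s y|t s].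
    exact: (affine_gauss_measure (agent_mx t *m s + K t *m y) (Lq t)).
  exact: (dirac_gauss_measure (shrinkage t *m s)).
pose S t (w : vec R N) : vec R d := state_mx t *m w.
pose th_hat t (w : vec R N) : vec R d := shrinkage t *m S t w.
have yW t s : (t <= T)%N -> (1 <= s <= T)%N -> y_mx s *m (noise_mx t)^T = 0.
  by move=> tT st; apply: noise_mx_orth => // j jT; exact: y_mx_agent.
have tW t : (t <= T)%N -> th_mx t *m (noise_mx t)^T = 0.
  by move=> tT; apply: noise_mx_orth => // j jT; exact: th_mx_agent.
have S_fresh s t : (s <= t)%N -> (t < T)%N -> state_mx s *m (sel (3 * t.+1))^T = 0.
  move=> st tT; rewrite /state_mx mulmxDl bar_mx_fresh ?noise_mx_fresh ?addr0//; lia.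
have hE s : th_hat s = fun w => shrinkage s *m state_mx s *m w.
  by apply/funext => w; rewrite /th_hat /S mulmxA.
have mS t : measurable_fun setT (S t) by exact: measurable_canon.
have mh t : measurable_fun setT (th_hat t) by rewrite hE; exact: measurable_canon.
exists _, (vec R N), P, cth, cY, S, th_hat; split.
- split.
  + exact: (canon_env T A C L0E LwE LvE).
  + by move=> t.
  + by move=> w; rewrite /S /state_mx /= bar_mx0 addr0 mul0mx.
  + move=> t tT.
    have yf : y_mx t.+1 *m (sel (3 * t.+1))^T = 0 by apply: y_mx_agent; lia.
    apply: (@canon_fresh_samples (3 * t.+1) _ _ _ _ _ _ (fun w => (S t w, cY t.+1 w))).
    * by lia.
    * by apply: measurable_fun_pair => //; exact: measurable_canon.
    * by move=> w; rewrite /S /cY !mulmxA !coproj_id// S_fresh.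
    * move=> w; rewrite /phi /S /cY state_mxS (mulmxDl (_ + _)) (mulmxDl (agent_mx _ *m _)).
      by rewrite -(mulmxA (agent_mx t)) -(mulmxA (K t)) -(mulmxA (Lq t)).
    * rewrite -setUA; apply: env_coproj; first by lia.
      move=> E [[s /= st]|[s /= st]]; first by apply: ev_coproj; exact: S_fresh.
      by rewrite hE; apply: ev_coproj; rewrite -mulmxA S_fresh ?mulmx0//; lia.
  + move=> t tT; apply: dirac_samples => //.
    apply: smallest_sub; first exact: sigma_algebra_measurable.
    have evm n (X : vec R N -> vec R n) : measurable_fun setT X -> ev X `<=` measurable.
      by move=> mX _ [E mE ->]; rewrite -[Y in measurable Y]setTI; exact: mX.
    move=> E [[[[s _]|[s _]]|[s _]]|[s _]]; apply: evm => //; exact: measurable_canon.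
- move=> t tT; have tT' : (t <= T)%N by case/andP: tT.
  refine (@channel_info R d m T A C L0 Lw Lv B U lam D UU barE lamD D0 lnB t (noise_mx t) _ (vec R d)
    id tT (noise_mx_cov tT) _ (@measurable_id _ _ _)).
  by move=> s st; apply: yW => //; lia.
- rewrite /total_cost /optimal_cost -sumEFin big_nat_cond [RHS]big_nat_cond.
  apply: eq_bigr => t; rewrite andbT => tT; have tT' : (t <= T)%N by case/andP: tT.
  rewrite (@channel_cost R d m T A C L0 Lw Lv U lam D UU barE lamD D0 t (noise_mx t) tT (noise_mx_cov tT) (tW _ tT'))// => s st.
  by apply: yW => //; lia.
Qed.

End agent.

End attaining_agents.

Lemma loewner_psd (R : realType) n (X Y M : 'M[R]_n) : X^T = X -> Y^T = Y ->
  loewner_le (M *m Y *m M^T) X -> psd (X - M *m Y *m M^T).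
Proof.
move=> XT YT le; split; first by rewrite linearB/= !trmx_mul trmxK XT YT mulmxA.
by move=> a; rewrite mulmxBr mulmxBl mxE [X in _ + X]mxE subr_ge0; exact: le.
Qed.

Section water_filling.
Context (R : realType) (d : nat) (lam : 'rV[R]_d) (eta : R).
Hypothesis eta0 : 0 < eta.

(** An inactive component would put 1 - exp 0 = 0 on the diagonal of [DFmx], so invertibility makes
    all logarithms strictly positive and removes the positive parts. *)
Lemma water_filling_active : DFmx lam eta \in unitmx -> forall i,
  [/\ eta / 2 < lam ord0 i,
      expR (- (2 * Bti (lam ord0 i) eta)) = (eta / 2) / lam ord0 i &
      pos_part (ln (2 * lam ord0 i / eta)) = ln (lam ord0 i / (eta / 2))].
Proof.
rewrite unitmxE det_diag unitfE prodf_seq_neq0 => /allP h i.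
have := h i; rewrite mem_index_enum => /(_ isT); rewrite /= mxE => {}h.
set x := 2 * lam ord0 i / eta.
have x1 : 1 < x.
  rewrite ltNge; apply: contraNN h => x1.
  have lx : ln x <= 0 by have [x0|x0] := leP x 0; [rewrite ln0|exact: ln_le0].
  by rewrite /Bti -/x /pos_part (max_r lx) !mulr0 oppr0 expR0 subrr.
have x0 : 0 < x by exact: lt_trans x1.
have xE : x = lam ord0 i / (eta / 2) by rewrite /x; field; rewrite gt_eqF.
have l0 : eta / 2 < lam ord0 i.
  by move: x1; rewrite xE ltr_pdivlMr ?divr_gt0// mul1r.
have lx : 0 <= ln x by rewrite ln_ge0// ltW.
have px : pos_part (ln x) = ln x by exact: max_l.
split => //; last by rewrite px xE.
rewrite /Bti -/x px mulrA mulfV// mul1r expRN lnK ?posrE// xE invf_div//.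
Qed.

End water_filling.

Theorem theorem3 (R : realType) (d m T : nat) (B : R)
  (A : 'M[R]_d) (C : 'M[R]_(m, d)) (S0 Sw : 'M[R]_d) (Sv : 'M[R]_m)
  (Pc Cb : nat -> 'M[R]_d) (U : nat -> 'M[R]_d) (lam : nat -> 'rV[R]_d)
  (eta : nat -> R) :
  (1 <= T)%N -> 0 <= B ->
  psd S0 -> psd Sw -> psd Sv ->
  (* Pc t = Cov[theta_t | H_t] (deterministic) *)
  (forall (dO : measure_display) (Om : measurableType dO) (P : probability Om R)
          (th : nat -> Om -> vec R d) (Y : nat -> Om -> vec R m),
      env_real P T A C S0 Sw Sv th Y ->
      forall t, (1 <= t <= T)%N -> is_cond_cov P (th t) (hist Y t) (Pc t)) ->
  (* Cb t = Cov[ bar theta_t ],  bar theta_t = E[theta_t | H_t] *)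
  (forall (dO : measure_display) (Om : measurableType dO) (P : probability Om R)
          (th : nat -> Om -> vec R d) (Y : nat -> Om -> vec R m),
      env_real P T A C S0 Sw Sv th Y ->
      forall t, (1 <= t <= T)%N ->
      forall g, is_cond_exp P (th t) (hist Y t) g ->
        covmx P (fun w => g (hist Y t w)) = Cb t) ->
  (* eigen-decomposition of Cb t *)
  (forall t, (1 <= t <= T)%N ->
     (U t)^T *m U t = 1%:M /\ Cb t = U t *m diag_mx (lam t) *m (U t)^T) ->
  (* eta_t solves sum_i [log(2 lam_ti / eta)]^+ = 2B *)
  (forall t, (1 <= t <= T)%N ->
     0 < eta t /\
     \sum_(i < d) pos_part (ln (2 * lam t ord0 i / eta t)) = 2 * B) ->
  let F t := U t *m DFmx (lam t) (eta t) *m (U t)^T in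
  let Psi t := U t *m DPsimx (lam t) (eta t) *m (U t)^T in
  let Pt t := A *m Pc t *m A^T + Sw in
  let Sinv t := invmx (C *m Pt t *m C^T + Sv) in
  (* implicit in the formula: the matrices being inverted are invertible *)
  (forall t, (1 <= t < T)%N -> (C *m Pt t *m C^T + Sv) \in unitmx) ->
  (* assumption (1) *)
  (forall t, (1 <= t <= T)%N -> F t \in unitmx) ->
  (* assumption (2) *)
  (forall t, (1 <= t < T)%N ->
     loewner_le
       ((1%:M - Pt t *m C^T *m Sinv t *m C) *m A *m invmx (F t) *m Psi t
          *m invmx (F t) *m A^T *m (1%:M - C^T *m Sinv t *m C *m Pt t))
       (invmx (F t.+1) *m Psi t.+1 *m invmx (F t.+1))) ->
  exists (k : nat)
         (p : nat -> R.-pker (vec R k * vec R m)%type ~> vec R k)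
         (q : nat -> R.-pker (vec R k) ~> vec R d) (c : \bar R),
    [/\ lin_gauss_agent p q,
        agent_costs T A C S0 Sw Sv B (0 : vec R k) p q c,
        c = ereal_inf (CL_costs T A C S0 Sw Sv B) &
        c = ereal_inf (RX_costs T A C S0 Sw Sv B)].
Proof.
move=> T1 B0 pS0 pSw pSv HPc HCb Heig Heta F Psi Pt Sinv unitS unitF lo.
(* Factors are padded with zero columns to width d + m, the common block size of the frame. *)
have rowE (S : 'M[R]_d) : psd S -> exists L : 'M[R]_(d, d + m), L *m L^T = S.
  move=> /psd_factor[L LE]; exists (row_mx L 0).
  by rewrite tr_row_mx mul_row_col trmx0 mulmx0 addr0.
have [L0 L0E] := rowE _ pS0; have [Lw LwE] := rowE _ pSw.
have [Lv LvE] : exists L : 'M[R]_(m, d + m), L *m L^T = Sv.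
  have [L LE] := psd_factor pSv; exists (row_mx 0 L).
  by rewrite tr_row_mx mul_row_col trmx0 mulmx0 add0r.
pose errT := err_mx T A C L0 Lw Lv; pose barT := bar_mx T A C L0 Lw Lv; pose KT := kgain T A C L0 Lw Lv.
have env := canon_env T A C L0E LwE LvE.
have PcE t : (1 <= t <= T)%N -> Pc t = errT t *m (errT t)^T.
  move=> tT; apply: canon_cond_cov; first by case/andP: tT.
  exact: HPc.
have CbE t : (1 <= t <= T)%N -> barT t *m (barT t)^T = Cb t.
  move=> tT; have tT' : (t <= T)%N by case/andP: tT.
  rewrite -(HCb _ _ _ _ _ env t tT _ (canon_cond_exp A C L0 Lw Lv tT')).
  by rewrite canon_covmx.
have UU t (tT : (1 <= t <= T)%N) : (U t)^T *m U t = 1%:M by case: (Heig t tT).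
pose D t := eta t / 2.
have D0 t (tT : (1 <= t <= T)%N) : 0 < D t by rewrite divr_gt0//; case: (Heta t tT).
have active t (tT : (1 <= t <= T)%N) := @water_filling_active R d (lam t) _ (Heta t tT).1.
have DFu t (tT : (1 <= t <= T)%N) : DFmx (lam t) (eta t) \in unitmx.
  by have := unitF t tT; rewrite /F !unitmx_mul => /andP[/andP[]].
have lamD t (tT : (1 <= t <= T)%N) i : D t < lam t ord0 i.
  by case: (active t tT (DFu t tT) i).
have lam0 t (tT : (1 <= t <= T)%N) i : 0 < lam t ord0 i.
  exact: lt_trans (D0 t tT) (lamD t tT i).
have lnB t (tT : (1 <= t <= T)%N) : \sum_(i < d) ln (lam t ord0 i / D t) = 2 * B.
  rewrite -(Heta t tT).2; apply: eq_bigr => i _.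
  by case: (active t tT (DFu t tT) i).
have barE t (tT : (1 <= t <= T)%N) : barT t *m (barT t)^T = U t *m diag_mx (lam t) *m (U t)^T.
  by rewrite CbE//; case: (Heig t tT).
have barE' t (tT : (1 <= t <= T)%N) : barT t *m (barT t)^T = spectral_mx (U t) (lam t ord0).
  rewrite barE// /spectral_mx; congr (_ *m diag_mx _ *m _).
  by apply/rowP => i; rewrite mxE.
have FE t (tT : (1 <= t <= T)%N) : F t = spectral_mx (U t) (fun i => 1 - D t / lam t ord0 i).
  rewrite /F /spectral_mx /DFmx; congr (_ *m diag_mx _ *m _).
  by apply/rowP => i; rewrite !mxE; case: (active t tT (DFu t tT) i) => _ ->.
have PsiE t (tT : (1 <= t <= T)%N) :
    Psi t = spectral_mx (U t) (fun i => (1 - D t / lam t ord0 i) * (D t / lam t ord0 i) * lam t ord0 i).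
  rewrite /Psi /spectral_mx /DPsimx; congr (_ *m diag_mx _ *m _).
  by apply/rowP => i; rewrite !mxE; case: (active t tT (DFu t tT) i) => _ ->.
pose W := channel_cov U lam D.
(* The matrices compared in assumption (2) are the noise covariances of the optimal channel. *)
have WE t (tT : (1 <= t <= T)%N) : invmx (F t) *m Psi t *m invmx (F t) = W t.
  have nz i : lam t ord0 i - D t != 0 by rewrite subr_eq0 gt_eqF// lamD.
  have lz i : lam t ord0 i != 0 by rewrite gt_eqF// lam0.
  have Fz i : 1 - D t / lam t ord0 i != 0.
    by rewrite -(mulfV (lz i)) -mulrBl mulf_neq0// invr_neq0.
  rewrite FE// PsiE// spectral_mxV// ?UU// !spectral_mxM ?UU//.
  by apply: eq_spectral_mx => i; field; rewrite nz lz.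
have Wsq t (tT : (1 <= t <= T)%N) : exists L : 'M[R]_(d, d + m), L *m L^T = W t.
  apply: rowE.
  suff -> : W t = spectral_mx (U t) (fun i => Num.sqrt (D t * lam t ord0 i / (lam t ord0 i - D t))) *m
      (spectral_mx (U t) (fun i => Num.sqrt (D t * lam t ord0 i / (lam t ord0 i - D t))))^T.
    exact: psd_mulmxT.
  rewrite spectral_mxT spectral_mxM ?UU//; apply: eq_spectral_mx => i.
  rewrite -expr2 sqr_sqrtr//; apply: divr_ge0.
    by apply: mulr_ge0; apply: ltW; [exact: D0|exact: lam0].
  by rewrite subr_ge0; apply: ltW; exact: lamD.
(* For these t the innovation covariance is invertible, so the gain takes its classical form. At t =
   0 the pseudo-inverse gain is kept, as the first state needs no such formula. *)
have KE t : (1 <= t < T)%N -> KT t = Pt t *m C^T *m Sinv t.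
  move=> tT; have tT1 : (1 <= t <= T)%N by lia.
  have tT2 : (t < T)%N by lia.
  have := gain_normal T A C L0 Lw Lv t.
  have [-> ->] := innov_mx_cov A C L0 Lw Lv tT2.
  rewrite (pred_mx_cov A C L0 Lw Lv tT2) LwE LvE -(PcE _ tT1) -/(Pt t) -/(KT t) => <-.
  by rewrite /Sinv mulmxK// unitS.
have /choice[Lr LrE] : forall t, exists L : 'M[R]_(d, d + m), (1 <= t <= T)%N -> L *m L^T = W t.
  move=> t; case: (boolP (1 <= t <= T)%N) => [tT|_]; last by exists 0.
  by have [L LE] := Wsq t tT; exists L.
have PtS t : (1 <= t <= T)%N -> (Pt t)^T = Pt t.
  move=> tT; rewrite /Pt linearD/= !trmx_mul trmxK PcE// trmx_mul trmxK.
  by rewrite -LwE trmx_mul trmxK !mulmxA.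
have SvS : Sv^T = Sv by case: pSv.
pose M t := (1%:M - KT t *m C) *m A.
(* Assumption (2) read as positivity of the noise to be injected; the last factor of its left-hand
   side is the transpose of the first because [Pt] and [Sinv] are symmetric. *)
have Qpsd t : (1 <= t < T)%N -> psd (W t.+1 - M t *m W t *m (M t)^T).
  move=> tT; have tT1 : (1 <= t <= T)%N by lia.
  have tT2 : (1 <= t.+1 <= T)%N by lia.
  have WT s : (W s)^T = W s by exact: spectral_mxT.
  apply: loewner_psd; rewrite ?WT//.
  move=> x; have := lo t tT x.
  rewrite WE//.
  have SinvT : (Sinv t)^T = Sinv t.
    by rewrite /Sinv trmx_inv linearD/= !trmx_mul trmxK PtS// SvS !mulmxA.
  have MT : (M t)^T = A^T *m (1%:M - C^T *m Sinv t *m C *m Pt t).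
    rewrite /M trmx_mul linearB/= trmx1 trmx_mul KE// !trmx_mul trmxK SinvT PtS//.
    by rewrite !mulmxA.
  rewrite (_ : _ *m A *m invmx (F t) *m _ *m _ *m _ *m _ = M t *m W t *m (M t)^T); last first.
    by rewrite MT -WE// /M KE// !mulmxA.
  by [].
have /choice[Lq LqE] : forall t, exists L : 'M[R]_(d, d + m),
    (t = 0%N -> L *m L^T = W 1) /\
    ((1 <= t < T)%N -> L *m L^T = W t.+1 - M t *m W t *m (M t)^T).
  case=> [|t]; first by have [L LE] := Wsq 1%N T1; exists L.
  case: (boolP (1 <= t.+1 < T)%N) => [tT|_]; last by exists 0.
  by have [L LE] := rowE _ (Qpsd _ tT); exists L.
have [p [q [lin att]]] := @agent_attains R d m T A C S0 Sw Sv L0 Lw Lv L0E LwE LvE B U lam D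
  UU barE' lamD D0 lnB Lq ((LqE 0%N).1 erefl) (fun t => (LqE t).2).
have pred := @prediction_attains R d m T A C S0 Sw Sv L0 Lw Lv L0E LwE LvE B U lam D
  UU barE' lamD D0 lnB Lr LrE.
exists d, p, q, (optimal_cost T A C L0 Lw Lv D)%:E; split => //.
(* The same number bounds both cost sets from below and belongs to both, so it is each infimum. *)
- apply/eqP; rewrite eq_le; apply/andP; split; last first.
    by apply: ereal_inf_lbound; exists _, (vec R d), 0, p, q.
  apply: le_ereal_inf_tmp => _ [dx [X [x0 [p' [q' [dO [Om [P [th [Y [S [th_hat [ag MI ->]]]]]]]]]]]]].
  have env' : env_real P T A C S0 Sw Sv th Y by case: ag.
  exact: (agent_lower L0E LwE LvE UU barE lam0 D0 lnB env' ag MI).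
- apply/eqP; rewrite eq_le; apply/andP; split; last exact: ereal_inf_lbound.
  apply: le_ereal_inf_tmp => _ [q' [dO [Om [P [th [Y [th_hat [env' mh smp MI ->]]]]]]]].
  exact: (prediction_lower L0E LwE LvE UU barE lam0 D0 lnB env' mh smp MI).
Qed.
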